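(* Assume the structural assumptions (a)–(d) of the context: smoothness, parabolicity in $U_{II}$, positive hyperbolic speeds in $U_I$, and symmetrizability. Then almost-constant steady solutions with almost-constant data exist and are locally unique, nondegenerate, and spectrally stable. Precisely: for every $U_0=(U_{0I},U_{0II})\in\mathcal U$ there exist $\delta>0$ and $\varepsilon>0$ such that for every $U_{1II}\in\mathbb R^{n-r}$ with $|U_{0II}-U_{1II}|\le\delta$ there is a unique solution $\hat U:[0,1]\to\mathcal U$ of $$ (f(\hat U))_x=(B(\hat U)\hat U_x)_x\ \ (0<x<1),\qquad \hat U(0)=U_0,\qquad \hat U_{II}(1)=U_{1II}, $$ satisfying $|\hat U_{II}'(0)|\le\varepsilon$; moreover, this solution is nondegenerate (it corresponds to a root $C_2$ of the map $\Psi$ of the context with $d\Psi(C_2)$ invertible) and spectrally stable.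
   Context: Setting. $\mathcal U\subset\mathbb R^n$ is an open set of states $U=(U_I,U_{II})\in\mathbb R^r\times\mathbb R^{n-r}$. Consider $\partial_t f^0(U)+f(U)_x=(B(U)U_x)_x$ on $0<x<1$ with boundary conditions $U(0)=U_0$, $U_{II}(1)=U_{1II}$. Here $f^0=(f^0_I,f^0_{II})$ and $f=(f_I,f_{II})$ take values in $\mathbb R^r\times\mathbb R^{n-r}$, $B=\begin{pmatrix} 0 & 0 \\ 0 & B_{22} \end{pmatrix}$ with $B_{22}(U)\in M_{n-r}(\mathbb R)$. Write $A^0=df^0=\begin{pmatrix} \mathrm{Id}_r & 0 \\ A^0_{21} & A^0_{22} \end{pmatrix}$ (invertible, with $\det A^0_{22}>0$) and $A=df=\begin{pmatrix} A_{11} & A_{12} \\ A_{21} & A_{22} \end{pmatrix}$ with $A_{11}\in M_r(\mathbb R)$. Assumptions, for every $U\in\mathcal U$: (a) $f^0$, $f$, $B$ are smooth. (b) $(A^0_{22})^{-1}B_{22}+((A^0_{22})^{-1}B_{22})^T$ has positive eigenvalues. (c) The eigenvalues of $A_{11}(U)=(df_I)_I(U)$ are real and positive. (d) (Symmetrizability) There is a smooth block-diagonal matrix function $S(U)=\begin{pmatrix} S_{11}(U) & 0 \\ 0 & S_{22}(U) \end{pmatrix}$ such that $S A^0$ is symmetric positive definite, $SA$ is symmetric, and $S_{22}B_{22}+(S_{22}B_{22})^T>0$. The map $\Psi$. For fixed $U_0$, $U_{1II}$, and $C_2\in\mathbb R^{n-r}$, let $U$ be the maximal solution with $U(0)=U_0$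 of $$B_{22}(U)U_{II}'=f_{II}(U)-f_{II}(U_0)+B_{22}(U_0)C_2,\qquad f_I(U)=f_I(U_0).$$ $\Psi$ is defined on the set of $C_2$ for which $U$ is defined on $[0,1]$, by $\Psi(C_2)=U_{II}(1)-U_{1II}$. Steady solutions correspond to roots $C_2=\hat U_{II}'(0)$ of $\Psi$. Spectral stability of $\hat U$ means that for every $\lambda\in\mathbb C$ with $\Re\lambda\ge0$ the linearized eigenvalue problem $$\lambda A^0(\hat U)V+(A(\hat U)V)_x=\big(B(\hat U)V_x+(dB(\hat U)V)\hat U_x\big)_x,\quad V(0)=0,\ V_{II}(1)=0$$ on $(0,1)$ has only the trivial solution $V\equiv0$. *)

(* Defs.v *)
From HB Require Import structures.
From mathcomp Require Import all_boot all_order all_algebra.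
From mathcomp Require Import all_classical all_reals all_analysis.
From mathcomp Require Import complex.

Set Implicit Arguments.
Unset Strict Implicit.
Unset Printing Implicit Defensive.

Import Order.TTheory GRing.Theory Num.Theory.
Import numFieldNormedType.Exports.

Local Open Scope classical_set_scope.
Local Open Scope ring_scope.

(* MathComp-Analysis norms matrices with the sup norm; the data are measured
   with the Euclidean norm instead. *)
Definition enorm (R : realType) (k : nat) (v : 'cV[R]_k) : R :=
  Num.sqrt (\sum_i v i ord0 ^+ 2).

Definition posdefmx (R : realType) (k : nat) (M : 'M[R]_k) : Prop :=
  forall v : 'cV[R]_k, v != 0 -> 0 < (v^T *m M *m v) ord0 ord0.

Definition Jac (R : realType) (p q : nat) (g : 'cV[R]_p -> 'cV[R]_q)
    (u : 'cV[R]_p) : 'M[R]_(q, p) :=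
  \matrix_(i, j) ('d g u (delta_mx j ord0)) i ord0.

Fixpoint Ck_on (R : realType) (V W : normedModType R) (k : nat) (D : set V)
    (g : V -> W) : Prop :=
  match k with
  | 0 => forall x, D x -> {for x, continuous g}
  | k'.+1 => (forall x, D x -> differentiable g x) /\
             (forall v, Ck_on k' D ('D_v g))
  end.

Definition smooth_on (R : realType) (V W : normedModType R) (D : set V)
    (g : V -> W) : Prop :=
  forall k, Ck_on k D g.

(* Functions on [0, 1] are represented by functions on R whose values outside
   [0, 1] are ignored.  Differentiation is relative to [0, 1], hence one-sided
   at 0 and at 1. *)
Definition I01 (R : realType) : set R := `[0, 1]%classic.

Definition quot01 (R : realType) (W : normedModType R) (g : R -> W) (x : R) :
    R -> W :=
  fun y => (y - x)^-1 *: (g y - g x).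

Definition derivable01 (R : realType) (W : normedModType R) (g : R -> W)
    (x : R) : Prop :=
  cvg (quot01 g x @ within (@I01 R) x^').

Definition derive01 (R : realType) (W : normedModType R) (g : R -> W)
    (x : R) : W :=
  lim (quot01 g x @ within (@I01 R) x^').

Definition C1_01 (R : realType) (W : normedModType R) (g : R -> W) : Prop :=
  (forall x, I01 x -> derivable01 g x) /\
  {within @I01 R, continuous (derive01 g)}.

Definition mxC (R : realType) (p q : nat) (M : 'M[R]_(p, q)) : 'M[R[i]]_(p, q) :=
  map_mx (real_complex R) M.

Definition mxRe (R : realType) (p q : nat) (M : 'M[R[i]]_(p, q)) : 'M[R]_(p, q) :=
  map_mx (@complex.Re R) M.

Definition mxIm (R : realType) (p q : nat) (M : 'M[R[i]]_(p, q)) : 'M[R]_(p, q) :=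
  map_mx (@complex.Im R) M.

(* Complex-valued functions of a real variable are differentiated through
   their real and imaginary parts. *)
Definition derivable01C (R : realType) (k : nat) (V : R -> 'cV[R[i]]_k)
    (x : R) : Prop :=
  derivable01 (fun y => mxRe (V y)) x /\ derivable01 (fun y => mxIm (V y)) x.

Definition derive01C (R : realType) (k : nat) (V : R -> 'cV[R[i]]_k)
    (x : R) : 'cV[R[i]]_k :=
  mxC (derive01 (fun y => mxRe (V y)) x) +
  Complex 0 1 *: mxC (derive01 (fun y => mxIm (V y)) x).

Definition C1_01C (R : realType) (k : nat) (V : R -> 'cV[R[i]]_k) : Prop :=
  C1_01 (fun y => mxRe (V y)) /\ C1_01 (fun y => mxIm (V y)).

(* The dimensions are r and m = n - r: a state is U = col_mx U_I U_II, with
   usubmx U = U_I and dsubmx U = U_II. *)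

Definition Bmx (R : realType) (r m : nat) (B22 : 'cV[R]_(r + m) -> 'M[R]_m)
    (u : 'cV[R]_(r + m)) : 'M[R]_(r + m) :=
  block_mx 0 0 0 (B22 u).

Record structural_assumptions (R : realType) (r m : nat)
    (D : set 'cV[R]_(r + m)) (f0 f : 'cV[R]_(r + m) -> 'cV[R]_(r + m))
    (B22 : 'cV[R]_(r + m) -> 'M[R]_m) : Prop := {
  f0_smooth : smooth_on D f0;
  f_smooth : smooth_on D f;
  B_smooth : smooth_on D (Bmx B22);
  A0_block : forall u, D u ->
    Jac f0 u = block_mx 1%:M 0 (dlsubmx (Jac f0 u)) (drsubmx (Jac f0 u));
  A0_unit : forall u, D u -> Jac f0 u \in unitmx;
  A0_det : forall u, D u -> 0 < \det (drsubmx (Jac f0 u));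
  B_parabolic : forall u, D u ->
    let K := invmx (drsubmx (Jac f0 u)) *m B22 u in
    (* real eigenvalues suffice: K + K^T is symmetric *)
    forall a : R, eigenvalue (K + K^T) a -> 0 < a;
  A11_speeds : forall u, D u ->
    forall z : R[i], eigenvalue (mxC (ulsubmx (Jac f u))) z ->
      complex.Im z = 0 /\ 0 < complex.Re z;
  symmetrizable : exists (S11 : 'cV[R]_(r + m) -> 'M[R]_r)
                         (S22 : 'cV[R]_(r + m) -> 'M[R]_m),
    let S := fun u => block_mx (S11 u) 0 0 (S22 u) : 'M[R]_(r + m) in
    smooth_on D S /\
    forall u, D u ->
      [/\ S u *m Jac f0 u \is symmetricmx,
          posdefmx (S u *m Jac f0 u),
          S u *m Jac f u \is symmetricmx &
          posdefmx (S22 u *m B22 u + (S22 u *m B22 u)^T)]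
}.

(* Classical solutions: W is C^1 on [0, 1] and the flux B(W) W_x is
   differentiable on (0, 1). *)
Definition steady_solution (R : realType) (r m : nat)
    (D : set 'cV[R]_(r + m)) (f : 'cV[R]_(r + m) -> 'cV[R]_(r + m))
    (B22 : 'cV[R]_(r + m) -> 'M[R]_m)
    (U0 : 'cV[R]_(r + m)) (U1II : 'cV[R]_m) (W : R -> 'cV[R]_(r + m)) : Prop :=
  let flux := fun x => Bmx B22 (W x) *m derive01 W x in
  [/\ forall x, I01 x -> D (W x),
      C1_01 W,
      forall x, 0 < x < 1 ->
        derivable01 flux x /\ derive01 (f \o W) x = derive01 flux x,
      W 0 = U0 &
      dsubmx (W 1) = U1II].

(* The solution defining Psi, on [0, 1].  Because solutions are unique, one
   exists on [0, 1] exactly when the maximal solution is defined there. *)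
Definition profile_ode (R : realType) (r m : nat)
    (D : set 'cV[R]_(r + m)) (f : 'cV[R]_(r + m) -> 'cV[R]_(r + m))
    (B22 : 'cV[R]_(r + m) -> 'M[R]_m)
    (U0 : 'cV[R]_(r + m)) (C2 : 'cV[R]_m) (W : R -> 'cV[R]_(r + m)) : Prop :=
  [/\ forall x, I01 x -> D (W x),
      C1_01 W,
      W 0 = U0 &
      forall x, I01 x ->
        B22 (W x) *m derive01 (fun y => dsubmx (W y)) x =
          dsubmx (f (W x)) - dsubmx (f U0) + B22 U0 *m C2 /\
        usubmx (f (W x)) = usubmx (f U0)].

Definition Psi_dom (R : realType) (r m : nat)
    (D : set 'cV[R]_(r + m)) (f : 'cV[R]_(r + m) -> 'cV[R]_(r + m))
    (B22 : 'cV[R]_(r + m) -> 'M[R]_m) (U0 : 'cV[R]_(r + m)) : set 'cV[R]_m :=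
  [set C2 | exists W, profile_ode D f B22 U0 C2 W].

(* Meaningful on Psi_dom only. *)
Definition Psi (R : realType) (r m : nat)
    (D : set 'cV[R]_(r + m)) (f : 'cV[R]_(r + m) -> 'cV[R]_(r + m))
    (B22 : 'cV[R]_(r + m) -> 'M[R]_m) (U0 : 'cV[R]_(r + m)) (U1II : 'cV[R]_m)
    (C2 : 'cV[R]_m) : 'cV[R]_m :=
  dsubmx (xget (fun=> U0) [set W | profile_ode D f B22 U0 C2 W] 1) - U1II.

Definition steady_nondegenerate (R : realType) (r m : nat)
    (D : set 'cV[R]_(r + m)) (f : 'cV[R]_(r + m) -> 'cV[R]_(r + m))
    (B22 : 'cV[R]_(r + m) -> 'M[R]_m) (U0 : 'cV[R]_(r + m)) (U1II : 'cV[R]_m)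
    (W : R -> 'cV[R]_(r + m)) : Prop :=
  let C2 := derive01 (fun y => dsubmx (W y)) 0 in
  let P := Psi D f B22 U0 U1II in
  [/\ interior (Psi_dom D f B22 U0) C2,
      profile_ode D f B22 U0 C2 W,
      P C2 = 0,
      differentiable P C2 &
      Jac P C2 \in unitmx].

(* dB(u) V, extended complex-linearly to complex V. *)
Definition dBC (R : realType) (r m : nat) (B22 : 'cV[R]_(r + m) -> 'M[R]_m)
    (u : 'cV[R]_(r + m)) (V : 'cV[R[i]]_(r + m)) : 'M[R[i]]_(r + m) :=
  \sum_j V j ord0 *: mxC ('d (Bmx B22) u (delta_mx j ord0)).

Definition eigenproblem (R : realType) (r m : nat)
    (f0 f : 'cV[R]_(r + m) -> 'cV[R]_(r + m))
    (B22 : 'cV[R]_(r + m) -> 'M[R]_m) (W : R -> 'cV[R]_(r + m))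
    (lambda : R[i]) (V : R -> 'cV[R[i]]_(r + m)) : Prop :=
  let AV := fun x => mxC (Jac f (W x)) *m V x in
  let flux := fun x => mxC (Bmx B22 (W x)) *m derive01C V x
                       + dBC B22 (W x) (V x) *m mxC (derive01 W x) in
  [/\ C1_01C V,
      forall x, 0 < x < 1 -> derivable01C flux x /\
        lambda *: (mxC (Jac f0 (W x)) *m V x) + derive01C AV x
        = derive01C flux x,
      V 0 = 0 &
      dsubmx (V 1) = 0].

Definition spectrally_stable (R : realType) (r m : nat)
    (f0 f : 'cV[R]_(r + m) -> 'cV[R]_(r + m))
    (B22 : 'cV[R]_(r + m) -> 'M[R]_m) (W : R -> 'cV[R]_(r + m)) : Prop :=
  forall lambda : R[i], 0 <= complex.Re lambda ->
  forall V, eigenproblem f0 f B22 W lambda V -> forall x, I01 x -> V x = 0.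

(* Main.v *)
(** Linearised rigidity near a constant state.  Write the (possibly nonconstant) linearised
    problem for [V] as [l + (A V)' = (0, G')] with flux [G], pair it with [(1 - al x) S V], where [S]
    is the symmetrizer, and add [k (1 - x) |V_II|^2].  The resulting quantity [Q] vanishes at [0]
    because [V 0 = 0], is nonnegative at [1] because [V_II 1 = 0] and [S11 A11 > 0], and satisfies
    [Q' <= - gm |V|^2] when the profile is almost constant and [Re lambda >= 0]; so [V = 0].  The
    weight [al] gives decay in [V_I] through [S11 A11 > 0], the parabolic term gives decay in
    [V_II'], and [k] turns the latter into decay in [V_II].

    Existence and nondegeneracy.  Since [A11] and [B22] are invertible, the profile equations are an
    ordinary differential equation [W' = F (W, C)] for which [(U0, 0)] is an equilibrium.  Its flow
    exists on [[0, 1]] for small [C] and the map [C |-> W_II 1] has a derivative with quadratic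
    remainder.  At [C = 0] this derivative is invertible by the rigidity above with [lambda = 0] at
    the constant state [U0], so a contraction argument gives a unique small [C] for every [U1II]
    close to [U0_II], and the derivative stays invertible there. *)

From HB Require Import structures.
Require Import Defs.
From mathcomp Require Import all_boot all_order all_algebra.
From mathcomp Require Import all_classical all_reals all_analysis.
From mathcomp Require Import complex ring lra.
Import Order.TTheory GRing.Theory Num.Theory.
Import numFieldNormedType.Exports.
Local Open Scope classical_set_scope.
Local Open Scope ring_scope.
Set Implicit Arguments.
Unset Strict Implicit.
Unset Printing Implicit Defensive.

(** * Calculus of matrix-valued functions *)

Section matrix_calculus.
Context {R : realType}.

(** For stability, [lambda] ranges over an unbounded half-plane, so perturbing the spectrum of the
    constant state gives nothing uniform. In the energy argument [lambda] multiplies only [S A0]: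
    symmetry cancels the contribution of [Im lambda] once the real and imaginary parts are added,
    and positivity gives that of [Re lambda] a sign. The admissible size of the profile is thus
    fixed before [lambda]. Only the flux is known to be differentiable, so it enters [Q] as a
    function of its own and [V_II''] never occurs. On the nonlinear side, two flows are compared
    through the linearisation along a third one. This single inequality yields existence,
    uniqueness, differentiability of [Psi] and invertibility of its derivative, with no separate
    continuity argument for the derivative. Uniqueness concerns every solution with small slope at
    0, including those not known to stay near [U0]; hence the Gronwall estimate with a barrier,
    which first confines the solution. *)

Lemma mx_entry_le (p q : nat) (M : 'M[R]_(p, q)) i j : `|M i j| <= `|M|.
Proof.
rewrite [leRHS]/Num.Def.normr/= mx_normrE.
exact: (le_bigmax _ (fun k : 'I_p * 'I_q => `|M k.1 k.2|) (i, j)).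
Qed.

Lemma mx_norm_le (p q : nat) (M : 'M[R]_(p, q)) (c : R) : 0 <= c ->
  (forall i j, `|M i j| <= c) -> `|M| <= c.
Proof.
move=> c0 h; rewrite [leLHS]/Num.Def.normr/= mx_normrE.
by apply: bigmax_le => // -[i j] _; exact: h.
Qed.

Lemma mulmx_norm_le (p q s : nat) (A : 'M[R]_(p, q)) (B : 'M[R]_(q, s)) :
  `|A *m B| <= q%:R * `|A| * `|B|.
Proof.
apply: mx_norm_le => [|i j]; first by rewrite !mulr_ge0.
rewrite mxE (le_trans (ler_norm_sum _ _ _))//.
apply: (@le_trans _ _ (\sum_(k < q) `|A| * `|B|)).
  by apply: ler_sum => k _; rewrite normrM ler_pM// mx_entry_le.
rewrite sumr_const card_ord -mulrA -[leLHS]mulr_natl.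
done.
Qed.

Lemma is_derive_mxP (p q : nat) (W : R -> 'M[R]_(p, q)) (x : R) (dW : 'M[R]_(p, q)) :
  is_derive x 1 W dW <->
  forall i j, is_derive x 1 (fun y => W y i j : R) (dW i j).
Proof.
split=> [[dr <-] i j|h].
  have dr' := (derivable_mxP _ _ _).1 dr.
  by apply: DeriveDef; [exact: dr'|rewrite derive_mx// mxE].
have dr : derivable W x 1 by apply/derivable_mxP => i j; case: (h i j).
apply: DeriveDef => //.
by rewrite derive_mx//; apply/matrixP => i j; rewrite mxE; case: (h i j).
Qed.

Lemma is_derive_mul (f g : R -> R) (x df dg : R) :
  is_derive x 1 f df -> is_derive x 1 g dg ->
  is_derive x 1 (fun y => f y * g y) (df * g x + f x * dg).
Proof.
move=> hf hg; apply: is_derive_eq (is_deriveM hf hg) _.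
by rewrite /GRing.scale/= addrC mulrC.
Qed.

Lemma is_derive_bigsum (I : Type) (s : seq I) (P : pred I) (x : R)
    (h : I -> R -> R) (dh : I -> R) :
  (forall i, is_derive x 1 (h i) (dh i)) ->
  is_derive x 1 (fun y => \sum_(i <- s | P i) h i y) (\sum_(i <- s | P i) dh i).
Proof.
move=> H; elim: s => [|i s IH].
  rewrite big_nil; under eq_fun do rewrite big_nil.
  exact: is_derive_cst.
rewrite big_cons; under eq_fun do rewrite big_cons.
by case: (P i) => //; have := H i => ?; exact: is_deriveD.
Qed.

Lemma is_derive_mulmx (p q s : nat) (A : R -> 'M[R]_(p, q)) (B : R -> 'M[R]_(q, s))
    (x : R) dA dB : is_derive x 1 A dA -> is_derive x 1 B dB ->
  is_derive x 1 (fun y => A y *m B y) (dA *m B x + A x *m dB).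
Proof.
move=> /is_derive_mxP hA /is_derive_mxP hB; apply/is_derive_mxP => i j.
rewrite !mxE -big_split/=; under eq_fun do rewrite mxE.
by apply: is_derive_bigsum => k; exact: is_derive_mul.
Qed.

Lemma continuous_mxP (T : topologicalType) (p q : nat) (f : T -> 'M[R]_(p, q)) x :
  {for x, continuous f} <-> forall i j, {for x, continuous (fun y => f y i j : R)}.
Proof.
split=> [cf i j|cf].
  apply: (@continuous_comp _ _ _ f (fun M : 'M[R]_(p, q) => M i j)) => //.
  exact: coord_continuous.
apply/cvgrPdist_le => /= e e0; near=> y.
apply: mx_norm_le => [|i j]; first exact: ltW.
rewrite !mxE.
suff : forall k : 'I_p * 'I_q, `|f x k.1 k.2 - f y k.1 k.2| <= e by move=> /(_ (i, j)).
near: y; apply: filter_forall => -[i' j'] /=.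
by have /cvgrPdist_le/(_ e e0) := cf i' j'.
Unshelve. all: by end_near. Qed.

Lemma cont_add (T : topologicalType) (V : normedModType R) (f g : T -> V) x :
  {for x, continuous f} -> {for x, continuous g} ->
  {for x, continuous (fun y => f y + g y)}.
Proof. exact: continuousD. Qed.

Lemma cont_mul (T : topologicalType) (f g : T -> R) x :
  {for x, continuous f} -> {for x, continuous g} ->
  {for x, continuous (fun y => f y * g y)}.
Proof. exact: continuousM. Qed.

Lemma cont_sub (T : topologicalType) (V : normedModType R) (f g : T -> V) x :
  {for x, continuous f} -> {for x, continuous g} ->
  {for x, continuous (fun y => f y - g y)}.
Proof. exact: continuousB. Qed.

Lemma cont_comp (S T U : topologicalType) (f : S -> T) (g : T -> U) x :
  {for x, continuous f} -> {for f x, continuous g} ->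
  {for x, continuous (fun y => g (f y))}.
Proof. exact: continuous_comp. Qed.

Lemma continuous_bigsum (T : topologicalType) (I : Type) (s : seq I) (P : pred I)
    (h : I -> T -> R) x :
  (forall i, {for x, continuous (h i)}) ->
  {for x, continuous (fun y => \sum_(i <- s | P i) h i y)}.
Proof.
move=> H; elim: s => [|i s IH].
  rewrite (_ : (fun y => _) = cst 0); first exact: cst_continuous.
  by apply/funext => y; rewrite big_nil.
rewrite (_ : (fun y => _) =
    if P i then h i \+ (fun y => \sum_(j <- s | P j) h j y)
    else (fun y => \sum_(j <- s | P j) h j y)); last first.
  by case: ifP => Pi; apply/funext => y; rewrite big_cons Pi.
by case: ifP => // _; exact: continuousD.
Qed.

Lemma continuous_mulmx (T : topologicalType) (p q s : nat) (A : T -> 'M[R]_(p, q))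
    (B : T -> 'M[R]_(q, s)) x : {for x, continuous A} -> {for x, continuous B} ->
  {for x, continuous (fun y => A y *m B y)}.
Proof.
move=> /continuous_mxP cA /continuous_mxP cB; apply/continuous_mxP => i j.
rewrite (_ : (fun y => _) = (fun y => \sum_k A y i k * B y k j)); last first.
  by apply/funext => y; rewrite mxE.
by apply: continuous_bigsum => k; exact: continuousM.
Qed.

Lemma within_cst (W : normedModType R) (A : set R) (c : W) :
  {within A, continuous (fun _ : R => c)}.
Proof. by apply: continuous_subspaceT => z; exact: cst_continuous. Qed.

Lemma within_add (W : normedModType R) (A : set R) (f g : R -> W) :
  {within A, continuous f} -> {within A, continuous g} ->
  {within A, continuous (fun y => f y + g y)}.
Proof. by move=> cf cg z; exact: cont_add (cf z) (cg z). Qed.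

Lemma within_sub (W : normedModType R) (A : set R) (f g : R -> W) :
  {within A, continuous f} -> {within A, continuous g} ->
  {within A, continuous (fun y => f y - g y)}.
Proof. by move=> cf cg z; exact: cont_sub (cf z) (cg z). Qed.

Lemma within_mul (A : set R) (f g : R -> R) :
  {within A, continuous f} -> {within A, continuous g} ->
  {within A, continuous (fun y => f y * g y)}.
Proof. by move=> cf cg z; exact: cont_mul (cf z) (cg z). Qed.

Lemma within_mulmx (p q s : nat) (A : set R) (f : R -> 'M[R]_(p, q))
    (g : R -> 'M[R]_(q, s)) :
  {within A, continuous f} -> {within A, continuous g} ->
  {within A, continuous (fun y => f y *m g y)}.
Proof. by move=> cf cg z; exact: continuous_mulmx (cf z) (cg z). Qed.

(** The squared Frobenius norm: unlike the sup norm it is differentiable along a curve, so Gronwall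
    arguments run on it and are transferred by [ssq_ge]. *)
Definition ssq (p q : nat) (M : 'M[R]_(p, q)) : R := \sum_i \sum_j M i j ^+ 2.

Lemma ssq_ge (p q : nat) (M : 'M[R]_(p, q)) : `|M| ^+ 2 <= ssq M.
Proof.
have s0 : 0 <= ssq M by do 2 (apply: sumr_ge0 => ? _); exact: sqr_ge0.
rewrite -(sqr_sqrtr s0) lerXn2r// ?nnegrE ?sqrtr_ge0//.
apply: mx_norm_le => [|i j]; first exact: sqrtr_ge0.
rewrite -sqrtr_sqr ler_wsqrtr// /ssq (bigD1 i)//= (bigD1 j)//= -addrA lerDl.
rewrite addr_ge0//; first by apply: sumr_ge0 => ? _; exact: sqr_ge0.
by do 2 (apply: sumr_ge0 => ? _); exact: sqr_ge0.
Qed.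

Lemma is_derive_ssq (p q : nat) (W : R -> 'M[R]_(p, q)) (x : R) dW :
  is_derive x 1 W dW ->
  is_derive x 1 (fun y => ssq (W y)) (\sum_i \sum_j 2 * (W x i j * dW i j) : R).
Proof.
move=> /is_derive_mxP h; rewrite /ssq.
apply: is_derive_bigsum => i; apply: is_derive_bigsum => j.
under eq_fun do rewrite expr2.
apply: is_derive_eq (is_derive_mul (h i j) (h i j)) _.
by rewrite [_ * W _ _ _]mulrC -mulr2n mulr_natl.
Qed.

Lemma continuous_ssq (T : topologicalType) (p q : nat) (f : T -> 'M[R]_(p, q)) x :
  {for x, continuous f} -> {for x, continuous (fun y => ssq (f y))}.
Proof.
move=> /continuous_mxP cf; rewrite /ssq.
apply: continuous_bigsum => i; apply: continuous_bigsum => j.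
by apply: (@continuous_comp _ _ _ (fun y => f y i j) (fun z : R => z ^+ 2)) => //;
  exact: exprn_continuous.
Qed.

End matrix_calculus.

(** * Gronwall estimates *)

Section gronwall.
Context {R : realType}.

Lemma within_continuousP (W : normedModType R) (A : set R) (f : R -> W) :
  {within A, continuous f} <-> forall x, A x -> forall e : R, 0 < e ->
    exists2 d : R, 0 < d & forall y, A y -> `|y - x| < d -> `|f y - f x| < e.
Proof.
rewrite (@subspace_continuousP _ A _ f); split=> h x Ax.
  move=> e e0; move/cvgrPdist_lt : (h x Ax) => /(_ e e0).
  rewrite near_withinE => -[d /= d0 hd]; exists d => // y Ay yx.
  by rewrite distrC; apply: hd => //=; rewrite distrC.
apply/cvgrPdist_lt => e e0; have [d d0 hd] := h x Ax e e0.
rewrite near_withinE; exists d => //= y + Ay.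
by rewrite /ball_/= distrC => yx; rewrite distrC; exact: hd.
Qed.

Lemma derive_le0_le (e de : R -> R) (a b : R) : a <= b ->
  (forall x : R, a < x < b -> is_derive x 1 e (de x)) ->
  (forall x : R, a < x < b -> de x <= 0) ->
  {within `[a, b], continuous e} -> e b <= e a.
Proof.
rewrite le_eqVlt => /predU1P[-> //|ab] he hde ce.
have hd : forall x : R, x \in `]a, b[ -> is_derive x 1 e (de x).
  by move=> x; rewrite in_itv/=; exact: he.
have [c] := MVT ab hd ce.
rewrite in_itv/= => cab h; rewrite -subr_le0 h.
by rewrite mulr_le0_ge0 ?subr_ge0 ?(ltW ab)// hde.
Qed.

Lemma is_derive_expRNM (K x : R) :
  is_derive x 1 (fun y : R => expR (- (K * y))) (- (K * expR (- (K * x)))).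
Proof.
have h1 : is_derive x 1 (fun y : R => - (K * y)) (- K).
  apply: is_derive_eq (is_deriveN (is_deriveZ K (is_derive_id x 1))) _.
  by rewrite /GRing.scale/= mulr1.
apply: is_derive_eq (is_derive1_comp (is_derive_expR _) h1) _.
by rewrite mulrN mulrC.
Qed.

(** The differential inequality makes [(e y + d) * expR (- (K * y))] nonincreasing. *)
Lemma gronwall_open (e de : R -> R) (K d b : R) : 0 <= K -> 0 <= d ->
  0 <= b <= 1 ->
  {within `[0, b], continuous e} -> e 0 = 0 ->
  (forall x : R, 0 < x < b -> is_derive x 1 e (de x)) ->
  (forall x : R, 0 < x < b -> de x <= K * (e x + d)) ->
  e b <= d * expR K.
Proof.
move=> K0 d0 /andP[b0 b1] ce e0 he hde.
pose g y := (e y + d) * expR (- (K * y)).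
pose dg y := de y * expR (- (K * y)) + (e y + d) * - (K * expR (- (K * y))).
have hg (x : R) : 0 < x < b -> is_derive x 1 g (dg x).
  move=> xb; have ? := he x xb; apply: is_derive_mul; last exact: is_derive_expRNM.
  by apply: is_derive_eq; rewrite addr0.
have : g b <= g 0.
  apply: (@derive_le0_le _ dg) => //.
    move=> x xb.
    rewrite /dg mulrN mulrA -mulrBl pmulr_lle0 ?expR_gt0// subr_le0 mulrC.
    exact: hde.
  have cg : {within `[0, b], continuous (fun y : R => expR (- (K * y)))}.
    apply: continuous_subspaceT => z.
    apply: (@continuous_comp _ _ _ (fun y => - (K * y)) expR); last exact: continuous_expR.
    by apply: continuousN; apply: mulrl_continuous.
  have cD : {within `[0, b], continuous (fun y => e y + d)}.
    by move=> z; exact: cont_add (ce z) (@cst_continuous _ _ d z).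
  by move=> z; exact: continuousM (cD z) (cg z).
rewrite /g e0 add0r mulr0 oppr0 expR0 mulr1.
rewrite expRN ler_pdivrMr ?expR_gt0// => h.
apply: (@le_trans _ _ (e b + d)); first by rewrite lerDl.
apply: le_trans h _; rewrite ler_wpM2l// ler_expR.
by rewrite ler_piMr.
Qed.

(* The differential inequality is only required below the level [r], which the
   resulting bound prevents [e] from reaching. *)
Lemma gronwall_barrier (e de : R -> R) (K d r : R) : 0 <= K -> 0 <= d ->
  {within `[0, 1], continuous e} -> e 0 = 0 ->
  (forall x : R, 0 < x < 1 -> is_derive x 1 e (de x)) ->
  (forall x : R, 0 < x < 1 -> e x <= r -> de x <= K * (e x + d)) ->
  d * expR K < r -> forall x : R, 0 <= x <= 1 -> e x <= d * expR K.
Proof.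
move=> K0 d0 ce e0 he hde dr.
have r0 : 0 < r by apply: le_lt_trans dr; rewrite mulr_ge0// expR_ge0.
have step (b : R) : 0 <= b <= 1 -> (forall y : R, 0 < y < b -> e y <= r) ->
    e b <= d * expR K.
  move=> /andP[b0 b1] hb.
  have lt1 (x : R) : 0 < x < b -> 0 < x < 1.
    by move=> /andP[-> xb]/=; exact: lt_le_trans b1.
  apply: (@gronwall_open _ de) => //; first by rewrite b0.
  - apply: continuous_subspaceW ce => y /=; rewrite !in_itv/= => /andP[-> yb]/=.
    exact: le_trans b1.
  - by move=> x xb; exact/he/lt1.
  - by move=> x xb; apply: hde; [exact: lt1|exact: hb].
(* Continuity induction: [s] is the last time up to which [e] stays below [r]. The bound at [s] is
   strictly below [r], so continuity would push past [s] unless [s = 1]. *)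
pose A := [set x : R | 0 <= x <= 1 /\ forall y : R, 0 <= y <= x -> e y <= r].
have A0 : A 0.
  split; first by rewrite lexx ler01.
  by move=> y /le_anti <-; rewrite e0 ltW.
have hsA : has_sup A by split; [exists 0|exists 1 => x [/andP[]]].
pose s := sup A.
have s0 : 0 <= s by apply: ub_le_sup => //; exact: hsA.2.
have s1 : s <= 1 by apply: ge_sup; [exists 0|move=> x [/andP[]]].
have below (y : R) : 0 <= y -> y < s -> e y <= r.
  move=> y0 ys; have [|a [_ Aa] ya] := sup_adherent (eps := s - y) _ hsA.
    by rewrite subr_gt0.
  by apply: Aa; rewrite y0 ltW//; move: ya; rewrite -/s; lra.
have es : e s <= d * expR K.
  apply: step; first by rewrite s0.
  by move=> y /andP[y0 ys]; apply: below => //; exact: ltW.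
have sE : s = 1.
  apply/eqP; rewrite eq_le s1/= leNgt; apply/negP => s_lt1.
  have sI : [set` `[0, 1]] s by rewrite /= in_itv/= s0.
  have [|t t0 ht] := (within_continuousP _ _).1 ce s sI (r - e s).
    by rewrite subr_gt0 (le_lt_trans es).
  pose z := Num.min 1 (s + t / 2).
  have sz : s < z by rewrite /z lt_min s_lt1/= ltrDl divr_gt0.
  have Az : A z.
    split; first by rewrite (le_trans s0 (ltW sz))/= /z ge_min lexx.
    move=> y /andP[y0 yz]; have [ys|sy] := ltP y s; first exact: below.
    have : y <= 1 by apply: le_trans yz _; rewrite /z ge_min lexx.
    have : y <= s + t / 2 by apply: le_trans yz _; rewrite /z ge_min lexx orbT.
    move=> yst y1; have := ht y; rewrite /= in_itv/= y0 y1 => /(_ isT).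
    rewrite ger0_norm ?subr_ge0// => /(_ _)/wrap[|]; first by move: t0; lra.
    by move=> /(le_lt_trans (ler_norm _)); rewrite ltrD2r => /ltW.
  by have := ub_le_sup hsA.2 Az; rewrite leNgt sz.
move=> x /andP[x0 x1]; apply: step; first by rewrite x0.
move=> y /andP[y0 yx]; apply: below; first exact: ltW.
by rewrite sE (lt_le_trans yx).
Qed.

(** The rate comes from differentiating [ssq]: each of the [p * q] entries contributes at most
    [2 * (|E| * |dE|)], and [2 * |E| * d <= |E|^2 + d^2] turns this into
    [(2 * L + 1) * (ssq E + d ^+ 2)]. *)
Lemma gronwall_mx_barrier (p q : nat) (E dE : R -> 'M[R]_(p, q)) (L d rho : R) :
  0 <= L -> 0 <= d -> {within `[0, 1], continuous E} -> E 0 = 0 ->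
  (forall x : R, 0 < x < 1 -> is_derive x 1 E (dE x)) ->
  (forall x : R, 0 < x < 1 -> `|E x| <= rho -> `|dE x| <= L * `|E x| + d) ->
  d * expR ((p * q)%:R * (2 * L + 1)) < rho ->
  forall x : R, 0 <= x <= 1 -> `|E x| <= d * expR ((p * q)%:R * (2 * L + 1)).
Proof.
move=> L0 d0 cE E0 hE hdE; set K := _%:R * _ => drho x x01.
have K0 : 0 <= K by rewrite mulr_ge0// addr_ge0// mulr_ge0.
have eK1 : 1 <= expR K by rewrite -expR0 ler_expR.
have dK0 : 0 <= d * expR K by rewrite mulr_ge0// expR_ge0.
have rho0 : 0 <= rho by apply: le_trans (ltW drho).
(* The scalar estimate carries [expR K] once where the square of the claimed bound carries it twice;
   [1 <= expR K] closes the gap. *)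
have dle : d ^+ 2 * expR K <= (d * expR K) ^+ 2.
  by rewrite exprMn ler_wpM2l ?sqr_ge0// expr2 ler_peMr// expR_ge0.
pose de x := \sum_i \sum_j 2 * (E x i j * dE x i j) : R.
have : ssq (E x) <= d ^+ 2 * expR K.
  apply: (@gronwall_barrier (fun y => ssq (E y)) de K (d ^+ 2) (rho ^+ 2)) => //.
  - exact: sqr_ge0.
  - by move=> z; apply: continuous_ssq; exact: cE.
  - rewrite E0 /ssq; apply: big1 => i _; apply: big1 => j _.
    by rewrite mxE expr0n.
  - by move=> y y01; apply: is_derive_ssq; exact: hE.
  - move=> y y01 hy.
    have yrho : `|E y| <= rho.
      by rewrite -(@ler_pXn2r _ 2)// ?nnegrE// (le_trans (ssq_ge _)).
    have hh := hdE y y01 yrho.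
    have e1 : 2 * (`|E y| * `|dE y|) <= (2 * L + 1) * (ssq (E y) + d ^+ 2).
      have h1 := ssq_ge (E y).
      have h2 : `|E y| * `|dE y| <= `|E y| * (L * `|E y| + d) by rewrite ler_wpM2l.
      have h3 : 0 <= L * (ssq (E y) - `|E y| ^+ 2) by rewrite mulr_ge0// subr_ge0.
      have h4 : 0 <= L * d ^+ 2 by rewrite mulr_ge0// sqr_ge0.
      have h5 := sqr_ge0 (`|E y| - d).
      by nra.
    apply: (@le_trans _ _ (\sum_(i < p) \sum_(j < q) 2 * (`|E y| * `|dE y|))).
      apply: ler_sum => i _; apply: ler_sum => j _; rewrite ler_wpM2l//.
      by rewrite (le_trans (ler_norm _))// normrM ler_pM// mx_entry_le.
    rewrite !sumr_const !card_ord -mulrnA -[leLHS]mulr_natl mulnC -mulrA.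
    by rewrite ler_wpM2l.
  - rewrite (le_lt_trans dle)// ltrXn2r//= nnegrE//.
move=> h; rewrite -(@ler_pXn2r _ 2)// ?nnegrE//.
by rewrite (le_trans (ssq_ge _))// (le_trans h).
Qed.

Lemma gronwall_mx (p q : nat) (E dE : R -> 'M[R]_(p, q)) (L d : R) :
  0 <= L -> 0 <= d -> {within `[0, 1], continuous E} -> E 0 = 0 ->
  (forall x : R, 0 < x < 1 -> is_derive x 1 E (dE x)) ->
  (forall x : R, 0 < x < 1 -> `|dE x| <= L * `|E x| + d) ->
  forall x : R, 0 <= x <= 1 -> `|E x| <= d * expR ((p * q)%:R * (2 * L + 1)).
Proof.
move=> L0 d0 cE E0 hE hdE.
apply: (@gronwall_mx_barrier _ _ _ dE _ _ (d * expR ((p * q)%:R * (2 * L + 1)) + 1)) => //.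
  by move=> x x01 _; exact: hdE.
by rewrite ltrDl.
Qed.

End gronwall.

(** * Picard iteration on the unit interval *)

(* The library has the complete and the normed structure on matrices but not their join. *)
HB.instance Definition _ (R : realType) (p q : nat) := Complete.on 'M[R]_(p, q).

Section picard.
Context {R : realType}.

(** Composing with this retraction extends a function continuous on [[0, 1]] to one continuous on
    the whole line, which makes two-sided derivatives available at the end points. *)
Definition clamp01 (x : R) : R := Num.max 0 (Num.min x 1).

Lemma clamp01_in x : 0 <= clamp01 x <= 1.
Proof. by rewrite /clamp01 le_max lexx/= ge_max ler01 ge_min lexx orbT. Qed.

Lemma clamp01_id x : 0 <= x <= 1 -> clamp01 x = x.
Proof. by move=> /andP[x0 x1]; rewrite /clamp01 (min_idPl x1); exact/max_idPr. Qed.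

Lemma clamp01_lip x y : `|clamp01 x - clamp01 y| <= `|x - y|.
Proof.
wlog xy : x y / x <= y.
  by move=> h; case: (leP x y) => [|/ltW] /h//; rewrite distrC (distrC x).
rewrite distrC [leRHS]distrC !ger0_norm ?subr_ge0//; last first.
  rewrite /clamp01 /Num.max /Num.min.
  by move: xy; repeat case: ifPn; rewrite -?leNgt; lra.
rewrite /clamp01 /Num.max /Num.min.
by move: xy; repeat case: ifPn; rewrite -?leNgt; lra.
Qed.

Lemma continuous_clamp01 (W : normedModType R) (g : R -> W) :
  {within `[0, 1], continuous g} -> continuous (g \o clamp01).
Proof.
move=> /within_continuousP h x; apply/cvgrPdist_lt => e e0.
have cI y : [set` `[0, 1]] (clamp01 y) by rewrite /= in_itv/= clamp01_in.
have [d d0 hd] := h _ (cI x) e e0.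
exists d => //= y /= xy; rewrite distrC; apply: hd; first exact: cI.
by rewrite distrC (le_lt_trans (clamp01_lip _ _)).
Qed.

Lemma is_derive_within (p q : nat) (A : set R) (W dW : R -> 'M[R]_(p, q)) :
  (forall x, A x -> is_derive x 1 W (dW x)) -> {within A, continuous W}.
Proof.
move=> h; apply/subspace_continuousP => x Ax; apply: cvg_within_filter.
apply/continuous_mxP => i j; apply: differentiable_continuous.
by apply/derivable1_diffP; have /is_derive_mxP/(_ i j)[] := h x Ax.
Qed.

Lemma scalar_antiderivative (g : R -> R) : {within `[0, 1], continuous g} ->
  exists P : R -> R, P 0 = 0 /\ forall x : R, 0 <= x <= 1 -> is_derive x 1 P (g x).
Proof.
move=> cg; have cgc := continuous_clamp01 cg.
(* Integrating from -1, inside an interval reaching to 2, puts 0 and 1 in the interior, where the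
   fundamental theorem gives two-sided derivatives. *)
pose F x := (\int[@lebesgue_measure R]_(t in `[(-1)%R, x]) (g \o clamp01) t)%R.
have hF (x : R) : 0 <= x <= 1 -> is_derive x 1 F (g x).
  move=> x01; have /andP[x0 x1] := x01.
  have [||| |d1 d2] := @continuous_FTC1_closed R (g \o clamp01) (-1) x 2.
  - by rewrite (le_lt_trans x1)// ltr1n.
  - apply: continuous_compact_integrable; first exact: segment_compact.
    exact: continuous_subspaceT.
  - by rewrite (lt_le_trans _ x0)// ltrN10.
  - exact: cgc.
  by apply: DeriveDef => //; rewrite -derive1E d2/= clamp01_id.
exists (fun x => F x - F 0); split; first by rewrite subrr.
move=> x x01; have ? := hF x x01.
by apply: is_derive_eq; rewrite subr0.
Qed.

Lemma antiderivative (p q : nat) (g : R -> 'M[R]_(p, q)) (u0 : 'M[R]_(p, q)) :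
  {within `[0, 1], continuous g} ->
  exists P : R -> 'M[R]_(p, q), P 0 = u0 /\
    forall x : R, 0 <= x <= 1 -> is_derive x 1 P (g x).
Proof.
move=> cg.
have h (k : 'I_p * 'I_q) : exists P : R -> R, P 0 = 0 /\
    forall x : R, 0 <= x <= 1 -> is_derive x 1 P (g x k.1 k.2).
  by apply: scalar_antiderivative => x; have /continuous_mxP := cg x; exact.
have [P hP] := choice h.
exists (fun x => \matrix_(i, j) (P (i, j) x + u0 i j)); split.
  by apply/matrixP => i j; rewrite mxE (hP (i, j)).1 add0r.
move=> x x01; apply/is_derive_mxP => i j.
have ? := (hP (i, j)).2 x x01; under eq_fun do rewrite mxE.
by apply: is_derive_eq; rewrite addr0.
Qed.

(** For [|s| = 1] the function [s * E y i j - g y] starts at 0 and is nonincreasing. This plays the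
    role of bounding the norm of an integral by the integral of the norm. *)
Lemma derive_norm_le (p q : nat) (E dE : R -> 'M[R]_(p, q)) (g dg : R -> R) :
  E 0 = 0 -> g 0 = 0 ->
  (forall x : R, 0 <= x <= 1 -> is_derive x 1 E (dE x)) ->
  (forall x : R, 0 <= x <= 1 -> is_derive x 1 g (dg x)) ->
  (forall x : R, 0 <= x <= 1 -> `|dE x| <= dg x) ->
  forall x : R, 0 <= x <= 1 -> `|E x| <= g x.
Proof.
move=> E0 g0 hE hg le_dE x x01; have /andP[x0 x1] := x01.
have sub (y : R) : 0 <= y <= x -> 0 <= y <= 1.
  by move=> /andP[-> yx]/=; exact: le_trans x1.
have key (s : R) i j : `|s| = 1 -> s * E x i j <= g x.
  move=> s1; pose e y := s * E y i j - g y.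
  have he (y : R) : 0 <= y <= x -> is_derive y 1 e (s * dE y i j - dg y).
    move=> yx; have ? := hg y (sub y yx).
    have ? := (is_derive_mxP _ _ _).1 (hE y (sub y yx)) i j.
    by apply: is_derive_eq.
  have : e x <= e 0.
    apply: (@derive_le0_le _ _ (fun y => s * dE y i j - dg y)) => //.
    - by move=> y /andP[y0 yx]; apply: he; rewrite !ltW.
    - move=> y /andP[y0 yx]; rewrite subr_le0 (le_trans (ler_norm _))//.
      rewrite normrM s1 mul1r (le_trans (mx_entry_le _ _ _))// le_dE//.
      by rewrite sub// !ltW.
    - apply: derivable_within_continuous => y; rewrite in_itv/= => /he [] //.
  by rewrite /e E0 g0 mxE mulr0 subr0 subr_le0.
have gx0 : 0 <= g x.
  have : - g x <= - g 0; last by rewrite g0 oppr0 oppr_le0.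
  have hN (y : R) : 0 <= y <= x -> is_derive y 1 (fun y => - g y) (- dg y).
    by move=> /sub/hg; exact: is_deriveN.
  apply: (@derive_le0_le R (fun y => - g y) (fun y => - dg y)) => //.
  - by move=> y /andP[y0 yx]; apply: hN; rewrite !ltW.
  - move=> y /andP[y0 yx]; rewrite oppr_le0; apply: le_trans (le_dE y _) => //.
    by rewrite sub// !ltW.
  - by apply: derivable_within_continuous => y; rewrite in_itv/= => /hN[].
apply: mx_norm_le => // i j; rewrite ler_norml lerNl -mulN1r key ?normrN1//=.
by rewrite -[leLHS]mul1r key// normr1.
Qed.

Lemma half_pow_small (c e : R) : 0 < e -> exists k : nat, c / 2 ^+ k < e.
Proof.
move=> e0; have h : geometric c (2^-1 : R) @ \oo --> 0.
  by apply: cvg_geometric; rewrite ger0_norm ?invr_ge0// invf_lt1// ltr1n.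
have /cvgrPdist_lt/(_ e e0)[N _ /(_ N (leqnn N))] := h.
rewrite sub0r normrN => /(le_lt_trans (ler_norm _)) h'; exists N.
by move: h'; rewrite /geometric/= exprVn.
Qed.

(** The Lipschitz bound is global in the state, so in a weighted norm the iteration contracts on the
    whole interval at once. Continuity of [G] is asked only along curves, the form in which it is
    known for a linear equation with coefficients given along a solution. *)
Lemma picard (p q : nat) (G : R -> 'M[R]_(p, q) -> 'M[R]_(p, q)) (L : R)
    (u0 : 'M[R]_(p, q)) : 0 <= L ->
  (forall (x : R) u v, 0 <= x <= 1 -> `|G x u - G x v| <= L * `|u - v|) ->
  (forall W : R -> 'M[R]_(p, q), {within `[0, 1], continuous W} ->
     {within `[0, 1], continuous (fun x => G x (W x))}) ->
  exists W : R -> 'M[R]_(p, q), W 0 = u0 /\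
    forall x : R, 0 <= x <= 1 -> is_derive x 1 W (G x (W x)).
Proof.
move=> L0 lipG contG.
(* [T] is the Picard operator, with a meaningless value on curves that are not continuous. *)
have /choice[T hT] : forall W : R -> 'M[R]_(p, q), exists P : R -> 'M[R]_(p, q),
    {within `[0, 1], continuous W} ->
    P 0 = u0 /\ forall x : R, 0 <= x <= 1 -> is_derive x 1 P (G x (W x)).
  move=> W; have [cW|ncW] := pselect {within `[0, 1], continuous W}.
    by have [P hP] := antiderivative u0 (contG W cW); exists P.
  by exists W.
have cT (W : R -> 'M[R]_(p, q)) : {within `[0, 1], continuous W} -> {within `[0, 1], continuous (T W)}.
  by move=> /hT[_ h]; exact: (@is_derive_within _ _ _ _ (fun x => G x (W x))).
pose w k := iter k T (fun=> u0).
have cw k : {within `[0, 1], continuous (w k)}.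
  elim: k => [|k]; last exact: cT.
  by apply: continuous_subspaceT => ?; exact: cst_continuous.
(* With this exponent [L <= l / 2], so integrating [L * expR (l * x)] gains the factor [1 / 2]. *)
pose l := 2 * L + 1.
have l0 : 0 < l by rewrite /l; lra.
(* The weight [expR (l * x)] turns the Picard operator into a contraction on
   the whole interval. *)
have weight (W1 W2 : R -> 'M[R]_(p, q)) (c : R) :
    {within `[0, 1], continuous W1} -> {within `[0, 1], continuous W2} ->
    0 <= c -> (forall x : R, 0 <= x <= 1 -> `|W1 x - W2 x| <= c * expR (l * x)) ->
    forall x : R, 0 <= x <= 1 -> `|T W1 x - T W2 x| <= c / 2 * expR (l * x).
  move=> c1 c2 c0 hc x x01; have [a1 d1] := hT _ c1; have [a2 d2] := hT _ c2.
  apply: (@le_trans _ _ (c / 2 * expR (l * x) - c / 2)); last first.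
    by rewrite lerBlDr lerDl divr_ge0.
  apply: (@derive_norm_le _ _ (fun x => T W1 x - T W2 x)
    (fun x => G x (W1 x) - G x (W2 x)) (fun x => c / 2 * expR (l * x) - c / 2)
    (fun x => c / 2 * (l * expR (l * x)))) => //.
  - by rewrite a1 a2 subrr.
  - by rewrite mulr0 expR0 mulr1 subrr.
  - by move=> y y01; have ? := d1 y y01; have ? := d2 y y01; exact: is_deriveB.
  - move=> y y01.
    have := is_derive_expRNM (- l) y.
    rewrite !mulNr !opprK; under eq_fun do rewrite mulNr opprK.
    by move=> ?; apply: is_derive_eq; rewrite subr0.
  - move=> y y01; apply: (le_trans (lipG _ _ _ y01)).
    apply: (@le_trans _ _ (L * (c * expR (l * y)))); first by rewrite ler_wpM2l// hc.
    have : 0 <= c * expR (l * y) by rewrite mulr_ge0// expR_ge0.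
    by rewrite /l; lra.
have [c0 c00 hc0] : exists2 c : R, 0 <= c & forall x : R, 0 <= x <= 1 ->
    `|w 1 x - w 0 x| <= c.
  have cn : {within `[0, 1], continuous (fun x => `|w 1 x - w 0 x|)}.
    by move=> x; exact: cont_comp (cont_sub (cw 1 x) (cw 0 x)) (@norm_continuous _ _ _).
  have [c _ hc] := EVT_max ler01 cn.
  by exists `|w 1 c - w 0 c| => // x x01; apply: hc; rewrite in_itv/=.
have step k : forall x : R, 0 <= x <= 1 ->
    `|w k.+1 x - w k x| <= c0 / 2 ^+ k * expR (l * x).
  elim: k => [|k IH] x x01.
    rewrite expr0 divr1 (le_trans (hc0 x x01))// ler_peMr// -expR0 ler_expR.
    by rewrite mulr_ge0 ?(ltW l0)//; case/andP: x01.
  rewrite exprS invfM [2^-1 * _]mulrC mulrA.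
  have hh : 0 <= c0 / 2 ^+ k by rewrite divr_ge0// exprn_ge0.
  exact: (weight _ _ _ (cw k.+1) (cw k) hh IH x x01).
pose c := c0 * expR l.
have cge0 : 0 <= c by rewrite mulr_ge0// expR_ge0.
have step' k x : 0 <= x <= 1 -> `|w k.+1 x - w k x| <= c / 2 ^+ k.
  move=> x01; rewrite (le_trans (step k x x01))// /c [leRHS]mulrAC ler_wpM2l//.
    by rewrite divr_ge0// exprn_ge0.
  by rewrite ler_expR ler_piMr ?(ltW l0)//; case/andP: x01.
have cauchy n k x : 0 <= x <= 1 -> `|w (k + n)%N x - w k x| <= 2 * c / 2 ^+ k.
  move=> x01; suff : `|w (k + n)%N x - w k x| <= 2 * c / 2 ^+ k - 2 * c / 2 ^+ (k + n)%N.
    move/le_trans; apply; rewrite lerBlDr lerDl divr_ge0 ?exprn_ge0//.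
    by rewrite mulr_ge0.
  elim: n => [|n IH]; first by rewrite addn0 !subrr normr0.
  rewrite addnS -(subrKA (w (k + n)%N x)).
  rewrite (le_trans (ler_normD _ _))//.
  have := step' (k + n)%N x x01; move: IH; rewrite exprS invfM.
  by lra.
have cvg_w x : 0 <= x <= 1 -> cvgn (fun k => w k x).
  move=> x01; apply/cauchy_cvgP/cauchy_exP => e e0.
  have [k hk] := half_pow_small (2 * c) e0.
  exists (w k x); exists k => // n /= kn; rewrite -ball_normE/= distrC.
  by rewrite -(subnKC kn) (le_lt_trans _ hk)// cauchy.
pose W x := limn (fun k => w k x).
have W_w k x : 0 <= x <= 1 -> `|W x - w k x| <= 2 * c / 2 ^+ k.
  move=> x01; apply/ler_addgt0Pl => e e0.
  have /cvgrPdist_lt/(_ e e0)[N _ hN] := cvg_w x x01.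
  rewrite -(subrKA (w (k + N)%N x)) (le_trans (ler_normD _ _))// lerD ?cauchy//.
  by rewrite ltW// hN//= leq_addl.
have cW : {within `[0, 1], continuous W}.
  apply/within_continuousP => x; rewrite /= in_itv/= => x01 e e0.
  have e3 : 0 < e / 3 by lra.
  have [k hk] := half_pow_small (2 * c) e3.
  have xI : [set` `[0, 1]] x by rewrite /= in_itv.
  have [d d0 hd] := (within_continuousP _ _).1 (cw k) x xI _ e3.
  exists d => // y yI yx; have hy := hd y yI yx.
  have y01 : 0 <= y <= 1 by move: yI; rewrite /= in_itv.
  have h1 := W_w k x x01; have h2 := W_w k y y01.
  have -> : W y - W x = (W y - w k y) + (w k y - w k x) - (W x - w k x).
    by apply/matrixP => i j; rewrite !mxE; ring.
  rewrite (le_lt_trans (ler_normB _ _))//.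
  by have := ler_normD (W y - w k y) (w k y - w k x); lra.
exists (T W); have [TW0 dTW] := hT W cW; split=> // x x01.
suff -> : T W x = W x by exact: dTW.
apply/eqP; rewrite -subr_eq0 -normr_le0; apply/ler_addgt0Pl => e e0; rewrite addr0.
(* [T W] and [W] are both close to [w k.+1], which is [T (w k)]: the term with [expR l] pays for the
   first distance, the other for the second. *)
have [k hk] := half_pow_small (2 * (2 * c * (1 + expR l))) e0.
have h0 : 0 <= 2 * c / 2 ^+ k by rewrite divr_ge0 ?exprn_ge0// mulr_ge0.
have hw : forall x : R, 0 <= x <= 1 -> `|W x - w k x| <= 2 * c / 2 ^+ k * expR (l * x).
  move=> y y01; rewrite (le_trans (W_w k y y01))// ler_peMr// -expR0 ler_expR.
  by rewrite mulr_ge0 ?(ltW l0)//; case/andP: y01.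
have h1 := weight W (w k) _ cW (cw k) h0 hw x x01.
have h2 := W_w k.+1 x x01; rewrite exprS invfM in h2.
rewrite -(subrKA (w k.+1 x)) (le_trans (ler_normD _ _))// distrC [X in X + _]distrC.
rewrite [X in _ + X]distrC.
have h3 : expR (l * x) <= expR l by rewrite ler_expR ler_piMr ?(ltW l0)//; case/andP: x01.
have h4 : 2 * c / 2 ^+ k * expR (l * x) <= 2 * c / 2 ^+ k * expR l by rewrite ler_wpM2l.
have h5 : 0 <= 2 * c / 2 ^+ k * expR l by rewrite mulr_ge0// expR_ge0.
change (T (w k) x) with (w k.+1 x) in h1.
nra.
Qed.

End picard.

(** * The flow near an equilibrium *)

Section flow.
Context {R : realType} (p : nat).
Variables (H : 'cV[R]_p -> 'cV[R]_p) (DH : 'cV[R]_p -> 'M[R]_p) (y0 : 'cV[R]_p).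
Variables (rho K : R).
Hypotheses (rho0 : 0 < rho) (K0 : 0 <= K) (Hy0 : H y0 = 0).
Hypothesis DH_le : forall a : 'cV[R]_p, `|a - y0| <= rho -> `|DH a| <= K.
Hypothesis DH_lip : forall a b : 'cV[R]_p, `|a - y0| <= rho -> `|b - y0| <= rho ->
  `|DH a - DH b| <= K * `|a - b|.
Hypothesis H_taylor : forall a b : 'cV[R]_p, `|a - y0| <= rho -> `|b - y0| <= rho ->
  `|H a - H b - DH b *m (a - b)| <= K * `|a - b| ^+ 2.

(** A Lipschitz constant of [H] on the ball: [p%:R * K] for the linear part, [2 * rho * K] for the
    quadratic remainder, since two points of the ball are at most [2 * rho] apart. *)
Let L : R := p%:R * K + 2 * rho * K.
Let L0 : 0 <= L.
Proof. by rewrite addr_ge0// ?mulr_ge0// ltW. Qed.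

Let H_lip (a b : 'cV[R]_p) : `|a - y0| <= rho -> `|b - y0| <= rho -> `|H a - H b| <= L * `|a - b|.
Proof.
move=> ha hb; have h1 := H_taylor ha hb; have h2 := DH_le hb.
have h3 := mulmx_norm_le (DH b) (a - b).
have h4 : `|a - b| <= 2 * rho.
  rewrite -(subrKA y0) (le_trans (ler_normD _ _))// [X in _ + X]distrC; lra.
have h5 : p%:R * `|DH b| * `|a - b| <= p%:R * K * `|a - b| by rewrite ler_wpM2r// ler_wpM2l.
have h6 : K * `|a - b| ^+ 2 <= K * (2 * rho * `|a - b|).
  by rewrite ler_wpM2l// expr2 ler_wpM2r.
rewrite -(subrK (DH b *m (a - b)) (H a - H b)) (le_trans (ler_normD _ _))//.
by rewrite /L; lra.
Qed.

Let kappa : R := expR ((p * 1)%:R * (2 * L + 1)).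
Let kappa0 : 0 <= kappa. Proof. exact: expR_ge0. Qed.

(** The retraction onto the ball of radius [rho]. Balls of the sup norm are cubes, so clamping each
    coordinate is 1-Lipschitz, and [H] after it is globally Lipschitz. *)
Let clampB (y : 'cV[R]_p) : 'cV[R]_p :=
  \col_i (y0 i 0 + Num.max (- rho) (Num.min rho (y i 0 - y0 i 0))).

Let clampB_in (y : 'cV[R]_p) : `|clampB y - y0| <= rho.
Proof.
apply: mx_norm_le => [|i j]; first exact: ltW.
rewrite !mxE ord1 addrAC subrr add0r /Num.max /Num.min ler_norml.
by move: rho0; repeat case: ifPn; rewrite -?leNgt => *; apply/andP; split; lra.
Qed.

Let clampB_id (y : 'cV[R]_p) : `|y - y0| <= rho -> clampB y = y.
Proof.
move=> hy; apply/matrixP => i j; rewrite !mxE ord1.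
have := le_trans (mx_entry_le (y - y0) i 0) hy.
rewrite !mxE ler_norml => /andP[h1 h2].
by rewrite (min_idPr h2) (max_idPr h1); ring.
Qed.

Let clampB_lip (y y' : 'cV[R]_p) : `|clampB y - clampB y'| <= `|y - y'|.
Proof.
apply: mx_norm_le => // i j; apply: le_trans (mx_entry_le (y - y') i j).
rewrite !mxE ord1 /Num.max /Num.min.
set a := y i 0; set b := y' i 0; set c := y0 i 0.
have [h1 h2] : a - b <= `|a - b| /\ b - a <= `|a - b|.
  by rewrite ler_norm distrC ler_norm.
by rewrite ler_norml; move: rho0; repeat case: ifPn; rewrite -?leNgt => *; apply/andP; split; lra.
Qed.

(** Growth factor of distances over unit time: the initial distance plus the displacement that
    Gronwall allows. *)
Let M1 : R := 1 + L * kappa.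
Let M1_ge1 : 1 <= M1. Proof. by rewrite lerDl mulr_ge0. Qed.

(** Solutions starting within [rho1] stay within [rho / 4], hence never feel the clamp; the
    remaining room serves the barrier in [flow_unique]. *)
Let rho1 : R := rho / (4 * M1).
Let rho1_gt0 : 0 < rho1.
Proof. by rewrite divr_gt0// mulr_gt0// (lt_le_trans ltr01). Qed.

Let rho1_le : M1 * rho1 <= rho / 4.
Proof.
have M0 : M1 != 0 by rewrite gt_eqF// (lt_le_trans ltr01).
by rewrite le_eqVlt; apply/orP; left; apply/eqP; rewrite /rho1; field.
Qed.

Let solves (y : 'cV[R]_p) (Y : R -> 'cV[R]_p) := Y 0 = y /\
  forall x : R, 0 <= x <= 1 ->
    is_derive x 1 Y (H (Y x)) /\ `|Y x - y0| <= M1 * `|y - y0|.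

(** Solve the clamped equation globally; the a priori bound keeps the solution where the clamp is
    the identity. *)
Let flow_exists (y : 'cV[R]_p) : `|y - y0| <= rho1 -> exists Y, solves y Y.
Proof.
move=> hy.
have [||Y [Y0 dY]] := @picard R p 1 (fun _ u => H (clampB u)) L y L0.
- by move=> x u v _; rewrite (le_trans (H_lip _ _))// ler_wpM2l// clampB_lip.
- move=> W /within_continuousP cW; apply/within_continuousP => x Ax e e0.
  have L10 : 0 < L + 1 by rewrite ltr_wpDl.
  have [|d d0 hd] := cW x Ax (e / (L + 1)); first by rewrite divr_gt0.
  exists d => // z Az xz.
  rewrite (le_lt_trans (H_lip _ _))//; have := hd z Az xz.
  rewrite ltr_pdivlMr// => h.
  have h1 := clampB_lip (W z) (W x).
  have h2 : L * `|clampB (W z) - clampB (W x)| <= L * `|W z - W x| by rewrite ler_wpM2l.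
  by have h3 := normr_ge0 (W z - W x); lra.
have bound x : 0 <= x <= 1 -> `|Y x - y0| <= M1 * `|y - y0|.
  move=> x01; rewrite -(subrKA y) (le_trans (ler_normD _ _))// /M1 mulrDl mul1r addrC lerD2l.
  rewrite [leRHS]mulrAC.
  apply: (@gronwall_mx R p 1 (fun x => Y x - y) (fun x => H (clampB (Y x)))) => //.
  - by rewrite mulr_ge0.
  - move=> z; apply: cont_sub; last exact: cst_continuous.
    by apply: (@is_derive_within _ _ _ _ _ (fun x => H (clampB (Y x)))).
  - by rewrite Y0 subrr.
  - move=> z /andP[z0 z1]; have ? := dY z; have ? : is_derive z 1 Y (H (clampB (Y z))).
      by apply: dY; rewrite !ltW.
    by apply: is_derive_eq; rewrite subr0.
  - move=> z z01; rewrite -mulrDr.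
    have := H_lip (clampB_in (Y z)) (_ : `|y0 - y0| <= rho).
    rewrite subrr normr0 Hy0 subr0 => /(_ (ltW rho0))/le_trans; apply.
    rewrite ler_wpM2l//; apply: le_trans (ler_normD _ _).
    rewrite subrKA -[X in clampB _ - X](@clampB_id y0) ?clampB_lip//.
    by rewrite subrr normr0 ltW.
exists Y; split=> // x x01; split; last exact: bound.
have := dY x x01; rewrite clampB_id// (le_trans (bound x x01))//.
have : M1 * `|y - y0| <= M1 * rho1 by rewrite ler_wpM2l// (le_trans ler01).
by move: rho1_le rho0; lra.
Qed.

Let solves_in (y : 'cV[R]_p) (Y : R -> 'cV[R]_p) : `|y - y0| <= rho1 -> solves y Y ->
  forall x : R, 0 <= x <= 1 -> `|Y x - y0| <= rho.
Proof.
move=> hy [_ h] x x01; have [_ /le_trans] := h x x01; apply.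
have : M1 * `|y - y0| <= M1 * rho1 by rewrite ler_wpM2l// (le_trans ler01).
by move: rho1_le rho0; lra.
Qed.

Let solves_cont (y : 'cV[R]_p) (Y : R -> 'cV[R]_p) : solves y Y -> {within `[0, 1], continuous Y}.
Proof.
move=> [_ h]; apply: (@is_derive_within _ _ _ _ _ (fun x => H (Y x))) => x.
by rewrite /= in_itv/= => /h[].
Qed.

(** [V] is not assumed to stay in the ball where [H] is controlled. The Gronwall estimate with
    barrier [rho / 2] on the distance to [y] confines it first; then Gronwall with zero defect
    compares it with [Y]. *)
Let flow_unique (y : 'cV[R]_p) (Y V : R -> 'cV[R]_p) : `|y - y0| <= rho1 -> solves y Y ->
  {within `[0, 1], continuous V} -> V 0 = y ->
  (forall x : R, 0 < x < 1 -> is_derive x 1 V (H (V x))) ->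
  forall x : R, 0 <= x <= 1 -> V x = Y x.
Proof.
move=> hy sY cV V0 dV.
have yrho : `|y - y0| <= rho / 4.
  apply: le_trans rho1_le; rewrite (le_trans hy)// ler_peMl// ltW//.
have Vin x : 0 <= x <= 1 -> `|V x - y0| <= rho.
  move=> x01.
  have hd : L * `|y - y0| * kappa < rho / 2.
    have : M1 * `|y - y0| <= M1 * rho1 by rewrite ler_wpM2l// (le_trans ler01).
    by move: rho1_le rho0 (normr_ge0 (y - y0)); rewrite /M1; nra.
  have : `|V x - y| <= L * `|y - y0| * kappa.
    apply: (@gronwall_mx_barrier R p 1 (fun x => V x - y) (fun x => H (V x)) _ _ (rho / 2)) => //.
    - by rewrite mulr_ge0.
    - by move=> z; apply: cont_sub; [exact: cV|exact: cst_continuous].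
    - by rewrite V0 subrr.
    - by move=> z z01; have ? := dV z z01; apply: is_derive_eq; rewrite subr0.
    - move=> z z01 hz.
      have hVz : `|V z - y0| <= rho.
        by rewrite -(subrKA y) (le_trans (ler_normD _ _))//; move: rho0; lra.
      have := H_lip hVz (_ : `|y0 - y0| <= rho).
      rewrite subrr normr0 Hy0 subr0 => /(_ (ltW rho0))/le_trans; apply.
      by rewrite -mulrDr ler_wpM2l//; apply: le_trans (ler_normD _ _); rewrite subrKA.
  move=> h; rewrite -(subrKA y) (le_trans (ler_normD _ _))//; move: rho0 hd; lra.
move=> x x01; apply/eqP; rewrite -subr_eq0 -normr_le0.
rewrite -[leRHS](mul0r kappa).
have [Y0 dY] := sY.
apply: (@gronwall_mx R p 1 (fun x => V x - Y x) (fun x => H (V x) - H (Y x)) L 0) => //.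
- by move=> z; apply: cont_sub; [exact: cV|exact: (solves_cont sY)].
- by rewrite V0 Y0 subrr.
- move=> z z01; have ? := dV z z01; have /andP[z0 z1] := z01.
  by have [|? _] := dY z; [rewrite !ltW|exact: is_deriveB].
- move=> z /andP[z0 z1]; have z01 : 0 <= z <= 1 by rewrite !ltW.
  by rewrite addr0 H_lip// ?Vin// (solves_in hy sY).
Qed.

Let flow_lip (y y' : 'cV[R]_p) (Y Y' : R -> 'cV[R]_p) : `|y - y0| <= rho1 -> `|y' - y0| <= rho1 ->
  solves y Y -> solves y' Y' ->
  forall x : R, 0 <= x <= 1 -> `|Y x - Y' x| <= M1 * `|y - y'|.
Proof.
move=> hy hy' sY sY' x x01; have [Y0 dY] := sY; have [Y'0 dY'] := sY'.
have -> : Y x - Y' x = (y - y') + (Y x - Y' x - (y - y')).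
  by rewrite [RHS]addrC subrK.
rewrite (le_trans (ler_normD _ _))// /M1 mulrDl mul1r lerD2l.
rewrite [leRHS]mulrAC.
apply: (@gronwall_mx R p 1 (fun x => Y x - Y' x - (y - y')) (fun x => H (Y x) - H (Y' x))) => //.
- by rewrite mulr_ge0.
- apply: within_sub; last exact: within_cst.
  by apply: within_sub; [exact: (solves_cont sY)|exact: (solves_cont sY')].
- by rewrite Y0 Y'0 subrr.
- move=> z /andP[z0 z1]; have z01 : 0 <= z <= 1 by rewrite !ltW.
  have [? _] := dY z z01; have [? _] := dY' z z01.
  by apply: is_derive_eq; rewrite subr0.
- move=> z /andP[z0 z1]; have z01 : 0 <= z <= 1 by rewrite !ltW.
  rewrite (le_trans (H_lip _ _)) ?(solves_in hy sY) ?(solves_in hy' sY')//.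
  rewrite -mulrDr ler_wpM2l//.
  by rewrite -[in leLHS](subrK (y - y') (Y z - Y' z)) ler_normD.
Qed.

(* [Z 1] is the derivative of the time-one map at [ys]; the remainder is uniform in [ys]. *)
Lemma flow_near_equilibrium : exists (r M : R) (Y : 'cV[R]_p -> R -> 'cV[R]_p),
  [/\ 0 < r, 0 <= M,
    forall y : 'cV[R]_p, `|y - y0| <= r -> Y y 0 = y /\ forall x : R, 0 <= x <= 1 ->
      [/\ is_derive x 1 (Y y) (H (Y y x)), `|Y y x - y0| <= M * `|y - y0| &
          `|Y y x - y0| <= rho],
    forall (y : 'cV[R]_p) (V : R -> 'cV[R]_p), `|y - y0| <= r ->
      {within `[0, 1], continuous V} -> V 0 = y ->
      (forall x : R, 0 < x < 1 -> is_derive x 1 V (H (V x))) ->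
      forall x : R, 0 <= x <= 1 -> V x = Y y x &
    forall ys : 'cV[R]_p, `|ys - y0| <= r -> exists Z : R -> 'M[R]_p,
      [/\ Z 0 = 1%:M,
          forall x : R, 0 <= x <= 1 -> is_derive x 1 Z (DH (Y ys x) *m Z x) &
          forall y y' : 'cV[R]_p, `|y - y0| <= r -> `|y' - y0| <= r ->
            `|Y y 1 - Y y' 1 - Z 1 *m (y - y')| <=
              M * (`|y - y'| * (`|y - y'| + `|y' - ys|))]].
Proof.
have /choice[Y hY] : forall y : 'cV[R]_p, exists Y : R -> 'cV[R]_p, `|y - y0| <= rho1 -> solves y Y.
  move=> y; have [h|h] := pselect (`|y - y0| <= rho1).
    by have [Y sY] := flow_exists h; exists Y.
  by exists (fun=> 0).
pose K2 := expR ((p * 1)%:R * (2 * (p%:R * K) + 1)) : R.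
have K20 : 0 <= K2 by exact: expR_ge0.
pose M2 := (K * M1 ^+ 2 + p%:R * K * M1 ^+ 2) * K2.
have M20 : 0 <= M2.
  by rewrite mulr_ge0// addr_ge0// ?mulr_ge0// ?exprn_ge0// (le_trans ler01).
have M10 : 0 <= M1 by rewrite (le_trans ler01).
exists rho1, (M1 + M2), Y; split=> //.
- by rewrite addr_ge0.
- move=> y hy; have sY := hY y hy; have [Y0 dY] := sY; split=> // x x01.
  have [h1 h2] := dY x x01; split=> //; last exact: (solves_in hy sY).
  by rewrite (le_trans h2)// ler_wpM2r// lerDl.
- by move=> y V hy; apply: flow_unique => //; exact: hY.
move=> ys hys; have sYs := hY ys hys; have [Ys0 dYs] := sYs.
have inYs := solves_in hys sYs.
have pK0 : 0 <= p%:R * K by rewrite mulr_ge0.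
have cYs : {within `[0, 1], continuous (fun x => DH (Y ys x))}.
  have /within_continuousP cY := solves_cont sYs.
  apply/within_continuousP => x Ax e e0.
  have K10 : 0 < K + 1 by rewrite ltr_wpDl.
  have [|d d0 hd] := cY x Ax (e / (K + 1)); first by rewrite divr_gt0.
  exists d => // z Az xz; have := hd z Az xz; rewrite ltr_pdivlMr// => h.
  move: Ax Az; rewrite /= !in_itv/= => x01 z01.
  rewrite (le_lt_trans (DH_lip (inYs z z01) (inYs x x01)))//.
  by have h3 := normr_ge0 (Y ys z - Y ys x); lra.
have [||Z [Z0 dZ]] := @picard R p p (fun x u => DH (Y ys x) *m u) (p%:R * K) 1%:M pK0.
- move=> x u v x01; rewrite -mulmxBr (le_trans (mulmx_norm_le _ _))//.
  by rewrite ler_wpM2r// ler_wpM2l// DH_le// inYs.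
- by move=> W cW x; exact: continuous_mulmx (cYs x) (cW x).
exists Z; split=> // y y' hy hy'.
have sY := hY y hy; have sY' := hY y' hy'; have [Y0 dY] := sY; have [Y'0 dY'] := sY'.
have cZ : {within `[0, 1], continuous Z}.
  by apply: (@is_derive_within _ _ _ _ _ (fun x => DH (Y ys x) *m Z x)).
set nyy := `|y - y'|; set nys := `|y' - ys|.
(* The defect of the linearised comparison: the Taylor remainder of [H] between the two flows, and
   the change of [DH] from the second flow to the reference flow. *)
pose d := K * M1 ^+ 2 * nyy ^+ 2 + p%:R * K * M1 ^+ 2 * (nys * nyy).
have nyy0 : 0 <= nyy by exact: normr_ge0.
have nys0 : 0 <= nys by exact: normr_ge0.
have M1sq : 0 <= M1 ^+ 2 by exact: exprn_ge0.
have d0 : 0 <= d.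
  by rewrite addr_ge0// (mulr_ge0 (mulr_ge0 _ _)) ?exprn_ge0// mulr_ge0.
apply: (@le_trans _ _ (d * K2)).
  apply: (@gronwall_mx R p 1 (fun x => Y y x - Y y' x - Z x *m (y - y'))
    (fun x => H (Y y x) - H (Y y' x) - DH (Y ys x) *m Z x *m (y - y')) (p%:R * K) d) => //.
  - apply: within_sub; last by apply: within_mulmx => //; exact: within_cst.
    by apply: within_sub; [exact: (solves_cont sY)|exact: (solves_cont sY')].
  - by rewrite Y0 Y'0 Z0 mul1mx subrr.
  - move=> z /andP[z0 z1]; have z01 : 0 <= z <= 1 by rewrite !ltW.
    have [? _] := dY z z01; have [? _] := dY' z z01; apply: is_deriveB.
    apply: is_derive_eq (is_derive_mulmx (dZ z z01) (is_derive_cst (y - y') z 1)) _.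
    by rewrite mulmx0 addr0.
  - move=> z /andP[z0 z1]; have z01 : 0 <= z <= 1 by rewrite !ltW.
    have ia := solves_in hy sY z01; have ib := solves_in hy' sY' z01; have ic := inYs z z01.
    have lab := flow_lip hy hy' sY sY' z01; have lbc := flow_lip hy' hys sY' sYs z01.
    move: ia ib ic lab lbc.
    move: (Y y z) (Y y' z) (Y ys z) => a b c ia ib ic lab lbc.
    (* Taylor remainder at [b], plus the change of base point from [b] to [c], plus [DH c] applied
       to the unknown of Gronwall's inequality. *)
    have -> : H a - H b - DH c *m Z z *m (y - y') =
      (H a - H b - DH b *m (a - b)) + (DH b - DH c) *m (a - b) +
      DH c *m (a - b - Z z *m (y - y')).
      rewrite mulmxBl [DH c *m (_ - Z z *m _)]mulmxBr mulmxA.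
      move: (H a - H b) (DH b *m _) (DH c *m (a - b)) (_ *m (y - y')) => u v w t.
      by apply/matrixP => i j; rewrite !mxE; ring.
    rewrite (le_trans (ler_normD _ _))// addrC lerD//.
      by rewrite (le_trans (mulmx_norm_le _ _))// ler_wpM2r// ler_wpM2l// DH_le.
    rewrite (le_trans (ler_normD _ _))// lerD//.
      rewrite (le_trans (H_taylor ia ib))// -mulrA -exprMn ler_wpM2l//.
      by rewrite !expr2 ler_pM.
    rewrite (le_trans (mulmx_norm_le _ _))//.
    apply: (@le_trans _ _ (p%:R * (K * (M1 * nys)) * (M1 * nyy))); last by nra.
    rewrite ler_pM ?mulr_ge0// ler_wpM2l//.
    by rewrite (le_trans (DH_lip ib ic))// ler_wpM2l.
  by rewrite ler01 lexx.
rewrite /d /M2.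
rewrite /M2 in M20 *; move: (M1 ^+ 2) M1sq M20 => m m0 M20.
have e1 : 0 <= K * m * K2 * (nyy * nys) by rewrite !mulr_ge0.
have e2 : 0 <= p%:R * K * m * K2 * nyy ^+ 2 by rewrite !mulr_ge0// exprn_ge0.
have e3 : 0 <= M1 * (nyy * (nyy + nys)) by rewrite !mulr_ge0// addr_ge0.
by lra.
Qed.

End flow.

(** * Functions with Lipschitz gradient *)

Section c11.
Context {R : realType}.

(* A quantitative form of "[h] is C^1 with Lipschitz gradient near [y0]",
   stable under the operations needed to differentiate a matrix inverse. *)
Definition c11_on (p : nat) (y0 : 'cV[R]_p) (rho K : R) (h : 'cV[R]_p -> R)
    (Dh : 'cV[R]_p -> 'rV[R]_p) : Prop :=
  forall a b : 'cV[R]_p, `|a - y0| <= rho -> `|b - y0| <= rho ->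
  [/\ `|h a| <= K, `|Dh a| <= K, `|Dh a - Dh b| <= K * `|a - b| &
      `|h a - h b - (Dh b *m (a - b)) 0 0| <= K * `|a - b| ^+ 2].

Definition c11 (p : nat) (y0 : 'cV[R]_p) (h : 'cV[R]_p -> R)
    (Dh : 'cV[R]_p -> 'rV[R]_p) : Prop :=
  exists rho K : R, [/\ 0 < rho, 0 <= K & c11_on y0 rho K h Dh].

Lemma c11_on_mono p (y0 : 'cV[R]_p) rho K rho' K' h Dh : rho' <= rho -> K <= K' ->
  c11_on y0 rho K h Dh -> c11_on y0 rho' K' h Dh.
Proof.
move=> r k H a b /le_trans-/(_ _ r) ha /le_trans-/(_ _ r) hb.
have [h1 h2 h3 h4] := H a b ha hb.
split; rewrite ?(le_trans h1)// ?(le_trans h2)// ?(le_trans h3) ?(le_trans h4)//.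
  by rewrite ler_wpM2r.
by rewrite ler_wpM2r// exprn_ge0.
Qed.

Lemma c11_common p (y0 : 'cV[R]_p) h Dh k Dk : c11 y0 h Dh -> c11 y0 k Dk ->
  exists rho K : R, [/\ 0 < rho, 0 <= K, c11_on y0 rho K h Dh & c11_on y0 rho K k Dk].
Proof.
move=> [r1 [K1 [r10 K10 H1]]] [r2 [K2 [r20 K20 H2]]].
exists (Num.min r1 r2), (K1 + K2); split; first by rewrite lt_min r10.
- by rewrite addr_ge0.
- by apply: c11_on_mono H1; rewrite ?ge_min ?lexx// lerDl.
- by apply: c11_on_mono H2; rewrite ?ge_min ?lexx ?orbT// lerDr.
Qed.

Lemma mulrc_le p (u : 'rV[R]_p) (v : 'cV[R]_p) : `|(u *m v) 0 0| <= p%:R * `|u| * `|v|.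
Proof. exact: le_trans (mx_entry_le _ _ _) (mulmx_norm_le _ _). Qed.

Lemma c11_on_lip p (y0 : 'cV[R]_p) rho K h Dh : 0 <= rho -> 0 <= K ->
  c11_on y0 rho K h Dh -> forall a b, `|a - y0| <= rho -> `|b - y0| <= rho ->
  `|h a - h b| <= (p%:R * K + 2 * rho * K) * `|a - b|.
Proof.
move=> r0 K0 H a b ha hb; have [_ _ _ h1] := H a b ha hb.
have [_ h2 _ _] := H b b hb hb.
have h3 := mulrc_le (Dh b) (a - b).
have h4 : `|a - b| <= 2 * rho.
  rewrite -(subrKA y0) (le_trans (ler_normD _ _))// [X in _ + X]distrC; lra.
have h5 : p%:R * `|Dh b| * `|a - b| <= p%:R * K * `|a - b| by rewrite ler_wpM2r// ler_wpM2l.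
have h6 : K * `|a - b| ^+ 2 <= K * (2 * rho * `|a - b|).
  by rewrite ler_wpM2l// expr2 ler_wpM2r.
rewrite -(subrK ((Dh b *m (a - b)) 0 0) (h a - h b)) (le_trans (ler_normD _ _))//; lra.
Qed.

Lemma c11_cst p (y0 : 'cV[R]_p) (c : R) : c11 y0 (fun=> c) (fun=> 0).
Proof.
exists 1, `|c|; split=> // a b _ _.
rewrite !subrr mul0mx mxE !normr0 subr0 normr0; split=> //.
Qed.

Lemma c11_coord p (y0 : 'cV[R]_p) i : c11 y0 (fun a => a i 0) (fun=> delta_mx 0 i).
Proof.
exists 1, (1 + `|y0|); split; [by []|by rewrite addr_ge0|].
move=> a b ha hb; have h0 := normr_ge0 y0.
have hd : `|delta_mx 0 i : 'rV[R]_p| <= 1 + `|y0|.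
  apply: mx_norm_le => [|k l]; first by rewrite addr_ge0.
  by rewrite mxE; case: (_ && _) => /=; rewrite ?normr1 ?normr0; lra.
split=> //.
- rewrite (le_trans (mx_entry_le _ _ _))// -[a](subrK y0).
  by rewrite (le_trans (ler_normD _ _))// lerD2r.
- by rewrite subrr normr0 mulr_ge0// addr_ge0.
- rewrite -rowE !mxE subrr normr0 mulr_ge0// ?exprn_ge0// addr_ge0//.
Qed.

Lemma c11_add p (y0 : 'cV[R]_p) h Dh k Dk : c11 y0 h Dh -> c11 y0 k Dk ->
  c11 y0 (fun a => h a + k a) (fun a => Dh a + Dk a).
Proof.
move=> /c11_common/[apply]-[rho [K [r0 K0 H1 H2]]].
exists rho, (K + K); split=> //; first by rewrite addr_ge0.
move=> a b ha hb; have [a1 a2 a3 a4] := H1 a b ha hb; have [b1 b2 b3 b4] := H2 a b ha hb.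
split.
- by rewrite (le_trans (ler_normD _ _))// lerD.
- by rewrite (le_trans (ler_normD _ _))// lerD.
- by rewrite opprD addrACA (le_trans (ler_normD _ _))// mulrDl lerD.
- rewrite mulmxDl mxE.
  have -> : h a + k a - (h b + k b) - ((Dh b *m (a - b)) 0 0 + (Dk b *m (a - b)) 0 0) =
    (h a - h b - (Dh b *m (a - b)) 0 0) + (k a - k b - (Dk b *m (a - b)) 0 0) by ring.
  by rewrite (le_trans (ler_normD _ _))// mulrDl lerD.
Qed.

Lemma c11_mul p (y0 : 'cV[R]_p) h Dh k Dk : c11 y0 h Dh -> c11 y0 k Dk ->
  c11 y0 (fun a => h a * k a) (fun a => h a *: Dk a + k a *: Dh a).
Proof.
move=> /c11_common/[apply]-[rho [K [r0 K0 H1 H2]]].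
set M := p%:R * K + 2 * rho * K.
have M0 : 0 <= M by rewrite addr_ge0// ?mulr_ge0// ltW.
exists rho, (2 * K ^+ 2 + 2 * (K * M) + M ^+ 2).
have KM : 0 <= K * M by rewrite mulr_ge0.
have K2 : 0 <= K ^+ 2 by rewrite exprn_ge0.
have M2 : 0 <= M ^+ 2 by rewrite exprn_ge0.
split=> //; first by rewrite !addr_ge0// mulr_ge0.
move=> a b ha hb; have [a1 a2 a3 a4] := H1 a b ha hb; have [b1 b2 b3 b4] := H2 a b ha hb.
have [a1' a2' _ _] := H1 b b hb hb; have [b1' b2' _ _] := H2 b b hb hb.
have l1 := c11_on_lip (ltW r0) K0 H1 ha hb; have l2 := c11_on_lip (ltW r0) K0 H2 ha hb.
rewrite -/M in l1 l2.
have n0 := normr_ge0 (a - b).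
split.
- have : `|h a * k a| <= K ^+ 2 by rewrite normrM expr2 ler_pM.
  lra.
- have e1 : `|h a *: Dk a| <= K ^+ 2 by rewrite normrZ expr2 ler_pM.
  have e2 : `|k a *: Dh a| <= K ^+ 2 by rewrite normrZ expr2 ler_pM.
  by rewrite (le_trans (ler_normD _ _))//; lra.
- have -> : h a *: Dk a + k a *: Dh a - (h b *: Dk b + k b *: Dh b) =
    (h a *: (Dk a - Dk b) + (h a - h b) *: Dk b) +
    (k a *: (Dh a - Dh b) + (k a - k b) *: Dh b).
    by apply/matrixP => i j; rewrite !mxE; ring.
  have e1 : `|h a *: (Dk a - Dk b)| <= K * (K * `|a - b|) by rewrite normrZ ler_pM.
  have e2 : `|k a *: (Dh a - Dh b)| <= K * (K * `|a - b|) by rewrite normrZ ler_pM.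
  have e3 : `|(h a - h b) *: Dk b| <= (M * `|a - b|) * K by rewrite normrZ ler_pM.
  have e4 : `|(k a - k b) *: Dh b| <= (M * `|a - b|) * K by rewrite normrZ ler_pM.
  have g1 := ler_normD (h a *: (Dk a - Dk b)) ((h a - h b) *: Dk b).
  have g2 := ler_normD (k a *: (Dh a - Dh b)) ((k a - k b) *: Dh b).
  have g3 : 0 <= M ^+ 2 * `|a - b| by rewrite mulr_ge0.
  by rewrite (le_trans (ler_normD _ _))//; lra.
- rewrite mulmxDl -!scalemxAl mxE [X in _ - (X + _)]mxE [X in _ - (_ + X)]mxE.
  set da := (Dh b *m _) 0 0 in a4 *; set dk := (Dk b *m _) 0 0 in b4 *.
  have -> : h a * k a - h b * k b - (h b * dk + k b * da) =
    h b * (k a - k b - dk) + k b * (h a - h b - da) + (h a - h b) * (k a - k b) by ring.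
  have e1 : `|h b * (k a - k b - dk)| <= K * (K * `|a - b| ^+ 2) by rewrite normrM ler_pM.
  have e2 : `|k b * (h a - h b - da)| <= K * (K * `|a - b| ^+ 2) by rewrite normrM ler_pM.
  have e3 : `|(h a - h b) * (k a - k b)| <= (M * `|a - b|) * (M * `|a - b|) by rewrite normrM ler_pM.
  have g1 := ler_normD (h b * (k a - k b - dk)) (k b * (h a - h b - da)).
  have g3 : 0 <= (K * M) * `|a - b| ^+ 2 by rewrite mulr_ge0// exprn_ge0.
  by rewrite (le_trans (ler_normD _ _))//; lra.
Qed.

(** The radius is shrunk until [|h|] stays above half of [|h y0|]; then [N] bounds the reciprocal
    and all four estimates are algebra. *)
Lemma c11_inv p (y0 : 'cV[R]_p) h Dh : c11 y0 h Dh -> h y0 != 0 ->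
  c11 y0 (fun a => (h a)^-1) (fun a => - (h a) ^- 2 *: Dh a).
Proof.
move=> [rho [K [r0 K0 H]]] hy0.
set M := p%:R * K + 2 * rho * K.
have M0 : 0 <= M by rewrite addr_ge0// ?mulr_ge0// ltW.
pose c := `|h y0| / 2; have c0 : 0 < c by rewrite divr_gt0// normr_gt0.
pose r := Num.min rho (c / (M + 1)).
have M10 : 0 < M + 1 by rewrite ltr_wpDl.
have rr : r <= rho by rewrite ge_min lexx.
have r'0 : 0 < r by rewrite lt_min r0 divr_gt0.
have y0y0 : `|y0 - y0| <= rho by rewrite subrr normr0 ltW.
have hc a : `|a - y0| <= r -> c <= `|h a|.
  move=> ha; have ha' := le_trans ha rr.
  have := c11_on_lip (ltW r0) K0 H ha' y0y0; rewrite -/M => hl.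
  have h1 : (M + 1) * `|a - y0| <= c.
    by rewrite mulrC -ler_pdivlMr// (le_trans ha)// ge_min lexx orbT.
  have h2 := lerB_dist (h y0) (h a); rewrite [in X in _ <= X]distrC in h2.
  have h3 : `|h y0| = 2 * c by rewrite /c; field.
  have h4 := normr_ge0 (a - y0); lra.
pose N := c^-1; have N0 : 0 < N by rewrite invr_gt0.
have hN a : `|a - y0| <= r -> `|(h a)^-1| <= N.
  by move=> ha; rewrite normfV lef_pV2 ?hc// posrE (lt_le_trans c0)// hc.
have h0 a : `|a - y0| <= r -> h a != 0.
  by move=> ha; rewrite -normr_gt0 (lt_le_trans c0)// hc.
have N0' := ltW N0.
pose M' := M * N ^+ 2; have M'0 : 0 <= M' by rewrite mulr_ge0// exprn_ge0.
have lipV a b : `|a - y0| <= r -> `|b - y0| <= r ->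
    `|(h a)^-1 - (h b)^-1| <= M' * `|a - b|.
  move=> ha hb.
  have -> : (h a)^-1 - (h b)^-1 = (h b - h a) * ((h a)^-1 * (h b)^-1).
    by field; rewrite !h0.
  have := c11_on_lip (ltW r0) K0 H (le_trans ha rr) (le_trans hb rr); rewrite -/M => hl.
  rewrite normrM distrC (mulrAC M) ler_pM// normrM expr2 ler_pM// hN//.
exists r, (N + N ^+ 2 * K + 2 * (N * M' * K) + N * (N * K + p%:R * K * M')).
have e1 : 0 <= N ^+ 2 * K by rewrite mulr_ge0// exprn_ge0.
have e2 : 0 <= N * M' * K by rewrite !mulr_ge0.
have e3 : 0 <= N * (N * K + p%:R * K * M') by rewrite mulr_ge0// addr_ge0// ?mulr_ge0.
split=> //; first by rewrite !addr_ge0// mulr_ge0.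
move=> a b ha hb.
have ha' := le_trans ha rr; have hb' := le_trans hb rr.
have [a1 a2 a3 a4] := H a b ha' hb'; have [b1 b2 _ _] := H b b hb' hb'.
have na := hN a ha; have nb := hN b hb; have lv := lipV a b ha hb.
have n0 := normr_ge0 (a - b).
rewrite -!exprVn.
move: na nb lv; move: (h0 a ha) (h0 b hb) => ha0 hb0.
set ga := (h a)^-1; set gb := (h b)^-1 => na nb lv.
have na2 : `|ga ^+ 2| <= N ^+ 2 by rewrite normrX !expr2 ler_pM.
split.
- by rewrite (le_trans na)//; lra.
- rewrite normrZ normrN; have : `|ga ^+ 2| * `|Dh a| <= N ^+ 2 * K by rewrite ler_pM.
  by lra.
- have -> : - ga ^+ 2 *: Dh a - - gb ^+ 2 *: Dh b =
    - ga ^+ 2 *: (Dh a - Dh b) - ((ga + gb) * (ga - gb)) *: Dh b.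
    by apply/matrixP => i j; rewrite !mxE; ring.
  have e4 : `|- ga ^+ 2 *: (Dh a - Dh b)| <= N ^+ 2 * (K * `|a - b|).
    by rewrite normrZ normrN ler_pM.
  have e5 : `|((ga + gb) * (ga - gb)) *: Dh b| <= ((2 * N) * (M' * `|a - b|)) * K.
    rewrite normrZ ler_pM// normrM ler_pM//.
    by rewrite (le_trans (ler_normD _ _))//; lra.
  have g1 := ler_normB (- ga ^+ 2 *: (Dh a - Dh b)) (((ga + gb) * (ga - gb)) *: Dh b).
  have e6 : 0 <= N * (N * K + p%:R * K * M') * `|a - b| by rewrite mulr_ge0.
  have e7 : 0 <= N * `|a - b| by rewrite mulr_ge0.
  by lra.
- rewrite -scalemxAl mxE; set d := (Dh b *m _) 0 0 in a4 *.
  have -> : ga - gb - - gb ^+ 2 * d =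
      gb * (- (h a - h b - d) * ga - d * (ga - gb)).
    by rewrite /ga /gb; field; rewrite ha0 hb0.
  have dle : `|d| <= p%:R * K * `|a - b|.
    by rewrite (le_trans (mulrc_le _ _))// ler_wpM2r// ler_wpM2l.
  have e4 : `|- (h a - h b - d) * ga| <= (K * `|a - b| ^+ 2) * N.
    by rewrite normrM normrN ler_pM.
  have e5 : `|d * (ga - gb)| <= (p%:R * K * `|a - b|) * (M' * `|a - b|).
    by rewrite normrM ler_pM.
  have g1 := ler_normB (- (h a - h b - d) * ga) (d * (ga - gb)).
  have e8 : `|gb * (- (h a - h b - d) * ga - d * (ga - gb))| <=
      N * ((K * `|a - b| ^+ 2) * N + (p%:R * K * `|a - b|) * (M' * `|a - b|)).
    by rewrite normrM ler_pM// (le_trans g1)// lerD.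
  have s0 : 0 <= `|a - b| ^+ 2 by rewrite exprn_ge0.
  have f1 : 0 <= N ^+ 2 * K * `|a - b| ^+ 2 by rewrite mulr_ge0.
  have f2 : 0 <= N * M' * K * `|a - b| ^+ 2 by rewrite mulr_ge0.
  have f3 : 0 <= N * `|a - b| ^+ 2 by rewrite mulr_ge0.
  by lra.
Qed.

Definition is_c11 (p : nat) (y0 : 'cV[R]_p) (h : 'cV[R]_p -> R) := exists Dh, c11 y0 h Dh.

Lemma c11_sum p (y0 : 'cV[R]_p) (I : Type) (s : seq I) (P : pred I)
    (h : I -> 'cV[R]_p -> R) Dh : (forall i, c11 y0 (h i) (Dh i)) ->
  c11 y0 (fun a => \sum_(i <- s | P i) h i a) (fun a => \sum_(i <- s | P i) Dh i a).
Proof.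
move=> H; elim: s => [|i s IH].
  rewrite (_ : (fun a => _) = fun=> 0); last by apply/funext => a; rewrite big_nil.
  rewrite (_ : (fun a => _) = fun=> 0 :> 'rV[R]_p); first exact: c11_cst.
  by apply/funext => a; rewrite big_nil.
under eq_fun do rewrite big_cons; under [X in c11 _ _ X]eq_fun do rewrite big_cons.
by case: (P i) => //; exact: c11_add.
Qed.

Lemma is_c11_sum p (y0 : 'cV[R]_p) (I : Type) (s : seq I) (P : pred I)
    (h : I -> 'cV[R]_p -> R) : (forall i, is_c11 y0 (h i)) ->
  is_c11 y0 (fun a => \sum_(i <- s | P i) h i a).
Proof.
move=> H; have [Dh hD] := choice H.
by exists (fun a => \sum_(i <- s | P i) Dh i a); exact: c11_sum.
Qed.

Lemma is_c11_mul p (y0 : 'cV[R]_p) h k : is_c11 y0 h -> is_c11 y0 k ->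
  is_c11 y0 (fun a => h a * k a).
Proof. by move=> [Dh hh] [Dk hk]; exists (fun a => h a *: Dk a + k a *: Dh a); exact: c11_mul. Qed.

Lemma is_c11_cst p (y0 : 'cV[R]_p) (c : R) : is_c11 y0 (fun=> c).
Proof. by exists (fun=> 0); exact: c11_cst. Qed.

Lemma is_c11_prod p (y0 : 'cV[R]_p) (I : Type) (s : seq I) (P : pred I)
    (h : I -> 'cV[R]_p -> R) : (forall i, is_c11 y0 (h i)) ->
  is_c11 y0 (fun a => \prod_(i <- s | P i) h i a).
Proof.
move=> H; elim: s => [|i s IH].
  rewrite (_ : (fun a => _) = fun=> 1); first exact: is_c11_cst.
  by apply/funext => a; rewrite big_nil.
under eq_fun do rewrite big_cons.
by case: (P i) => //; exact: is_c11_mul.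
Qed.

Lemma is_c11_det p (y0 : 'cV[R]_p) n (M : 'cV[R]_p -> 'M[R]_n) :
  (forall i j, is_c11 y0 (fun a => M a i j)) -> is_c11 y0 (fun a => \det (M a)).
Proof.
move=> H; apply: is_c11_sum => s; apply: is_c11_mul; first exact: is_c11_cst.
by apply: is_c11_prod => i; exact: H.
Qed.

Lemma is_c11_mulmx p (y0 : 'cV[R]_p) n q s (M : 'cV[R]_p -> 'M[R]_(n, q))
    (N : 'cV[R]_p -> 'M[R]_(q, s)) :
  (forall i j, is_c11 y0 (fun a => M a i j)) ->
  (forall i j, is_c11 y0 (fun a => N a i j)) ->
  forall i j, is_c11 y0 (fun a => (M a *m N a) i j).
Proof.
move=> hM hN i j; under eq_fun do rewrite mxE.
by apply: is_c11_sum => k; exact: is_c11_mul.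
Qed.

Lemma is_c11_near p (y0 : 'cV[R]_p) h k (r : R) : 0 < r ->
  (forall a, `|a - y0| <= r -> h a = k a) -> is_c11 y0 h -> is_c11 y0 k.
Proof.
move=> r0 hk [Dh [rho [K [rho0 K0 H]]]]; exists Dh, (Num.min r rho), K.
split=> //; first by rewrite lt_min r0.
move=> a b ha hb; have [ra rb] : `|a - y0| <= r /\ `|b - y0| <= r.
  by rewrite (le_trans ha) ?(le_trans hb)// ge_min lexx.
rewrite -!hk//; apply: H.
  by rewrite (le_trans ha)// ge_min lexx orbT.
by rewrite (le_trans hb)// ge_min lexx orbT.
Qed.

(** Cramer's rule writes an entry of the inverse with determinants and a single reciprocal.
    Invertibility is asked on a whole ball because [invmx] follows this formula only at invertible
    matrices. *)
Lemma is_c11_invmx p (y0 : 'cV[R]_p) n (M : 'cV[R]_p -> 'M[R]_n) (r : R) : 0 < r ->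
  (forall a, `|a - y0| <= r -> M a \in unitmx) ->
  (forall i j, is_c11 y0 (fun a => M a i j)) ->
  forall i j, is_c11 y0 (fun a => invmx (M a) i j).
Proof.
move=> r0 U H i j.
apply: (@is_c11_near _ _ (fun a => (\det (M a))^-1 *
    ((-1) ^+ (j + i) * \det (row' j (col' i (M a))))) _ r) => //.
  by move=> a /U Ua; rewrite /invmx Ua !mxE.
apply: is_c11_mul.
  have [Dd hd] := is_c11_det H.
  exists (fun a => - (\det (M a)) ^- 2 *: Dd a); apply: c11_inv hd _.
  by have := U y0; rewrite subrr normr0 unitmxE unitfE; apply; exact: ltW.
apply: is_c11_mul; first exact: is_c11_cst.
apply: is_c11_det => k l; under eq_fun do rewrite !mxE; exact: H.
Qed.

End c11.

(** * Smooth functions have locally Lipschitz gradients *)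

Section smooth_c11.
Context {R : realType}.

Lemma nbhs_closed_ball_le (V : normedModType R) (u0 : V) (P : set V) :
  nbhs u0 P -> exists2 r : R, 0 < r & forall u, `|u - u0| <= r -> P u.
Proof.
move=> /nbhs_ballP[r /= r0 h]; exists (r / 2); first by rewrite divr_gt0.
by move=> u hu; apply: h; rewrite -ball_normE/= distrC (le_lt_trans hu)// ltr_pdivrMr// ltr_pMr// ltr1n.
Qed.

Lemma le_sum_term (I : finType) (F : I -> R) i : (forall j, 0 <= F j) ->
  F i <= \sum_j F j.
Proof. by move=> F0; rewrite (bigD1 i)//= lerDl sumr_ge0. Qed.

Lemma derive_partials n p q (F : 'cV[R]_n -> 'M[R]_(p, q)) (c v : 'cV[R]_n) :
  differentiable F c -> 'D_v F c = \sum_k v k 0 *: 'D_(delta_mx k 0) F c.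
Proof.
move=> dF; rewrite deriveE// {1}[v]matrix_sum_delta.
under eq_bigr do rewrite big_ord1.
rewrite raddf_sum; apply: eq_bigr => k _.
by rewrite [LHS]linearZ /= deriveE.
Qed.

(** The mean value theorem holds for scalar functions only, so the intermediate point depends on the
    entry. Its distance to [b] is recorded for the quadratic Taylor remainder. *)
Lemma MVT_entry n p q (F : 'cV[R]_n -> 'M[R]_(p, q)) (u0 a b : 'cV[R]_n) (r : R) i j :
  (forall u : 'cV[R]_n, `|u - u0| <= r -> differentiable F u) ->
  `|a - u0| <= r -> `|b - u0| <= r ->
  exists c, [/\ `|c - u0| <= r, `|c - b| <= `|a - b| &
    F a i j - F b i j = \sum_k (a - b) k 0 * ('D_(delta_mx k 0) F c) i j].
Proof.
move=> dF ha hb; pose v : 'cV[R]_n := a - b; pose c (t : R) : 'cV[R]_n := b + t *: v.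
pose phi t := F (c t) i j.
have hc (t : R) : 0 <= t <= 1 -> `|c t - u0| <= r.
  move=> /andP[t0 t1].
  have -> : c t - u0 = t *: (a - u0) + (1 - t) *: (b - u0).
    by apply/matrixP => k l; rewrite !mxE; ring.
  rewrite (le_trans (ler_normD _ _))// !normrZ !ger0_norm ?subr_ge0//.
  have h1 : t * `|a - u0| <= t * r by rewrite ler_wpM2l.
  have h2 : (1 - t) * `|b - u0| <= (1 - t) * r by rewrite ler_wpM2l// subr_ge0.
  lra.
have dphi (t : R) : 0 <= t <= 1 -> is_derive t 1 phi (('D_v F (c t)) i j).
  move=> t01; have d : derivable F (c t) v by apply/diff_derivable/dF/hc.
  have E : (fun h : R => h^-1 *: ((phi \o shift t) (h *: 1) - phi t)) =
    (fun h : R => h^-1 *: (((fun u => F u i j) \o shift (c t)) (h *: v) - F (c t) i j)).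
    apply/funext => h; rewrite /phi /=; congr (_ *: (F _ i j - _)).
    by apply/matrixP => k l; rewrite !mxE /GRing.scale/=; ring.
  have d' := (derivable_mxP _ _ _).1 d i j.
  apply: DeriveDef; first by rewrite /derivable E.
  by rewrite derive_mx// mxE /derive E.
have cphi : {within `[0, 1], continuous phi}.
  apply: derivable_within_continuous => t; rewrite in_itv/= => /dphi[] //.
have dphi' : forall t : R, t \in `]0, 1[ -> is_derive t 1 phi (('D_v F (c t)) i j).
  by move=> t; rewrite in_itv/= => /andP[t0 t1]; apply: dphi; rewrite !ltW.
have [t + E] := MVT ltr01 dphi' cphi.
rewrite in_itv/= => /andP[t0 t1]; have t01 : 0 <= t <= 1 by rewrite !ltW.
exists (c t); split; first exact: hc.
  rewrite /c addrC addKr normrZ ger0_norm ?(ltW t0)// ler_piMl// ltW//.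
move: E; rewrite /phi /c scale1r scale0r addr0 /v [b + _]addrC subrK subr0 mulr1 => ->.
rewrite -/v -/(c t) derive_partials; last exact: dF (hc t t01).
by rewrite summxE; apply: eq_bigr => k _; rewrite mxE.
Qed.

(** The second partial derivatives are bounded near [u0] by continuity. The mean value theorem
    applied to the first partials makes the gradient Lipschitz; applied to [g], it leaves the
    difference of two gradients, hence a quadratic remainder. *)
Lemma c11_of_C2 n p q (D : set 'cV[R]_n) (g : 'cV[R]_n -> 'M[R]_(p, q))
    (u0 : 'cV[R]_n) i j : open D -> D u0 -> Ck_on 2 D g ->
  c11 u0 (fun u => g u i j) (fun u => \row_k ('D_(delta_mx k 0) g u) i j).
Proof.
move=> oD Du0 [dg Hg].
pose d (k : 'I_n) := 'D_(delta_mx k 0) g; pose dd k (l : 'I_n) := 'D_(delta_mx l 0) (d k).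
have ddif k u : D u -> differentiable (d k) u by move=> Du; have [h _] := Hg (delta_mx k 0); exact: h.
have ddc k l u : D u -> {for u, continuous (dd k l)}.
  by move=> Du; have [_ h] := Hg (delta_mx k 0); exact: h.
have bnd (W : normedModType R) (F : 'cV[R]_n -> W) : {for u0, continuous F} ->
    nbhs u0 [set u | `|F u| <= `|F u0| + 1].
  move=> cF; move/cvgrPdist_le : cF => /(_ 1 ltr01); apply: filterS => u /=.
  move=> h; rewrite -[F u](subrK (F u0)) (le_trans (ler_normD _ _))// addrC lerD2l.
  by rewrite distrC.
have : \forall u \near u0, [/\ D u, `|g u| <= `|g u0| + 1,
    forall k, `|d k u| <= `|d k u0| + 1 &
    forall k l, `|dd k l u| <= `|dd k l u0| + 1].
  near=> u; split; near: u.
  - exact: open_nbhs_nbhs.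
  - by apply: bnd; apply: differentiable_continuous; exact: dg.
  - by apply: filter_forall => k; apply: bnd; apply: differentiable_continuous; exact: ddif.
  - apply: filter_forall => k; apply: filter_forall => l; apply: bnd; exact: ddc.
move=> /nbhs_closed_ball_le[r r0 hr].
pose Kd := \sum_k (`|d k u0| + 1); pose Kdd := \sum_k \sum_l (`|dd k l u0| + 1).
have hKd k : `|d k u0| + 1 <= Kd.
  by apply: (le_sum_term (F := fun k => `|d k u0| + 1)) => l; rewrite addr_ge0.
have hKdd k l : `|dd k l u0| + 1 <= Kdd.
  apply: le_trans (le_sum_term (F := fun l => `|dd k l u0| + 1) l _) _.
    by move=> z; rewrite addr_ge0.
  apply: (le_sum_term (F := fun k => \sum_l (`|dd k l u0| + 1))) => z.
  by apply: sumr_ge0 => ? _; rewrite addr_ge0.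
have Kd0 : 0 <= Kd by apply: sumr_ge0 => k _; rewrite addr_ge0.
have Kdd0 : 0 <= Kdd by apply: sumr_ge0 => ? _; apply: sumr_ge0 => ? _; rewrite addr_ge0.
have Dr u : `|u - u0| <= r -> D u by move=> /hr[].
have lip a b : `|a - u0| <= r -> `|b - u0| <= r ->
   `|\row_k ('D_(delta_mx k 0) g a) i j - \row_k ('D_(delta_mx k 0) g b) i j : 'rV[R]_n|
     <= n%:R * Kdd * `|a - b|.
  move=> ha hb; apply: mx_norm_le => [|z k]; first by rewrite !mulr_ge0.
  rewrite !mxE.
  have [c [hc _ ->]] := MVT_entry i j (fun u hu => ddif k u (Dr u hu)) ha hb.
  rewrite (le_trans (ler_norm_sum _ _ _))//.
  apply: (@le_trans _ _ (\sum_(l < n) `|a - b| * Kdd)).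
    apply: ler_sum => l _; rewrite normrM ler_pM//; first exact: mx_entry_le.
    by rewrite (le_trans (mx_entry_le _ _ _))//; have [_ _ _ h] := hr c hc; exact: le_trans (h k l) (hKdd k l).
  by rewrite sumr_const card_ord -[leLHS]mulr_natl -mulrA (mulrC Kdd).
have nK : 0 <= n%:R * Kdd by rewrite mulr_ge0.
exists r, (`|g u0| + 1 + Kd + n%:R * Kdd + n%:R * (n%:R * Kdd)).
have ng := normr_ge0 (g u0).
have nnK : 0 <= n%:R * (n%:R * Kdd) by rewrite mulr_ge0.
split=> //; first by rewrite !addr_ge0.
move=> a b ha hb; have [Da ga da _] := hr a ha.
split.
- by rewrite (le_trans (mx_entry_le _ _ _))// (le_trans ga)//; lra.
- apply: mx_norm_le => [|z k]; first by rewrite !addr_ge0.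
  rewrite mxE (le_trans (mx_entry_le _ _ _))// (le_trans (da k))//.
  by have := hKd k; lra.
- rewrite (le_trans (lip a b ha hb))// ler_wpM2r//; lra.
- have [c [hc cb ->]] := MVT_entry i j (fun u hu => dg u (Dr u hu)) ha hb.
  rewrite mxE -sumrB (le_trans (ler_norm_sum _ _ _))//.
  have nab := normr_ge0 (a - b).
  apply: (@le_trans _ _ (\sum_(l < n) `|a - b| * (n%:R * Kdd * `|a - b|))).
    apply: ler_sum => l _.
    rewrite [X in _ - X]mulrC -mulrBr normrM ler_pM//; first exact: mx_entry_le.
    have := le_trans (mx_entry_le _ 0 l) (lip c b hc hb); rewrite !mxE /= => /le_trans; apply.
    by rewrite ler_wpM2l.
  rewrite sumr_const card_ord -[leLHS]mulr_natl.
  have -> : n%:R * (`|a - b| * (n%:R * Kdd * `|a - b|)) = n%:R * (n%:R * Kdd) * `|a - b| ^+ 2 by ring.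
  by rewrite ler_wpM2r ?exprn_ge0//; lra.
Unshelve. all: by end_near. Qed.

Lemma c11_family p (y0 : 'cV[R]_p) (I : finType) (h : I -> 'cV[R]_p -> R) Dh :
  (forall i, c11 y0 (h i) (Dh i)) ->
  exists rho K : R, [/\ 0 < rho, 0 <= K & forall i, c11_on y0 rho K (h i) (Dh i)].
Proof.
move=> H; have /choice[rho /choice[K hK]] : forall i, exists rho : R, exists K : R,
    [/\ 0 < rho, 0 <= K & c11_on y0 rho K (h i) (Dh i)] by exact: H.
exists (\big[Num.min/1]_i rho i), (\sum_i K i); split.
- by apply: lt_bigmin => // i _; have [] := hK i.
- by apply: sumr_ge0 => i _; have [] := hK i.
move=> i; have [r0 K0 Hi] := hK i; apply: c11_on_mono Hi.
  exact: bigmin_le.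
by apply: (le_sum_term (F := K)) => j; have [] := hK j.
Qed.

Lemma c11_usubmx n m (u0 : 'cV[R]_n) (c0 : 'cV[R]_m) h Dh : c11 u0 h Dh ->
  c11 (col_mx u0 c0) (fun y => h (usubmx y)) (fun y => row_mx (Dh (usubmx y)) 0).
Proof.
move=> [rho [K [r0 K0 H]]]; exists rho, K; split=> // a b ha hb.
have sub (w : 'cV[R]_(n + m)) : `|usubmx w| <= `|w|.
  by apply: mx_norm_le => // i j; rewrite mxE mx_entry_le.
have rowle (w : 'rV[R]_n) : `|row_mx w (0 : 'rV[R]_m)| <= `|w|.
  apply: mx_norm_le => // i j; case: (split_ordP j) => k ->.
    by rewrite row_mxEl mx_entry_le.
  by rewrite row_mxEr mxE normr0.
have near (w : 'cV[R]_(n + m)) : `|w - col_mx u0 c0| <= rho -> `|usubmx w - u0| <= rho.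
  by move=> hw; rewrite -{1}(col_mxKu u0 c0) -linearB (le_trans (sub _)).
have [h1 h2 h3 h4] := H _ _ (near a ha) (near b hb).
have lab : `|usubmx a - usubmx b| <= `|a - b| by rewrite -linearB sub.
split=> //.
- exact: le_trans (rowle _) h2.
- rewrite opp_row_mx add_row_mx oppr0 addr0 (le_trans (rowle _))// (le_trans h3)//.
  by rewrite ler_wpM2l.
- rewrite -[X in row_mx _ _ *m X]vsubmxK mul_row_col mul0mx addr0 linearB/= (le_trans h4)//.
  by rewrite ler_wpM2l// !expr2 ler_pM.
Qed.

End smooth_c11.

(** * The weighted energy *)

Section energy.
Context {R : realType}.

Definition bil (p q : nat) (M : 'M[R]_(p, q)) (u : 'cV[R]_p) (v : 'cV[R]_q) : R :=
  (u^T *m M *m v) 0 0.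

Lemma ulsubmx_norm_le p1 p2 q1 q2 (M : 'M[R]_(p1 + p2, q1 + q2)) : `|ulsubmx M| <= `|M|.
Proof. by apply: mx_norm_le => // i j; rewrite !mxE; exact: mx_entry_le. Qed.

Lemma ursubmx_norm_le p1 p2 q1 q2 (M : 'M[R]_(p1 + p2, q1 + q2)) : `|ursubmx M| <= `|M|.
Proof. by apply: mx_norm_le => // i j; rewrite !mxE; exact: mx_entry_le. Qed.

Lemma dlsubmx_norm_le p1 p2 q1 q2 (M : 'M[R]_(p1 + p2, q1 + q2)) : `|dlsubmx M| <= `|M|.
Proof. by apply: mx_norm_le => // i j; rewrite !mxE; exact: mx_entry_le. Qed.

Lemma drsubmx_norm_le p1 p2 q1 q2 (M : 'M[R]_(p1 + p2, q1 + q2)) : `|drsubmx M| <= `|M|.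
Proof. by apply: mx_norm_le => // i j; rewrite !mxE; exact: mx_entry_le. Qed.

Lemma usubmx_norm_le p1 p2 q (M : 'M[R]_(p1 + p2, q)) : `|usubmx M| <= `|M|.
Proof. by apply: mx_norm_le => // i j; rewrite !mxE; exact: mx_entry_le. Qed.

Lemma dsubmx_norm_le p1 p2 q (M : 'M[R]_(p1 + p2, q)) : `|dsubmx M| <= `|M|.
Proof. by apply: mx_norm_le => // i j; rewrite !mxE; exact: mx_entry_le. Qed.

Lemma bil_le p q (M : 'M[R]_(p, q)) u v :
  `|bil M u v| <= p%:R * q%:R * `|M| * `|u| * `|v|.
Proof.
have trle : `|u^T| <= `|u| by apply: mx_norm_le => // i j; rewrite mxE mx_entry_le.
apply: le_trans (mx_entry_le _ _ _) _; apply: le_trans (mulmx_norm_le _ _) _.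
have -> : p%:R * q%:R * `|M| * `|u| * `|v| = q%:R * (p%:R * `|u| * `|M|) * `|v| by ring.
rewrite ler_wpM2r// ler_wpM2l// (le_trans (mulmx_norm_le _ _))//.
by rewrite ler_wpM2r// ler_wpM2l.
Qed.

Lemma bilDr p q (M : 'M[R]_(p, q)) u v v' : bil M u (v + v') = bil M u v + bil M u v'.
Proof. by rewrite /bil mulmxDr mxE. Qed.

Lemma bilDm p q (M N : 'M[R]_(p, q)) u v : bil (M + N) u v = bil M u v + bil N u v.
Proof. by rewrite /bil mulmxDr mulmxDl mxE. Qed.

Lemma bilNr p q (M : 'M[R]_(p, q)) u v : bil M u (- v) = - bil M u v.
Proof. by rewrite /bil mulmxN mxE. Qed.

Lemma bilZr p q (M : 'M[R]_(p, q)) a u v : bil M u (a *: v) = a * bil M u v.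
Proof. by rewrite /bil -scalemxAr mxE. Qed.

Lemma bil0l p q (M : 'M[R]_(p, q)) v : bil M 0 v = 0.
Proof. by rewrite /bil trmx0 !mul0mx mxE. Qed.

Lemma bil_mul p q s (M : 'M[R]_(p, q)) (N : 'M[R]_(q, s)) u v :
  bil M u (N *m v) = bil (M *m N) u v.
Proof. by rewrite /bil !mulmxA. Qed.

Lemma bil_sym p (M : 'M[R]_p) u v : M^T = M -> bil M u v = bil M v u.
Proof.
move=> sM; rewrite /bil -[in LHS](trmxK (_ *m v)) mxE.
by rewrite !trmx_mul trmxK sM mulmxA.
Qed.

Lemma bil1_ge p (v : 'cV[R]_p) : `|v| ^+ 2 <= bil 1%:M v v.
Proof.
rewrite (le_trans (ssq_ge v))// /bil mulmx1 mxE /ssq le_eqVlt; apply/orP; left; apply/eqP.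
by apply: eq_bigr => i _; rewrite big_ord1 mxE expr2.
Qed.

Lemma is_derive_bil p q (M : R -> 'M[R]_(p, q)) dM (u : R -> 'cV[R]_p) du
    (v : R -> 'cV[R]_q) dv (x : R) :
  is_derive x 1 M dM -> is_derive x 1 u du -> is_derive x 1 v dv ->
  is_derive x 1 (fun y => bil (M y) (u y) (v y))
    (bil dM (u x) (v x) + bil (M x) du (v x) + bil (M x) (u x) dv).
Proof.
move=> hM /is_derive_mxP hu hv.
have hu' : is_derive x 1 (fun y => (u y)^T) du^T.
  by apply/is_derive_mxP => i j; under eq_fun do rewrite mxE; rewrite mxE.
have /is_derive_mxP/(_ 0 0) h := is_derive_mulmx (is_derive_mulmx hu' hM) hv.
apply: is_derive_eq h _; rewrite /bil mxE mulmxDl mxE.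
by congr (_ + _); rewrite addrC.
Qed.

Lemma within_bil p q (A : set R) (M : R -> 'M[R]_(p, q)) (u : R -> 'cV[R]_p) v :
  {within A, continuous M} -> {within A, continuous u} -> {within A, continuous v} ->
  {within A, continuous (fun y => bil (M y) (u y) (v y))}.
Proof.
move=> cM cu cv; have cu' : {within A, continuous (fun y => (u y)^T)}.
  move=> z; apply/continuous_mxP => i j.
  rewrite (_ : (fun y => _) = fun y => u y j i); last by apply/funext => y; rewrite mxE.
  by have /continuous_mxP := cu z; exact.
have h := within_mulmx (within_mulmx cu' cM) cv.
by move=> z; have /continuous_mxP := h z; exact.
Qed.

Lemma bil_block r m (M : 'M[R]_(r + m)) (z : 'cV[R]_(r + m)) :
  bil M z z = bil (ulsubmx M) (usubmx z) (usubmx z) + bil (ursubmx M) (usubmx z) (dsubmx z)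
    + bil (dlsubmx M) (dsubmx z) (usubmx z) + bil (drsubmx M) (dsubmx z) (dsubmx z).
Proof.
suff gen (a : 'cV[R]_r) (b : 'cV[R]_m) A B C D :
    bil (block_mx A B C D) (col_mx a b) (col_mx a b) =
    bil A a a + bil B a b + bil C b a + bil D b b.
  by rewrite -gen submxK vsubmxK.
rewrite /bil tr_col_mx mul_row_block mul_row_col !mulmxDl.
rewrite [LHS]mxE [X in X + _]mxE [X in _ + X]mxE; ring.
Qed.

(** [a], [b], [p] stand for the norms of [V_I], [V_II], [V_II']. The order of choice is [k], [al],
    [gm], [eta]: [k] is small enough for its coupling [b * p] to be absorbed by the dissipation in
    [p]; [al] is small against [k], since the weight creates terms in [b ^+ 2] that only
    [- k * b ^+ 2] can absorb; [eta] comes last and pays for the variation of the coefficients. *)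
Lemma energy_constants (c Lm mu : R) : 0 < c -> 0 <= Lm -> 0 <= mu ->
  exists al k eta gm : R, [/\ 0 < al <= 1 / 2, 0 < k, 0 < eta <= 1, 0 < gm &
    forall a b p h : R, 0 <= a -> 0 <= b -> 0 <= p -> 0 <= h <= eta ->
      5 * Lm * h * (a + b + p) ^+ 2 - c / 2 * p ^+ 2 - al * c / 2 * a ^+ 2
      + 2 * al * Lm * (a * b + b ^+ 2 + b * p) - k * b ^+ 2 + 2 * k * mu * (b * p)
      <= - (gm * (a ^+ 2 + b ^+ 2))].
Proof.
move=> c0 L0 m0.
have d1 : 0 < 8 * (mu ^+ 2 + 1) by rewrite mulr_gt0// ltr_wpDl ?exprn_ge0.
pose k := c / (8 * (mu ^+ 2 + 1)); have k0 : 0 < k by rewrite divr_gt0.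
have kE : 8 * k * mu ^+ 2 + 8 * k = c by rewrite /k; field; apply: lt0r_neq0; move: d1; lra.
(* [al * T] is the total coefficient of [b ^+ 2] created by the weight, after Young's inequality on
   [a * b] and [b * p]. *)
pose T := 4 * Lm ^+ 2 / c + 3 * Lm.
have T0 : 0 <= T by rewrite addr_ge0 ?mulr_ge0// ?exprn_ge0// invr_ge0 ltW.
have [al [al0 al1 al2 al3]] : exists al : R,
    [/\ 0 < al, al <= 1 / 2, al * T <= k / 4 & al * Lm <= c / 8].
  pose s1 := k / (4 * (T + 1)); pose s2 := c / (8 * (Lm + 1)).
  have s10 : 0 < s1 by rewrite divr_gt0// mulr_gt0// ltr_wpDl.
  have s20 : 0 < s2 by rewrite divr_gt0// mulr_gt0// ltr_wpDl.
  have e1 : s1 * T <= k / 4.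
    have : s1 * (T + 1) = k / 4 by rewrite /s1; field; apply: lt0r_neq0; move: T0; lra.
    by move: s10; lra.
  have e2 : s2 * Lm <= c / 8.
    have : s2 * (Lm + 1) = c / 8 by rewrite /s2; field; apply: lt0r_neq0; move: L0; lra.
    by move: s20; lra.
  exists (Num.min (1 / 2) (Num.min s1 s2)); split.
  - by rewrite !lt_min s10 s20 divr_gt0.
  - by rewrite ge_min lexx.
  - by rewrite (le_trans _ e1)// ler_wpM2r// !ge_min lexx orbT.
  - by rewrite (le_trans _ e2)// ler_wpM2r// !ge_min lexx !orbT.
pose gm := Num.min (al * c / 8) (Num.min (k / 8) (c / 16)).
have gm0 : 0 < gm by rewrite !lt_min !divr_gt0// mulr_gt0.
have gm1 : gm <= al * c / 8 by rewrite ge_min lexx.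
have gm2 : gm <= k / 8 by rewrite !ge_min lexx orbT.
have gm3 : gm <= c / 16 by rewrite !ge_min lexx !orbT.
(* The square of a sum of three terms is at most three times the sum of squares, so [5 * Lm * h]
   becomes [15 * Lm * h], which must not exceed [gm]. *)
pose eta := Num.min 1 (gm / (15 * (Lm + 1))).
have L1 : 0 < Lm + 1 by rewrite ltr_wpDl.
have e0 : 0 < eta by rewrite lt_min ltr01 divr_gt0// mulr_gt0.
have eE : 15 * Lm * eta <= gm.
  have : 15 * (Lm + 1) * (gm / (15 * (Lm + 1))) = gm by field; exact: lt0r_neq0.
  have : eta <= gm / (15 * (Lm + 1)) by rewrite ge_min lexx orbT.
  have L15 : 0 <= 15 * Lm by rewrite mulr_ge0.
  move=> /(ler_wpM2l L15) h2 h3.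
  have h4 : 0 <= gm / (15 * (Lm + 1)) by rewrite divr_ge0// ?mulr_ge0// ltW.
  lra.
exists al, k, eta, gm; split=> //; first by rewrite al0.
  by rewrite e0 ge_min lexx.
move=> a b p h a0 b0 p0 /andP[h0 he].
have a2 : 0 <= a ^+ 2 by rewrite exprn_ge0.
have b2 : 0 <= b ^+ 2 by rewrite exprn_ge0.
have p2 : 0 <= p ^+ 2 by rewrite exprn_ge0.
have t1 : 5 * Lm * h * (a + b + p) ^+ 2 <= gm * (a ^+ 2 + b ^+ 2 + p ^+ 2).
  have s1 : (a + b + p) ^+ 2 <= 3 * (a ^+ 2 + b ^+ 2 + p ^+ 2).
    by have := sqr_ge0 (a - b); have := sqr_ge0 (b - p); have := sqr_ge0 (a - p); nra.
  have s2 : 5 * Lm * h <= gm / 3.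
    have : 15 * Lm * h <= 15 * Lm * eta by rewrite ler_wpM2l// mulr_ge0.
    by lra.
  have s3 : 0 <= 5 * Lm * h by rewrite !mulr_ge0.
  have s4 := ler_wpM2l s3 s1.
  have s5 : 5 * Lm * h * (3 * (a ^+ 2 + b ^+ 2 + p ^+ 2)) <= gm / 3 * (3 * (a ^+ 2 + b ^+ 2 + p ^+ 2)).
    by rewrite ler_wpM2r// mulr_ge0// !addr_ge0.
  lra.
have t2 : 2 * k * mu * (b * p) <= k / 2 * b ^+ 2 + 2 * k * mu ^+ 2 * p ^+ 2.
  have : 0 <= k / 2 * (b - 2 * mu * p) ^+ 2 by rewrite mulr_ge0 ?sqr_ge0// ltW// divr_gt0.
  by lra.
have t3 : 2 * al * Lm * (a * b) <= al * c / 4 * a ^+ 2 + 4 * al * Lm ^+ 2 / c * b ^+ 2.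
  have : 0 <= al * c / 4 * (a - 4 * Lm / c * b) ^+ 2.
    by rewrite mulr_ge0 ?sqr_ge0// ltW// divr_gt0// mulr_gt0.
  have -> : al * c / 4 * (a - 4 * Lm / c * b) ^+ 2 =
    al * c / 4 * a ^+ 2 + 4 * al * Lm ^+ 2 / c * b ^+ 2 - 2 * al * Lm * (a * b).
    by field; exact: lt0r_neq0.
  by lra.
have t4 : 2 * al * Lm * (b * p) <= al * Lm * b ^+ 2 + al * Lm * p ^+ 2.
  have : 0 <= al * Lm * (b - p) ^+ 2 by rewrite mulr_ge0 ?sqr_ge0// mulr_ge0// ltW.
  by lra.
have t5 : (4 * al * Lm ^+ 2 / c + 3 * al * Lm) * b ^+ 2 <= k / 4 * b ^+ 2.
  by rewrite ler_wpM2r//; move: al2; rewrite /T; lra.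
have t6 : al * Lm * p ^+ 2 <= c / 8 * p ^+ 2 by rewrite ler_wpM2r.
have t7 : 2 * k * mu ^+ 2 * p ^+ 2 <= c / 4 * p ^+ 2 by rewrite ler_wpM2r//; move: kE k0; lra.
have t8 : gm * p ^+ 2 <= c / 16 * p ^+ 2 by rewrite ler_wpM2r.
have t9 : 2 * gm * b ^+ 2 <= k / 4 * b ^+ 2 by rewrite ler_wpM2r//; lra.
have t10 : 2 * gm * a ^+ 2 <= al * c / 4 * a ^+ 2 by rewrite ler_wpM2r//; lra.
have t11 : 0 <= c * p ^+ 2 by rewrite mulr_ge0// ltW.
lra.
Qed.

Lemma sum_sq_ge1 (a b p : R) : 0 <= a -> 0 <= b -> 0 <= p ->
  (a + b) * (a + b) + p * (a + b) + b * p <= (a + b + p) ^+ 2.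
Proof. by move=> a0 b0 p0; have := mulr_ge0 a0 p0; have := sqr_ge0 p; lra. Qed.

Lemma sum_sq_ge2 (a b p : R) : 0 <= a -> 0 <= b -> 0 <= p ->
  b * (a + b) <= (a + b + p) ^+ 2.
Proof.
move=> a0 b0 p0; have := mulr_ge0 a0 p0; have := mulr_ge0 b0 p0; have := mulr_ge0 a0 b0.
by have := sqr_ge0 p; have := sqr_ge0 a; lra.
Qed.

(** The arithmetic of the energy estimate, with the bilinear forms replaced by opaque numbers. The
    flux derivative [t9] cancels, and the spectral term [t8] is carried along exactly, never
    estimated. *)
Lemma energy_arith (w al k c N K h a b p mu x gm Lm t1 t2 t3 t4 t4' t5 t5' t6 t7 t8 t9 o1 o2 : R) :
  0 <= al -> 0 <= k -> al <= 1 -> 0 <= c -> 0 <= N -> 0 <= K -> 0 <= h -> h <= 1 ->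
  0 <= x -> x <= 1 -> 1 / 2 <= w -> w <= 1 -> 0 <= a -> 0 <= b -> 0 <= p ->
  Lm = 2 * (N * K ^+ 2) + 2 * (N * K) + 2 * N ->
  `|t1| <= N * (h * K) * ((a + b) * (a + b)) -> `|t2| <= N * (K * h) * ((a + b) * (a + b)) ->
  `|t3| <= N * (K * h) * (p * (a + b)) -> `|t4| <= N * (h * K) * (b * p) ->
  `|t4'| <= N * (h * h) * (b * (a + b)) -> `|t5| <= N * (K * K) * (b * p) ->
  `|t5'| <= N * (K * h) * (b * (a + b)) -> `|o2| <= mu * (b * p) ->
  c * a ^+ 2 - 2 * (N * (K * K) * (a * b)) - N * (K * K) * (b * b) <= t6 ->
  c * p ^+ 2 <= t7 -> b ^+ 2 <= o1 ->
  5 * Lm * h * (a + b + p) ^+ 2 - c / 2 * p ^+ 2 - al * c / 2 * a ^+ 2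
      + 2 * al * Lm * (a * b + b ^+ 2 + b * p) - k * b ^+ 2 + 2 * k * mu * (b * p)
      <= - (gm * (a ^+ 2 + b ^+ 2)) ->
  - al * (1 / 2 * t6 - (t5 + t5'))
  + w * (1 / 2 * (t1 + t2 + (t9 - t8 - t2) + (t9 - t8 - t2)) - (t4 + t4' + (t7 + t3) + t9))
  - k * o1 + k * (1 - x) * (o2 + o2) <= - (w * t8) - gm * (a ^+ 2 + b ^+ 2).
Proof.
move=> al0 k0 al1 c0 N0 K0 h0 h1 x0 x1 w0 w1 a0 b0 p0 LmE T1 T2 T3 T4 T4' T5 T5' one2 T6
  coBp one1 H.
have Lm0 : 0 <= Lm by rewrite LmE !addr_ge0// ?mulr_ge0 ?exprn_ge0.
set s := a + b + p; have s2 : 0 <= s ^+ 2 by exact: sqr_ge0.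
have NKh : 0 <= N * K * h by rewrite !mulr_ge0.
have Nh : 0 <= N * h by rewrite mulr_ge0.
have f0 : b * (a + b) <= s ^+ 2 by exact: sum_sq_ge2.
have F0 : (a + b) * (a + b) + p * (a + b) + b * p <= s ^+ 2 by exact: sum_sq_ge1.
have q1 : 0 <= N * K ^+ 2 by rewrite mulr_ge0 ?exprn_ge0.
have q2 : 0 <= N * K by rewrite mulr_ge0.
have ab0 : 0 <= a * b by rewrite mulr_ge0.
have b2 : 0 <= b ^+ 2 by rewrite exprn_ge0.
have g1 := ler_wpM2l NKh f0; have g2 := ler_wpM2l NKh F0; have g3 := ler_wpM2l Nh f0.
have r1 := mulr_ge0 (mulr_ge0 q1 h0) s2; have r2 := mulr_ge0 (mulr_ge0 q2 h0) s2.
have r3 := mulr_ge0 (mulr_ge0 N0 h0) s2.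
pose bd := N * K * h * ((a + b) * (a + b) + p * (a + b) + b * p) + N * h * (b * (a + b)).
have E1' : bd <= Lm * h * s ^+ 2.
  by rewrite /bd LmE; clear -g2 g3 r1 r2 r3; lra.
have E1 : w * (1 / 2 * t1 - 1 / 2 * t2 - t3 - t4 - t4') <= bd.
  have Nhh : N * (h * h) * (b * (a + b)) <= N * h * (b * (a + b)).
    by rewrite ler_wpM2r ?mulr_ge0 ?addr_ge0// ler_wpM2l// ler_piMl.
  have e : `|1 / 2 * t1 - 1 / 2 * t2 - t3 - t4 - t4'| <= bd.
    clear -T1 T2 T3 T4 T4' Nhh; move: T1 T2 T3 T4 T4'.
    rewrite /bd !ler_norml => /andP[? ?] /andP[? ?] /andP[? ?] /andP[? ?] /andP[? ?].
    by apply/andP; split; lra.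
  have bd0 : 0 <= bd by exact: le_trans e.
  apply: le_trans (ler_norm _) _; rewrite normrM -[leRHS]mul1r ler_pM//.
  by rewrite ger0_norm//; clear -w0; lra.
have E2 : - (w * t7) <= - (c / 2 * p ^+ 2).
  have w00 : 0 <= w by clear -w0; lra.
  have f1 := ler_wpM2l w00 coBp.
  have f2 : 1 / 2 * (c * p ^+ 2) <= w * (c * p ^+ 2) by rewrite ler_wpM2r// mulr_ge0// exprn_ge0.
  clear -f1 f2; lra.
have E3 : al * t5' <= Lm * h * s ^+ 2.
  have f1 : al * t5' <= 1 * (N * (K * h) * (b * (a + b))).
    by apply: le_trans (ler_norm _) _; rewrite normrM ler_pM// ger0_norm.
  rewrite LmE; clear -f1 g1 r1 r2 r3; lra.
have E4 : al * t5 <= al * Lm * (b * p).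
  have f1 : t5 <= Lm * (b * p).
    apply: le_trans (ler_norm _) _; apply: le_trans T5 _; rewrite ler_wpM2r ?mulr_ge0// LmE.
    clear -q1 q2 N0; lra.
  by rewrite -mulrA ler_wpM2l.
have E5 : - al * (1 / 2 * t6) <= - (al * c / 2 * a ^+ 2) + al * Lm * (a * b + b ^+ 2).
  have f1 : N * (K * K) * (a * b) + 1 / 2 * (N * (K * K) * (b * b)) <= Lm * (a * b + b ^+ 2).
    have e1 := mulr_ge0 q1 ab0; have e2 := mulr_ge0 q1 b2.
    have e3 : 0 <= (N * K + N) * (a * b + b ^+ 2) by rewrite mulr_ge0 ?addr_ge0.
    rewrite LmE; clear -e1 e2 e3; lra.
  have f2 : - (1 / 2 * t6) <= - (c / 2 * a ^+ 2) + Lm * (a * b + b ^+ 2) by clear -f1 T6; lra.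
  have := ler_wpM2l al0 f2; clear; lra.
have E6 : k * (1 - x) * (o2 + o2) <= 2 * k * mu * (b * p).
  have f1 : (1 - x) * o2 <= 1 * (mu * (b * p)).
    apply: le_trans (ler_norm _) _; rewrite normrM ler_pM// ger0_norm ?subr_ge0// gerBl//.
  have := ler_wpM2l k0 f1; clear; lra.
have E7 : - (k * o1) <= - (k * b ^+ 2) by rewrite lerN2 ler_wpM2l.
have E8 : 0 <= al * Lm * (a * b + b ^+ 2 + b * p).
  by rewrite mulr_ge0 ?mulr_ge0// !addr_ge0// mulr_ge0.
have E9 : 0 <= Lm * h * s ^+ 2 by exact: mulr_ge0 (mulr_ge0 Lm0 h0) s2.
move: H; rewrite -/s.
have -> : w * (1 / 2 * (t1 + t2 + (t9 - t8 - t2) + (t9 - t8 - t2)) -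
    (t4 + t4' + (t7 + t3) + t9)) =
    w * (1 / 2 * t1 - 1 / 2 * t2 - t3 - t4 - t4') - w * t7 - w * t8 by field.
clear -E1 E1' E2 E3 E4 E5 E6 E7 E8 E9; lra.
Qed.

Section pointwise.
Variables (r m : nat) (c K : R).
Hypotheses (c0 : 0 < c) (K0 : 0 <= K).

(* The values at a point [x] of the coefficients of the linearised problem along a profile [W]:
   [eE] is [z |-> dB(W) z W'], and [edA], [edS1], [edS2] are derivatives along [W]. *)
Record energy_data := EnergyData {
  eA : 'M[R]_(r + m); eA0 : 'M[R]_(r + m);
  eS1 : 'M[R]_r; eS2 : 'M[R]_m; eB : 'M[R]_m; eE : 'M[R]_(m, r + m);
  edA : 'M[R]_(r + m); edS1 : 'M[R]_r; edS2 : 'M[R]_m }.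

Definition eS (d : energy_data) : 'M[R]_(r + m) := block_mx (eS1 d) 0 0 (eS2 d).
Definition edS (d : energy_data) : 'M[R]_(r + m) := block_mx (edS1 d) 0 0 (edS2 d).

(** [K] bounds the coefficients and [h] bounds everything that vanishes along a constant profile.
    [eA0] enters through symmetry and sign, which keeps the estimate uniform in the spectral
    parameter. *)
Record energy_hyp (h : R) (d : energy_data) : Prop := {
  eA_le : `|eA d| <= K; eS_le : `|eS d| <= K; eS2_le : `|eS2 d| <= K; eB_le : `|eB d| <= K;
  eE_le : `|eE d| <= h; edA_le : `|edA d| <= h; edS_le : `|edS d| <= h;
  edS2_le : `|edS2 d| <= h;
  eSA_sym : (eS d *m eA d)^T = eS d *m eA d;
  eSA0_sym : (eS d *m eA0 d)^T = eS d *m eA0 d;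
  eSA0_ge0 : forall v, 0 <= bil (eS d *m eA0 d) v v;
  eSA_coer : forall v, c * `|v| ^+ 2 <= bil (ulsubmx (eS d *m eA d)) v v;
  eSB_coer : forall v, c * `|v| ^+ 2 <= bil (eS2 d *m eB d) v v }.

Definition eG (d : energy_data) (z dz : 'cV[R]_(r + m)) : 'cV[R]_m :=
  eB d *m dsubmx dz + eE d *m z.

Definition eQ (al k x : R) (d : energy_data) (z : 'cV[R]_(r + m)) (G : 'cV[R]_m) : R :=
  (1 - al * x) * (1 / 2 * bil (eS d *m eA d) z z - bil (eS2 d) (dsubmx z) G)
  + k * (1 - x) * bil 1%:M (dsubmx z) (dsubmx z).

(** The formal derivative of [eQ] in [x], with [dG] for the derivative of the flux, so that no
    second derivative of [z] appears. *)
Definition edQ (al k x : R) (d : energy_data) (z dz : 'cV[R]_(r + m))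
    (G dG : 'cV[R]_m) : R :=
  - al * (1 / 2 * bil (eS d *m eA d) z z - bil (eS2 d) (dsubmx z) G)
  + (1 - al * x) * (1 / 2 * (bil (edS d *m eA d + eS d *m edA d) z z
       + bil (eS d *m eA d) dz z + bil (eS d *m eA d) z dz)
     - (bil (edS2 d) (dsubmx z) G + bil (eS2 d) (dsubmx dz) G + bil (eS2 d) (dsubmx z) dG))
  - k * bil 1%:M (dsubmx z) (dsubmx z)
  + k * (1 - x) * (bil 1%:M (dsubmx dz) (dsubmx z) + bil 1%:M (dsubmx z) (dsubmx dz)).

Let n := (r + m)%N.
Let Lm : R := 2 * (n%:R * n%:R * n%:R) * (K ^+ 2 + K + 1).

Let Lm0 : 0 <= Lm.
Proof. by rewrite !mulr_ge0// !addr_ge0// exprn_ge0. Qed.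

Let bil_mul_le (p q s : nat) (M : 'M[R]_(p, q)) (N : 'M[R]_(q, s)) u v (h1 h2 : R) :
  (p <= n)%N -> (q <= n)%N -> (s <= n)%N -> `|M| <= h1 -> `|N| <= h2 ->
  `|bil (M *m N) u v| <= n%:R * n%:R * n%:R * (h1 * h2) * `|u| * `|v|.
Proof.
move=> pn qn sn hM hN; have h10 := le_trans (normr_ge0 _) hM; have h20 := le_trans (normr_ge0 _) hN.
rewrite (le_trans (bil_le _ _ _))// ler_wpM2r// ler_wpM2r//.
have e1 : `|M *m N| <= n%:R * (h1 * h2).
  rewrite (le_trans (mulmx_norm_le _ _))// -mulrA ler_pM// ?mulr_ge0// ?ler_nat// ler_pM//.
apply: (@le_trans _ _ (n%:R * n%:R * (n%:R * (h1 * h2)))); last by rewrite !mulrA.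
by rewrite ler_pM// ?mulr_ge0// ler_pM// ler_nat.
Qed.

(** [l] is the spectral term of one real component. It stays on the right-hand side because it has a
    sign only after the contributions of the real and imaginary parts are added. *)
Lemma energy_pointwise : exists al k eta gm : R,
  [/\ 0 < al <= 1 / 2, 0 < k, 0 < eta <= 1, 0 < gm &
  forall (d : energy_data) (h x : R) z dz dG l, 0 <= h <= eta -> 0 <= x <= 1 ->
    energy_hyp h d ->
    l + edA d *m z + eA d *m dz = col_mx 0 dG ->
    edQ al k x d z dz (eG d z dz) dG <=
      - ((1 - al * x) * bil (eS d) z l) -
      gm * (`|usubmx z| ^+ 2 + `|dsubmx z| ^+ 2)].
Proof.
have [al [k [eta [gm [al01 k0 eta01 gm0 H]]]]] := energy_constants c0 Lm0 (ler0n R (m * m)).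
exists al, k, eta, gm; split=> // d h x z dz dG l hh x01 Hd El.
have /andP[h0 he] := hh; have /andP[x0 x1] := x01; have /andP[al0 al1] := al01.
have h1 : h <= 1 by case/andP: eta01 => _; exact: le_trans.
have w1 : 1 - al * x <= 1 by rewrite lerBlDr lerDl mulr_ge0// ltW.
have w0 : 1 / 2 <= 1 - al * x.
  have : al * x <= 1 / 2 * 1 by rewrite ler_pM// ltW.
  lra.
have al1' : al <= 1 by lra.
set a := `|usubmx z|; set b := `|dsubmx z|; set p := `|dsubmx dz|.
have a0 : 0 <= a by exact: normr_ge0.
have b0 : 0 <= b by exact: normr_ge0.
have p0 : 0 <= p by exact: normr_ge0.
have zab : `|z| <= a + b.
  apply: mx_norm_le => [|i j]; first by rewrite addr_ge0.
  rewrite -[z]vsubmxK; case: (split_ordP i) => e ->.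
    by rewrite col_mxEu (le_trans (mx_entry_le _ _ _))// lerDl.
  by rewrite col_mxEd (le_trans (mx_entry_le _ _ _))// lerDr.
have z0 := normr_ge0 z.
have zz : `|z| * `|z| <= (a + b) * (a + b) by rewrite ler_pM.
set N := n%:R * n%:R * n%:R : R; have N0 : 0 <= N by rewrite !mulr_ge0.
have NK2 : 0 <= N * K ^+ 2 by rewrite mulr_ge0// exprn_ge0.
have NK : 0 <= N * K by rewrite mulr_ge0.
have LmE : Lm = 2 * (N * K ^+ 2) + 2 * (N * K) + 2 * N by rewrite /Lm -/N; ring.
have mn : (m <= n)%N by rewrite leq_addl.
have rn : (r <= n)%N by rewrite leq_addr.
have [cA cS cS2 cB cE cdA cdS cdS2 symSA _ _ coA coB] := Hd.
have bab : b * `|z| <= b * (a + b) by rewrite ler_wpM2l.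
have pab : p * `|z| <= p * (a + b) by rewrite ler_wpM2l.
have T1 : `|bil (edS d *m eA d) z z| <= N * (h * K) * ((a + b) * (a + b)).
  by apply: le_trans (bil_mul_le _ _ _ _ _ cdS cA) _ => //; rewrite -mulrA ler_wpM2l// !mulr_ge0.
have T2 : `|bil (eS d *m edA d) z z| <= N * (K * h) * ((a + b) * (a + b)).
  by apply: le_trans (bil_mul_le _ _ _ _ _ cS cdA) _ => //; rewrite -mulrA ler_wpM2l// !mulr_ge0.
have T3 : `|bil (eS2 d *m eE d) (dsubmx dz) z| <= N * (K * h) * (p * (a + b)).
  by apply: le_trans (bil_mul_le _ _ _ _ _ cS2 cE) _ => //; rewrite -mulrA ler_wpM2l// !mulr_ge0.
have T4 : `|bil (edS2 d *m eB d) (dsubmx z) (dsubmx dz)| <= N * (h * K) * (b * p).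
  by apply: le_trans (bil_mul_le _ _ _ _ _ cdS2 cB) _ => //; rewrite -mulrA.
have T4' : `|bil (edS2 d *m eE d) (dsubmx z) z| <= N * (h * h) * (b * (a + b)).
  by apply: le_trans (bil_mul_le _ _ _ _ _ cdS2 cE) _ => //; rewrite -mulrA ler_wpM2l// !mulr_ge0.
have T5 : `|bil (eS2 d *m eB d) (dsubmx z) (dsubmx dz)| <= N * (K * K) * (b * p).
  by apply: le_trans (bil_mul_le _ _ _ _ _ cS2 cB) _ => //; rewrite -mulrA.
have T5' : `|bil (eS2 d *m eE d) (dsubmx z) z| <= N * (K * h) * (b * (a + b)).
  by apply: le_trans (bil_mul_le _ _ _ _ _ cS2 cE) _ => //; rewrite -mulrA ler_wpM2l// !mulr_ge0.
have SAn : `|eS d *m eA d| <= n%:R * (K * K).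
  by rewrite (le_trans (mulmx_norm_le _ _))// -mulrA ler_wpM2l// ler_pM.
have subn (p' q' : nat) (M : 'M[R]_(p', q')) u v : `|M| <= `|eS d *m eA d| ->
    (p' <= n)%N -> (q' <= n)%N -> `|bil M u v| <= N * (K * K) * (`|u| * `|v|).
  move=> hM pn qn; rewrite (le_trans (bil_le _ _ _))// -mulrA ler_wpM2r ?mulr_ge0//.
  rewrite /N -(mulrA (n%:R * n%:R)) ler_pM ?mulr_ge0//; first by rewrite ler_pM// ler_nat.
  exact: le_trans SAn.
have hur := ursubmx_norm_le (eS d *m eA d).
have hdl := dlsubmx_norm_le (eS d *m eA d).
have hdr := drsubmx_norm_le (eS d *m eA d).
have T6 : c * a ^+ 2 - 2 * (N * (K * K) * (a * b)) - N * (K * K) * (b * b) <= bil (eS d *m eA d) z z.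
  rewrite bil_block.
  have := coA (usubmx z); rewrite -/a.
  have := subn _ _ _ (usubmx z) (dsubmx z) hur rn mn.
  have := subn _ _ _ (dsubmx z) (usubmx z) hdl mn rn.
  have := subn _ _ _ (dsubmx z) (dsubmx z) hdr mn mn.
  rewrite -/a -/b !ler_norml => /andP[? _] /andP[? _] /andP[? _] ?; lra.
(* The equation enters here, paired with [S z]. As [S] is block diagonal, the right-hand side
   [(0, dG)] is seen through [eS2] alone, the same pairing as in the flux part of [eQ]. *)
have key : bil (eS d *m eA d) z dz =
    bil (eS2 d) (dsubmx z) dG - bil (eS d) z l - bil (eS d *m edA d) z z.
  have -> : bil (eS2 d) (dsubmx z) dG = bil (eS d) z (col_mx 0 dG).
    rewrite /eS /bil -[z in RHS]vsubmxK tr_col_mx mul_row_block mul_row_col.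
    by rewrite !mulmx0 !add0r.
  rewrite -El !bilDr !bil_mul; ring.
have sym2 : bil (eS d *m eA d) dz z = bil (eS d *m eA d) z dz by exact: bil_sym.
have sym1 : bil 1%:M (dsubmx dz) (dsubmx z) = bil 1%:M (dsubmx z) (dsubmx dz).
  by apply: bil_sym; rewrite trmx1.
have one1 := bil1_ge (dsubmx z); rewrite -/b in one1.
have one2 : `|bil 1%:M (dsubmx z) (dsubmx dz)| <= (m * m)%:R * (b * p).
  rewrite (le_trans (bil_le _ _ _))// natrM -mulrA ler_wpM2r ?mulr_ge0//.
  rewrite ler_piMr ?mulr_ge0//; apply: mx_norm_le => // i j.
  by rewrite mxE; case: (i == j); rewrite ?normr1 ?normr0.
have coBp := coB (dsubmx dz); rewrite -/p in coBp.
rewrite /edQ /eG sym1 sym2 key !bilDr !bil_mul !bilDm.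
set s := a + b + p; have s2 : 0 <= s ^+ 2 by exact: sqr_ge0.
have ab0 : 0 <= a * b by rewrite mulr_ge0.
have ap0 : 0 <= a * p by rewrite mulr_ge0.
have bp0 : 0 <= b * p by rewrite mulr_ge0.
have a2 : 0 <= a ^+ 2 by rewrite exprn_ge0.
have b2 : 0 <= b ^+ 2 by rewrite exprn_ge0.
have p2 : 0 <= p ^+ 2 by rewrite exprn_ge0.
set w := 1 - al * x in w0 w1 *.
move: T1 T2 T3 T4 T4' T5 T5' one2 T6 coBp one1.
set t1 := bil (edS d *m eA d) z z; set t2 := bil (eS d *m edA d) z z.
set t3 := bil (eS2 d *m eE d) (dsubmx dz) z.
set t4 := bil (edS2 d *m eB d) _ _; set t4' := bil (edS2 d *m eE d) _ _.
set t5 := bil (eS2 d *m eB d) (dsubmx z) (dsubmx dz); set t5' := bil (eS2 d *m eE d) (dsubmx z) z.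
set o2 := bil 1%:M (dsubmx z) (dsubmx dz); set o1 := bil 1%:M (dsubmx z) (dsubmx z).
set t6 := bil (eS d *m eA d) z z; set t7 := bil (eS2 d *m eB d) (dsubmx dz) (dsubmx dz).
set t8 := bil (eS d) z l; set t9 := bil (eS2 d) (dsubmx z) dG.
move=> T1 T2 T3 T4 T4' T5 T5' one2 T6 coBp one1.
have al0' := ltW al0; have k0' := ltW k0; have c0' := ltW c0.
by apply: (@energy_arith w al k c N K h a b p (m * m)%:R x gm Lm) => //; exact: H.
Qed.

End pointwise.

End energy.

(** * Integrating the energy estimate over the interval *)

Section rigidity.
Context {R : realType}.

Lemma sum4_le0 (a b c d : R) : 0 <= a -> 0 <= b -> 0 <= c -> 0 <= d ->
  a + b + (c + d) <= 0 -> [/\ a <= 0, b <= 0, c <= 0 & d <= 0].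
Proof. by move=> *; split; lra. Qed.

Lemma is_derive_add (V : normedModType R) (f g : R -> V) (x : R) df dg :
  is_derive x 1 f df -> is_derive x 1 g dg -> is_derive x 1 (fun y => f y + g y) (df + dg).
Proof. exact: is_deriveD. Qed.

Lemma is_derive_sub (V : normedModType R) (f g : R -> V) (x : R) df dg :
  is_derive x 1 f df -> is_derive x 1 g dg -> is_derive x 1 (fun y => f y - g y) (df - dg).
Proof. exact: is_deriveB. Qed.

Lemma is_derive_block_mx r m (P : R -> 'M[R]_r) dP (Q : R -> 'M[R]_m) dQ (x : R) :
  is_derive x 1 P dP -> is_derive x 1 Q dQ ->
  is_derive x 1 (fun y => block_mx (P y) 0 0 (Q y) : 'M[R]_(r + m)) (block_mx dP 0 0 dQ).
Proof.
move=> /is_derive_mxP hP /is_derive_mxP hQ; apply/is_derive_mxP => i j.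
case: (split_ordP i) => k ->; case: (split_ordP j) => l ->.
- under eq_fun do rewrite block_mxEul; rewrite block_mxEul; exact: hP.
- under eq_fun do rewrite block_mxEur mxE; rewrite block_mxEur mxE; exact: is_derive_cst.
- under eq_fun do rewrite block_mxEdl mxE; rewrite block_mxEdl mxE; exact: is_derive_cst.
- under eq_fun do rewrite block_mxEdr; rewrite block_mxEdr; exact: hQ.
Qed.

Lemma within_mxP (p q : nat) (A : set R) (f : R -> 'M[R]_(p, q)) :
  {within A, continuous f} <-> forall i j, {within A, continuous (fun y => f y i j)}.
Proof.
split=> [cf i j z|cf z]; first by have /continuous_mxP := cf z; exact.
by apply/continuous_mxP => i j; exact: cf.
Qed.

Lemma within_block_mx r m (A : set R) (P : R -> 'M[R]_r) (Q : R -> 'M[R]_m) :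
  {within A, continuous P} -> {within A, continuous Q} ->
  {within A, continuous (fun y => block_mx (P y) 0 0 (Q y) : 'M[R]_(r + m))}.
Proof.
move=> /within_mxP cP /within_mxP cQ; apply/within_mxP => i j.
case: (split_ordP i) => k ->; case: (split_ordP j) => l ->.
- by rewrite (_ : (fun y => _) = fun y => P y k l)//; apply/funext => y; rewrite block_mxEul.
- rewrite (_ : (fun y => _) = fun y => 0); last by apply/funext => y; rewrite block_mxEur mxE.
  exact: within_cst.
- rewrite (_ : (fun y => _) = fun y => 0); last by apply/funext => y; rewrite block_mxEdl mxE.
  exact: within_cst.
- by rewrite (_ : (fun y => _) = fun y => Q y k l)//; apply/funext => y; rewrite block_mxEdr.
Qed.

Lemma is_derive_aff (a b x : R) : is_derive x 1 (fun y : R => a + b * y) b.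
Proof.
apply: is_derive_eq (is_deriveD (is_derive_cst a x 1) (is_deriveZ b (is_derive_id x 1))) _.
by rewrite add0r /GRing.scale/= mulr1.
Qed.

Lemma is_derive_dsubmx r m q (W : R -> 'M[R]_(r + m, q)) dW (x : R) :
  is_derive x 1 W dW -> is_derive x 1 (fun y => dsubmx (W y)) (dsubmx dW).
Proof.
move=> /is_derive_mxP h; apply/is_derive_mxP => i j.
by under eq_fun do rewrite mxE; rewrite mxE; exact: h.
Qed.

Lemma within_dsubmx r m q (A : set R) (W : R -> 'M[R]_(r + m, q)) :
  {within A, continuous W} -> {within A, continuous (fun y => dsubmx (W y))}.
Proof.
move=> /within_mxP h; apply/within_mxP => i j.
rewrite (_ : (fun y => _) = fun y => W y (rshift r i) j)//.
by apply/funext => y; rewrite mxE.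
Qed.

Variables (r m : nat) (c K : R).
Hypotheses (c0 : 0 < c) (K0 : 0 <= K).

(* [X] and [Y] are the real and imaginary parts of an eigenfunction for [la + i lb]. *)
Lemma energy_rigidity : exists2 eta : R, 0 < eta &
  forall d : R -> energy_data r m,
  (forall x : R, 0 <= x <= 1 -> energy_hyp c K eta (d x)) ->
  (forall x : R, 0 < x < 1 -> is_derive x 1 (fun y => eA (d y)) (edA (d x))) ->
  (forall x : R, 0 < x < 1 -> is_derive x 1 (fun y => eS1 (d y)) (edS1 (d x))) ->
  (forall x : R, 0 < x < 1 -> is_derive x 1 (fun y => eS2 (d y)) (edS2 (d x))) ->
  {within `[0, 1], continuous (fun x => eA (d x))} ->
  {within `[0, 1], continuous (fun x => eS1 (d x))} ->
  {within `[0, 1], continuous (fun x => eS2 (d x))} ->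
  forall (la lb : R) (X Y dX dY : R -> 'cV[R]_(r + m)) (GX GY dGX dGY : R -> 'cV[R]_m),
  0 <= la ->
  {within `[0, 1], continuous X} -> {within `[0, 1], continuous Y} ->
  {within `[0, 1], continuous GX} -> {within `[0, 1], continuous GY} ->
  (forall x : R, 0 < x < 1 -> [/\ is_derive x 1 X (dX x), is_derive x 1 GX (dGX x),
     GX x = eG (d x) (X x) (dX x) &
     la *: (eA0 (d x) *m X x) - lb *: (eA0 (d x) *m Y x) + edA (d x) *m X x
       + eA (d x) *m dX x = col_mx 0 (dGX x)]) ->
  (forall x : R, 0 < x < 1 -> [/\ is_derive x 1 Y (dY x), is_derive x 1 GY (dGY x),
     GY x = eG (d x) (Y x) (dY x) &
     la *: (eA0 (d x) *m Y x) + lb *: (eA0 (d x) *m X x) + edA (d x) *m Y x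
       + eA (d x) *m dY x = col_mx 0 (dGY x)]) ->
  X 0 = 0 -> Y 0 = 0 -> dsubmx (X 1) = 0 -> dsubmx (Y 1) = 0 ->
  forall x : R, 0 <= x <= 1 -> X x = 0 /\ Y x = 0.
Proof.
have [al [k [eta [gm [al01 k0 eta01 gm0 H]]]]] := energy_pointwise r m c0 K0.
have /andP[eta0 _] := eta01; have /andP[al0 al1] := al01.
exists eta => // d hd dA dS1 dS2 cA cS1 cS2 la lb X Y dX dY GX GY dGX dGY la0 cX cY cGX cGY
  hX hY X0 Y0 X1 Y1.
have one_in : 0 <= (1 : R) <= 1 by rewrite ler01 lexx.
have zero_in : 0 <= (0 : R) <= 1 by rewrite ler01 lexx.
pose Q x := eQ al k x (d x) (X x) (GX x) + eQ al k x (d x) (Y x) (GY x).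
pose dQ x := edQ al k x (d x) (X x) (dX x) (GX x) (dGX x) +
             edQ al k x (d x) (Y x) (dY x) (GY x) (dGY x).
have dQ1 (Z dZ : R -> 'cV[R]_(r + m)) (G dG : R -> 'cV[R]_m) (x : R) : 0 < x < 1 ->
    is_derive x 1 Z (dZ x) -> is_derive x 1 G (dG x) ->
    is_derive x 1 (fun y => eQ al k y (d y) (Z y) (G y))
      (edQ al k x (d x) (Z x) (dZ x) (G x) (dG x)).
  move=> x01 hZ hG.
  have hS := is_derive_block_mx (dS1 x x01) (dS2 x x01).
  have hSA := is_derive_mulmx hS (dA x x01).
  have hZ2 := is_derive_dsubmx hZ.
  have b1 := is_derive_bil hSA hZ hZ.
  have b2 := is_derive_bil (dS2 x x01) hZ2 hG.
  have b3 := is_derive_bil (is_derive_cst (1%:M : 'M[R]_m) x 1) hZ2 hZ2.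
  have w1 : is_derive x 1 (fun y : R => 1 - al * y) (- al).
    by rewrite (_ : (fun y => _) = fun y => 1 + (- al) * y);
      [exact: is_derive_aff|apply/funext => y; ring].
  have w2 : is_derive x 1 (fun y : R => k * (1 - y)) (- k).
    by rewrite (_ : (fun y => _) = fun y => k + (- k) * y);
      [exact: is_derive_aff|apply/funext => y; ring].
  have h1 := is_derive_mul (is_derive_cst (1 / 2 : R) x 1) b1.
  have h2 := is_derive_sub h1 b2.
  have h3 := is_derive_add (is_derive_mul w1 h2) (is_derive_mul w2 b3).
  apply: is_derive_eq h3 _.
  have z0 : bil (0 : 'M[R]_m) (dsubmx (Z x)) (dsubmx (Z x)) = 0.
    by rewrite /bil mulmx0 mul0mx mxE.
  rewrite /edQ /eS /edS z0 /=; ring.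
have caff (a b : R) : {within `[0, 1], continuous (fun y : R => a + b * y)}.
  apply: derivable_within_continuous => x _; have := is_derive_aff a b x.
  by case.
have cQ1 (Z : R -> 'cV[R]_(r + m)) (G : R -> 'cV[R]_m) :
    {within `[0, 1], continuous Z} -> {within `[0, 1], continuous G} ->
    {within `[0, 1], continuous (fun y => eQ al k y (d y) (Z y) (G y))}.
  move=> cZ cG; rewrite /eQ /eS.
  have cS := within_block_mx cS1 cS2.
  have cSA := within_mulmx cS cA.
  have cZ2 := within_dsubmx cZ.
  apply: within_add.
    apply: within_mul.
      rewrite (_ : (fun y => _) = fun y => 1 + (- al) * y); first exact: caff.
      by apply/funext => y; ring.
    apply: within_sub; last exact: within_bil.
    by apply: within_mul; [exact: within_cst|exact: within_bil].
  apply: within_mul.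
    rewrite (_ : (fun y => _) = fun y => k + (- k) * y); first exact: caff.
    by apply/funext => y; ring.
  by apply: within_bil => //; exact: within_cst.
have cQ : {within `[0, 1], continuous Q} by apply: within_add; exact: cQ1.
have hQ (x : R) : 0 < x < 1 -> is_derive x 1 Q (dQ x).
  move=> x01; have [x1 x2 _ _] := hX x x01; have [y1 y2 _ _] := hY x x01.
  by apply: is_deriveD; exact: dQ1.
pose N x := `|usubmx (X x)| ^+ 2 + `|dsubmx (X x)| ^+ 2 +
  (`|usubmx (Y x)| ^+ 2 + `|dsubmx (Y x)| ^+ 2).
have N0 x : 0 <= N x by rewrite !addr_ge0 ?exprn_ge0.
have dQ_le (x : R) : 0 < x < 1 -> dQ x <= - (gm * N x).
  move=> x01; have /andP[x0 x1] := x01; have x01' : 0 <= x <= 1 by rewrite !ltW.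
  have ee : 0 <= eta <= eta by rewrite lexx ltW.
  have [_ _ gX eX] := hX x x01; have [_ _ gY eY] := hY x x01.
  have HX := H (d x) eta x _ _ _ _ ee x01' (hd x x01') eX.
  have HY := H (d x) eta x _ _ _ _ ee x01' (hd x x01') eY.
  rewrite -gX in HX; rewrite -gY in HY.
  set lX := la *: _ - _ in HX; set lY := la *: _ + _ in HY.
  (* The two [lb] terms are opposite by symmetry of [S A0]; what remains is [la] times nonnegative
     forms. *)
  have pos : 0 <= bil (eS (d x)) (X x) lX + bil (eS (d x)) (Y x) lY.
    rewrite /lX /lY !bilDr bilNr !bilZr !bil_mul.
    rewrite (bil_sym (Y x) (X x) (eSA0_sym (hd x x01'))).
    have p1 := eSA0_ge0 (hd x x01') (X x); have p2 := eSA0_ge0 (hd x x01') (Y x).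
    have p3 := mulr_ge0 la0 p1; have p4 := mulr_ge0 la0 p2.
    by lra.
  have w0 : 0 <= 1 - al * x.
    rewrite subr_ge0 -[leRHS]mul1r ler_pM// ?ltW//; lra.
  have := mulr_ge0 w0 pos.
  rewrite /dQ /N; lra.
have Q0 : Q 0 = 0.
  by rewrite /Q /eQ X0 Y0 !linear0 !bil0l; ring.
have Q1E (Z : R -> 'cV[R]_(r + m)) (G : R -> 'cV[R]_m) : dsubmx (Z 1) = 0 ->
    (1 - al) * (1 / 2 * (c * `|usubmx (Z 1)| ^+ 2)) <= eQ al k 1 (d 1) (Z 1) (G 1).
  move=> Z1; rewrite /eQ Z1 !bil0l mulr1 mulr0 addr0 subr0.
  rewrite ler_wpM2l; [|lra|]; rewrite ?ler_wpM2l//.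
  rewrite bil_block Z1 !bil0l !addr0 {2}/bil mulmx0 mxE addr0.
  exact: eSA_coer (hd 1 one_in) _.
have Q1X := Q1E X GX X1; have Q1Y := Q1E Y GY Y1.
have a0 : 0 < 1 - al by lra.
have pz (z : 'cV[R]_r) : 0 <= (1 - al) * (1 / 2 * (c * `|z| ^+ 2)).
  by rewrite !mulr_ge0 ?exprn_ge0// ltW.
have mono (x y : R) : 0 <= x -> x <= y -> y <= 1 -> Q y <= Q x.
  move=> x0 xy y1; apply: (@derive_le0_le R Q dQ x y xy).
  - by move=> z /andP[xz zy]; apply: hQ; rewrite (le_lt_trans x0 xz) (lt_le_trans zy y1).
  - move=> z /andP[xz zy]; apply: le_trans (dQ_le z _) _.
      by rewrite (le_lt_trans x0 xz) (lt_le_trans zy y1).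
    by rewrite oppr_le0 mulr_ge0// ltW.
  - apply: continuous_subspaceW cQ => z /=; rewrite !in_itv/= => /andP[xz zy].
    by rewrite (le_trans x0 xz) (le_trans zy y1).
(* [Q] is nonincreasing, zero at 0 and nonnegative at 1, hence zero throughout. *)
have Q1 : Q 1 = 0.
  apply/eqP; rewrite eq_le -{1}Q0 mono//= addr_ge0//.
    exact: le_trans (pz _) Q1X.
  exact: le_trans (pz _) Q1Y.
have Qz (x : R) : 0 <= x <= 1 -> Q x = 0.
  move=> /andP[x0 x1]; apply/eqP; rewrite eq_le -{1}Q0 mono//=.
  by rewrite -{1}Q1 mono.
have norm0 (z : 'cV[R]_(r + m)) : `|usubmx z| ^+ 2 <= 0 -> `|dsubmx z| ^+ 2 <= 0 -> z = 0.
  move=> h1 h2; rewrite -[z]vsubmxK.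
  have -> : usubmx z = 0 by apply/eqP; rewrite -normr_eq0 -sqrf_eq0 eq_le h1 sqr_ge0.
  have -> : dsubmx z = 0 by apply/eqP; rewrite -normr_eq0 -sqrf_eq0 eq_le h2 sqr_ge0.
  exact: col_mx0.
move=> x /andP[]; rewrite le_eqVlt => /predU1P[<- _|x0]; first by [].
rewrite le_eqVlt => /predU1P[->|x1].
  have e0 : 0 < (1 - al) * (1 / 2 * c) by rewrite !mulr_gt0.
  have Qs : eQ al k 1 (d 1) (X 1) (GX 1) + eQ al k 1 (d 1) (Y 1) (GY 1) = 0 by exact: Q1.
  have s1 := sqr_ge0 `|usubmx (X 1)|; have s2 := sqr_ge0 `|usubmx (Y 1)|.
  split; apply: norm0; rewrite ?X1 ?Y1 ?normr0 ?expr0n//.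
    by rewrite -(pmulr_rle0 _ e0); have := pz (usubmx (Y 1)); lra.
  by rewrite -(pmulr_rle0 _ e0); have := pz (usubmx (X 1)); lra.
have x01 : 0 < x < 1 by rewrite x0.
(* [Q] vanishes near every interior point, so the decay estimate reads [0 <= - (gm * N x)]. *)
have dQ0 : dQ x = 0.
  have [_ <-] := hQ x x01.
  rewrite (@near_eq_derive _ _ _ Q (cst 0)) ?derive_cst//.
  have : \forall y \near x, y \in `]0, 1[ by apply: near_in_itvoo; rewrite in_itv.
  by apply: filterS => y; rewrite in_itv/= => /andP[y0 y1]; apply: Qz; rewrite !ltW.
have := dQ_le x x01; rewrite dQ0 oppr_ge0 pmulr_rle0// /N => hN.
have := sqr_ge0 `|usubmx (X x)|; have := sqr_ge0 `|usubmx (Y x)|.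
have := sqr_ge0 `|dsubmx (X x)|; have := sqr_ge0 `|dsubmx (Y x)|.
by move=> d1 d2 u1 u2; have [? ? ? ?] := sum4_le0 u2 d2 u1 d1 hN; split; exact: norm0.
Qed.

End rigidity.

(** * Definite matrices and the hyperbolic speeds *)

Section quadratic_forms.
Context {R : realType}.

Lemma bilZZ k (M : 'M[R]_k) a v : bil M (a *: v) (a *: v) = a ^+ 2 * bil M v v.
Proof. by rewrite bilZr /bil linearZ -!scalemxAl mxE expr2 mulrA. Qed.

Lemma continuous_bil k (M : 'M[R]_k) (u : 'rV[R]_k) :
  {for u, continuous (fun w : 'rV[R]_k => bil M w^T w^T)}.
Proof.
have ct : {for u, continuous (fun w : 'rV[R]_k => w^T)}.
  apply/continuous_mxP => i j; rewrite (_ : (fun y => _) = fun y : 'rV[R]_k => y j i : R).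
    exact: coord_continuous.
  by apply/funext => y; rewrite mxE.
have ci : {for u, continuous (fun w : 'rV[R]_k => w^T^T)}.
  by rewrite (_ : (fun y => _) = id)//; apply/funext => y; rewrite trmxK.
have cM : {for u, continuous (fun _ : 'rV[R]_k => M)} by exact: cst_continuous.
by have /continuous_mxP := continuous_mulmx (continuous_mulmx ci cM) ct; exact.
Qed.

(** The quotient of the two forms is invariant under scaling, so its minimum over the compact unit
    sphere is global. *)
Lemma rayleigh_min k (H S : 'M[R]_k) : posdefmx S -> (exists v : 'cV[R]_k, v != 0) ->
  exists mu u, [/\ u != 0, bil H u u = mu * bil S u u &
    forall v, mu * bil S v v <= bil H v v].
Proof.
move=> pS [v0 v00].
pose A := [set u : 'rV[R]_k | `|u| = 1].
have trn (v : 'cV[R]_k) : `|v^T| = `|v|.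
  apply/eqP; rewrite eq_le; apply/andP; split; apply: mx_norm_le => // i j.
    by rewrite mxE mx_entry_le.
  by rewrite -[v]trmxK mxE trmxK mx_entry_le.
have unitv (v : 'cV[R]_k) : v != 0 -> A (`|v|^-1 *: v^T).
  by move=> v_neq0; rewrite /A/= normrZ trn normfV normr_id mulVf// normr_eq0.
have pos (v : 'cV[R]_k) : v != 0 -> 0 < bil S v v by exact: pS.
have Anz u : A u -> u^T != 0.
  rewrite /A/= => u1; apply/eqP => /(congr1 trmx); rewrite trmxK trmx0 => u0.
  by move: u1; rewrite u0 normr0 => /eqP; rewrite eq_sym oner_eq0.
pose q u := bil H u^T u^T / bil S u^T u^T.
have cA : compact A.
  apply: bounded_closed_compact.
    by exists 1; split=> // x x1 u /= ->; exact: ltW.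
  have -> : A = (fun u => `|u|) @^-1` [set 1] by [].
  by apply: closed_comp => [u _|]; [exact: norm_continuous|exact: closed_eq].
have cq : {within A, continuous q}.
  apply/subspace_continuousP => u Au; apply: cvg_within_filter.
  have hV : {for u, continuous (fun w : 'rV[R]_k => (bil S w^T w^T)^-1)}.
    by apply: continuousV; [rewrite gt_eqF// pos// Anz|exact: continuous_bil].
  exact: cont_mul (@continuous_bil _ H u) hV.
have A0 : A !=set0 by exists (`|v0|^-1 *: v0^T); exact: unitv.
have [u uA umin] := EVT_min_rV A0 cA cq.
rewrite inE in uA.
exists (q u), u^T; have un0 := Anz u uA; split=> //.
  by rewrite /q divfK// gt_eqF// pos.
move=> v; have [->|vn0] := eqVneq v 0; first by rewrite !bil0l mulr0.
have := umin _ (mem_set (unitv v vn0)).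
rewrite {2}/q linearZ /= trmxK !bilZZ.
rewrite -mulf_div divff ?mul1r ?ler_pdivlMr ?pos// expf_neq0// invr_neq0// normr_eq0//.
Qed.

(** The constant is the Rayleigh minimum against the identity. The zero space has no unit vector and
    is treated apart, where any constant works. *)
Lemma posdef_coercive k (M : 'M[R]_k) : posdefmx M ->
  exists2 c : R, 0 < c & forall v, c * `|v| ^+ 2 <= bil M v v.
Proof.
move=> pM; have [[v vn0]|nv] := pselect (exists v : 'cV[R]_k, v != 0); last first.
  exists 1 => // v; have -> : v = 0 by apply: contra_notP nv => /eqP ?; exists v.
  by rewrite normr0 expr0n mulr0 bil0l.
have p1 : posdefmx (1%:M : 'M[R]_k).
  move=> w wn0; apply: lt_le_trans (bil1_ge w); by rewrite exprn_gt0// normr_gt0.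
have [mu [u [un0 Hu hmin]]] := rayleigh_min M p1 (ex_intro _ v vn0).
have mu0 : 0 < mu.
  have := pM u un0; rewrite -/(bil M u u) Hu pmulr_lgt0//; exact: p1.
exists mu => // w; apply: le_trans (hmin w); rewrite ler_wpM2l ?(ltW mu0)//.
exact: bil1_ge.
Qed.

Lemma coercive_near k (M N : 'M[R]_k) (c : R) :
  (forall v, c * `|v| ^+ 2 <= bil M v v) -> (k * k)%:R * `|N - M| <= c / 2 ->
  forall v, c / 2 * `|v| ^+ 2 <= bil N v v.
Proof.
move=> hM hN v; have -> : N = M + (N - M) by rewrite addrC subrK.
rewrite bilDm; have := hM v; have := bil_le (N - M) v v.
rewrite -natrM -mulrA -expr2 ler_norml => /andP[h _].
have := ler_wpM2r (exprn_ge0 2 (normr_ge0 v)) hN.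
lra.
Qed.

Lemma psd_ker k (P : 'M[R]_k) (u : 'cV[R]_k) : P^T = P ->
  (forall v, 0 <= bil P v v) -> bil P u u = 0 -> P *m u = 0.
Proof.
move=> sP psd Pu; pose h := P *m u.
have hE : bil P h u = bil 1%:M h h by rewrite /bil mulmx1 -mulmxA.
have h0 := bil1_ge h; have q0 := psd h.
have hn : `|h| ^+ 2 <= 0.
  rewrite leNgt; apply/negP => hpos.
  pose s := bil 1%:M h h; pose t := bil P h h.
  have s0 : 0 < s by exact: lt_le_trans h0.
  (* the quadratic polynomial [a |-> bil P (u - a h) (u - a h)] is negative
     for small positive [a] *)
  pose a := s / (t + 1).
  have t1 : 0 < t + 1 by rewrite ltr_wpDl.
  have a0 : 0 < a by rewrite divr_gt0.
  have := psd (u + (- a) *: h).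
  rewrite bilDr bilZr !(bil_sym (u + _)) // !bilDr !bilZr (bil_sym u h)// Pu hE -/s -/t.
  have at1 : a * (t + 1) = s by rewrite divfK// gt_eqF.
  by move=> hh; have := mulr_gt0 a0 a0; have := mulr_gt0 a0 s0; nra.
apply/eqP; rewrite -normr_eq0 -sqrf_eq0 eq_le hn sqr_ge0//.
Qed.

Lemma mxCM p q s (M : 'M[R]_(p, q)) (N : 'M[R]_(q, s)) : mxC (M *m N) = mxC M *m mxC N.
Proof. exact: map_mxM. Qed.

(* The minimum of the quotient of [v^T S A v] by [v^T S v] is an eigenvalue of [A]. *)
Lemma symmetrized_speeds_posdef k (A S : 'M[R]_k) : S^T = S -> posdefmx S ->
  (S *m A)^T = S *m A ->
  (forall z : R[i], eigenvalue (mxC A) z -> complex.Im z = 0 /\ 0 < complex.Re z) ->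
  posdefmx (S *m A).
Proof.
move=> sS pS sSA hA v vn0.
have [mu [u [un0 Hu hmin]]] := rayleigh_min (S *m A) pS (ex_intro _ v vn0).
suff mu0 : 0 < mu by apply: lt_le_trans (hmin v); rewrite mulr_gt0//; exact: pS.
have bilB w : bil (S *m A - mu *: S) w w = bil (S *m A) w w - mu * bil S w w.
  by rewrite bilDm /bil mulmxN mulNmx -scalemxAr -scalemxAl !mxE.
(* The form of [S *m A - mu *: S] is nonnegative and vanishes at the minimiser [u], so [u] lies in
   its kernel. *)
have K0 : (S *m A - mu *: S) *m u = 0.
  apply: psd_ker.
  - by rewrite linearB linearZ /= sSA sS.
  - by move=> w; rewrite bilB subr_ge0.
  - by rewrite bilB Hu subrr.
have SAu : S *m A *m u = mu *: (S *m u).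
  by apply/eqP; rewrite -subr_eq0 scalemxAl -mulmxBl K0.
(* [eigenvalue] speaks of row vectors: symmetry of [S] and of [S *m A] turns the relation for [u]
   into a left eigenvector of [A]. *)
pose w := (S *m u)^T.
have wA : w *m A = mu *: w.
  by rewrite /w [in LHS]trmx_mul sS -mulmxA -{1}sSA -trmx_mul SAu linearZ.
have wn0 : w != 0.
  apply/eqP => w0; have := pS u un0.
  by rewrite -mulmxA -(trmxK (S *m u)) -/w w0 trmx0 mulmx0 mxE ltxx.
have /hA[_] : eigenvalue (mxC A) (real_complex R mu).
  apply/eigenvalueP; exists (mxC w).
    by rewrite -mxCM wA /mxC map_mxZ.
  by rewrite map_mx_eq0.
by [].
Qed.

End quadratic_forms.

(** * One-sided derivatives on the unit interval *)

Section derive01_theory.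
Context {R : realType}.

Lemma is_deriveP (W : normedModType R) (g : R -> W) (x : R) (l : W) :
  is_derive x 1 g l <-> forall e : R, 0 < e -> exists2 d : R, 0 < d &
    forall y, y != x -> `|y - x| < d -> `|l - (y - x)^-1 *: (g y - g x)| < e.
Proof.
have qE (h : R) : ((g \o shift x) (h *: (1 : R)) - g x) = g (h + x) - g x.
  by rewrite /= /GRing.scale/= mulr1.
split.
  move=> [dr dl] e e0.
  have /cvgrPdist_lt/(_ e e0) : (fun h : R => h^-1 *: ((g \o shift x) (h *: (1 : R)) - g x)) @ 0^' --> l.
    by rewrite -dl; exact: dr.
  rewrite near_withinE => -[d /= d0 hd]; exists d => // y yx yd.
  have := hd (y - x); rewrite qE subrK; apply.
    by rewrite /ball_/= sub0r normrN.
  by rewrite subr_eq0.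
move=> H.
have cv : (fun h : R => h^-1 *: ((g \o shift x) (h *: (1 : R)) - g x)) @ 0^' --> l.
  apply/cvgrPdist_lt => e e0; have [d d0 hd] := H e e0.
  rewrite near_withinE; exists d => //= h; rewrite /ball_/= sub0r normrN => hd0 hn0.
  have := hd (h + x); rewrite addrK => /(_ _ hd0); rewrite /shift /= /GRing.scale/= mulr1; apply.
  by rewrite -subr_eq0 addrK.
apply: DeriveDef; first by apply/cvg_ex; exists l.
exact: cvg_lim cv.
Qed.

Definition is_derive01 (W : normedModType R) (g : R -> W) (x : R) (l : W) : Prop :=
  quot01 g x @ within (@I01 R) x^' --> l.

Lemma is_derive01P (W : normedModType R) (g : R -> W) (x : R) (l : W) :
  is_derive01 g x l <-> forall e : R, 0 < e -> exists2 d : R, 0 < d &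
    forall y, 0 <= y <= 1 -> y != x -> `|y - x| < d ->
      `|l - (y - x)^-1 *: (g y - g x)| < e.
Proof.
split.
  move=> /cvgrPdist_lt h e e0; have := h e e0.
  rewrite !near_withinE => -[d /= d0 hd]; exists d => // y y01 yx yd.
  by apply: (hd y) => //; rewrite /ball_/= distrC.
move=> H; apply/cvgrPdist_lt => e e0; have [d d0 hd] := H e e0.
rewrite !near_withinE; exists d => //= y; rewrite /ball_/= distrC => yd yx.
by rewrite /I01 /= in_itv/= => y01; exact: hd.
Qed.

Lemma I01P (x : R) : I01 x <-> 0 <= x <= 1.
Proof. by rewrite /I01 /= in_itv/=. Qed.

Lemma near_point01 (x d : R) : 0 <= x <= 1 -> 0 < d ->
  exists y : R, [/\ 0 <= y <= 1, y != x & `|y - x| < d].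
Proof.
move=> /andP[x0 x1] d0; pose t := Num.min (d / 2) (1 / 2).
have t0 : 0 < t by rewrite lt_min !divr_gt0.
have td : t < d by rewrite (@le_lt_trans _ _ (d / 2)) ?ge_min ?lexx//; lra.
have t1 : t <= 1 / 2 by rewrite ge_min lexx orbT.
have [xh|xh] := leP x (1 / 2).
  exists (x + t); rewrite addrC addrK gtr0_norm// -subr_eq0 addrK gt_eqF//.
  by split=> //; apply/andP; split; lra.
exists (x - t); rewrite addrC addrK normrN gtr0_norm// -subr_eq0 addrK oppr_eq0 gt_eqF//.
by split=> //; apply/andP; split; lra.
Qed.

(** Properness makes limits along the relative filter unique, which is what identifies [derive01]
    with a computed limit, at the end points too. *)
Lemma I01_proper (x : R) : 0 <= x <= 1 -> ProperFilter (within (@I01 R) x^').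
Proof.
move=> x01; apply: Build_ProperFilter_ex => P.
rewrite /within/= => -[d /= d0 hd]; have [y [y01 yx yd]] := near_point01 x01 d0.
by exists y; apply: (hd y) => //; rewrite /ball_/= distrC.
Qed.

Lemma is_derive01_unique (W : normedModType R) (g : R -> W) (x : R) (l : W) :
  0 <= x <= 1 -> is_derive01 g x l -> derivable01 g x /\ derive01 g x = l.
Proof.
move=> x01 h; have := I01_proper x01 => PF; split; first by apply/cvg_ex; exists l.
exact: cvg_lim h.
Qed.

Lemma derivable01P (W : normedModType R) (g : R -> W) (x : R) :
  derivable01 g x -> is_derive01 g x (derive01 g x).
Proof. by []. Qed.

Lemma is_derive_derive01 (W : normedModType R) (g : R -> W) (x : R) (l : W) :
  is_derive x 1 g l -> is_derive01 g x l.
Proof.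
move=> /is_deriveP h; apply/is_derive01P => e e0; have [d d0 hd] := h e e0.
by exists d => // y _; exact: hd.
Qed.

Lemma is_derive01_derive (W : normedModType R) (g : R -> W) (x : R) (l : W) :
  0 < x < 1 -> is_derive01 g x l -> is_derive x 1 g l.
Proof.
move=> /andP[x0 x1] /is_derive01P h; apply/is_deriveP => e e0; have [d d0 hd] := h e e0.
exists (Num.min d (Num.min x (1 - x))); first by rewrite !lt_min d0 x0 subr_gt0.
move=> y yx; rewrite !lt_min => /and3P[yd yx0 yx1]; apply: hd => //.
by move: yx0 yx1; rewrite !ltr_norml => /andP[? ?] /andP[? ?]; apply/andP; split; lra.
Qed.

Lemma is_derive01_ext (W : normedModType R) (g h : R -> W) (x : R) (l : W) :
  0 <= x <= 1 -> (forall y, 0 <= y <= 1 -> g y = h y) ->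
  is_derive01 g x l -> is_derive01 h x l.
Proof.
move=> x01 gh /is_derive01P H; apply/is_derive01P => e e0; have [d d0 hd] := H e e0.
by exists d => // y y01; rewrite -!gh//; exact: hd.
Qed.

Lemma is_derive01_continuous (W : normedModType R) (g : R -> W) (x : R) (l : W) :
  is_derive01 g x l -> forall e : R, 0 < e ->
  exists2 d : R, 0 < d & forall y, 0 <= y <= 1 -> `|y - x| < d -> `|g y - g x| < e.
Proof.
move=> /is_derive01P/(_ 1 ltr01)[d d0 hd] e e0.
have l1 : 0 < `|l| + 1 by rewrite ltr_wpDl.
exists (Num.min d (e / (`|l| + 1))); first by rewrite lt_min d0 divr_gt0.
move=> y y01; rewrite lt_min => /andP[yd ye].
have [->|yx] := eqVneq y x; first by rewrite subrr normr0.
have := hd y y01 yx yd; set q := _ *: _ => hq.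
have -> : g y - g x = (y - x) *: q by rewrite /q scalerA divff ?scale1r// subr_eq0.
have qle : `|q| <= `|l| + 1.
  rewrite -[q](subrK l) (le_trans (ler_normD _ _))// addrC lerD2l distrC ltW//.
rewrite normrZ; apply: (@le_lt_trans _ _ (`|y - x| * (`|l| + 1))); first by rewrite ler_wpM2l.
by rewrite -ltr_pdivlMr.
Qed.

Lemma C1_01_within (W : normedModType R) (g : R -> W) : C1_01 g ->
  {within `[0, 1], continuous g}.
Proof.
move=> [dg _]; apply/within_continuousP => x Ax e e0.
have [d d0 hd] := is_derive01_continuous (derivable01P (dg x Ax)) e0.
by exists d => // y; rewrite /= in_itv/=; exact: hd.
Qed.

Lemma is_derive01_mxP p q (g : R -> 'M[R]_(p, q)) (x : R) (l : 'M[R]_(p, q)) :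
  is_derive01 g x l <-> forall i j, is_derive01 (fun y => g y i j) x (l i j).
Proof.
have E y i j : (l - (y - x)^-1 *: (g y - g x)) i j =
    l i j - (y - x)^-1 *: (g y i j - g x i j) by rewrite !mxE.
split=> [/is_derive01P h i j|h].
  apply/is_derive01P => e e0; have [d d0 hd] := h e e0; exists d => // y y01 yx yd.
  by rewrite -E (le_lt_trans (mx_entry_le _ _ _))// hd.
apply/is_derive01P => e e0.
have /choice[d hd] : forall ij : 'I_p * 'I_q, exists d : R, 0 < d /\
    forall y, 0 <= y <= 1 -> y != x -> `|y - x| < d ->
      `|l ij.1 ij.2 - (y - x)^-1 *: (g y ij.1 ij.2 - g x ij.1 ij.2)| < e / 2.
  move=> ij; have [|d d0 hd] := (is_derive01P _ _ _).1 (h ij.1 ij.2) (e / 2).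
    by rewrite divr_gt0.
  by exists d.
exists (\big[Num.min/1]_ij d ij); first by apply: lt_bigmin => // ij _; have [] := hd ij.
move=> y y01 yx yd; apply: (@le_lt_trans _ _ (e / 2)); last by lra.
apply: mx_norm_le => [|i j]; first by rewrite divr_ge0// ltW.
rewrite E ltW//; have [_ H] := hd (i, j); apply: H => //.
by rewrite (lt_le_trans yd)//; exact: bigmin_le.
Qed.

Lemma is_derive01_sub_mx p1 p2 q (g : R -> 'M[R]_(p1 + p2, q)) (x : R) l :
  is_derive01 g x l -> is_derive01 (fun y => dsubmx (g y)) x (dsubmx l) /\
    is_derive01 (fun y => usubmx (g y)) x (usubmx l).
Proof.
move=> /is_derive01_mxP h; split; apply/is_derive01_mxP => i j.
  rewrite mxE (_ : (fun y => _) = fun y => g y (rshift p1 i) j); first exact: h.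
  by apply/funext => y; rewrite mxE.
rewrite mxE (_ : (fun y => _) = fun y => g y (lshift p2 i) j); first exact: h.
by apply/funext => y; rewrite mxE.
Qed.

Lemma within_comp (U V : normedModType R) (A : set R) (W : R -> U) (g : U -> V) :
  {within A, continuous W} -> (forall x, A x -> {for W x, continuous g}) ->
  {within A, continuous (fun x => g (W x))}.
Proof.
move=> /subspace_continuousP cW cg; apply/subspace_continuousP => x Ax.
exact: (cvg_comp _ _ (cW x Ax) (cg x Ax)).
Qed.

Lemma is_derive_comp_mx n p q (g : 'cV[R]_n -> 'M[R]_(p, q)) (W : R -> 'cV[R]_n) (x : R) dW :
  is_derive x 1 W dW -> differentiable g (W x) ->
  is_derive x 1 (fun y => g (W y)) ('D_dW g (W x)).
Proof.
move=> [dr <-] dg; have dW' : differentiable W x by apply/derivable1_diffP.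
have dc : differentiable (g \o W) x by exact: differentiable_comp.
have h : derivable (g \o W) x 1 by apply/diff_derivable.
apply: DeriveDef; first exact: h.
have E1 : 'D_1 W x = 'd W x 1 by exact: deriveE.
have E2 : 'D_1 (g \o W) x = 'd (g \o W) x 1 by exact: deriveE.
have E3 : 'D_('d W x 1) g (W x) = 'd g (W x) ('d W x 1) by exact: deriveE.
by rewrite E1 E3 -[LHS]/('D_1 (g \o W) x) E2 diff_comp.
Qed.

(** Gronwall with zero rate and zero defect. *)
Lemma is_derive_const (p q : nat) (f : R -> 'M[R]_(p, q)) :
  {within `[0, 1], continuous f} -> (forall x : R, 0 < x < 1 -> is_derive x 1 f 0) ->
  forall x : R, 0 <= x <= 1 -> f x = f 0.
Proof.
move=> cf df x x01; apply/eqP; rewrite -subr_eq0 -normr_le0.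
rewrite -[leRHS](mul0r (expR ((p * q)%:R * (2 * 0 + 1)))).
apply: (@gronwall_mx R p q (fun x => f x - f 0) (fun=> 0) 0 0) => //.
- by apply: within_sub => //; exact: within_cst.
- by rewrite subrr.
- by move=> z z01; have := is_derive_sub (df z z01) (is_derive_cst (f 0) z 1); rewrite subr0.
- by move=> z z01; rewrite normr0 mul0r addr0.
Qed.

End derive01_theory.

(** * Rigidity of the linearised problem *)

Section near_constants.
Context {R : realType}.

Lemma near_le_cont (V W : normedModType R) (F : V -> W) (u0 : V) :
  {for u0, continuous F} -> \forall u \near u0, `|F u| <= `|F u0| + 1.
Proof.
move=> cF; move/cvgrPdist_le : cF => /(_ 1 ltr01); apply: filterS => u h.
by rewrite -[F u](subrK (F u0)) (le_trans (ler_normD _ _))// addrC lerD2l distrC.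
Qed.

Lemma C1_bounds n p q (D : set 'cV[R]_n) (g : 'cV[R]_n -> 'M[R]_(p, q)) (u0 : 'cV[R]_n) :
  open D -> D u0 -> Ck_on 1 D g ->
  exists2 K : R, 0 <= K & \forall u \near u0, `|g u| <= K /\
    forall h : 'cV[R]_n, `|'D_h g u| <= K * `|h|.
Proof.
move=> oD Du0 [dg cg].
pose K0 := \sum_k (`|'D_(delta_mx k 0) g u0| + 1).
have K00 : 0 <= K0 by apply: sumr_ge0 => k _; rewrite addr_ge0.
exists (`|g u0| + 1 + K0); first by rewrite !addr_ge0.
near=> u.
have Du : D u by near: u; exact: open_nbhs_nbhs.
split.
  apply: (@le_trans _ _ (`|g u0| + 1)); last by rewrite lerDl.
  by near: u; apply: (@near_le_cont _ _ g); apply: differentiable_continuous; exact: dg.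
have hk : forall k, `|'D_(delta_mx k 0) g u| <= `|'D_(delta_mx k 0) g u0| + 1.
  by near: u; apply: filter_forall => k; apply: (@near_le_cont _ _ ('D_(delta_mx k 0) g)); exact: cg.
move=> h; rewrite (derive_partials _ (dg u Du)).
rewrite (le_trans (ler_norm_sum _ _ _))//.
apply: (@le_trans _ _ (K0 * `|h|)); last by rewrite ler_wpM2r// lerDr addr_ge0.
rewrite /K0 mulr_suml; apply: ler_sum => k _; rewrite normrZ mulrC ler_pM//.
exact: mx_entry_le.
Unshelve. all: by end_near. Qed.

(** The Jacobian by directional derivatives. These are the functions that [Ck_on] differentiates
    again, so [Jf] can be differentiated along a curve, with derivative [dJf]; it agrees with [Jac]
    where [f] is differentiable. *)
Definition Jf (r m : nat) (f : 'cV[R]_(r + m) -> 'cV[R]_(r + m)) (u : 'cV[R]_(r + m)) :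
    'M[R]_(r + m) := \matrix_(i, j) ('D_(delta_mx j 0) f u) i 0.

Definition dJf (r m : nat) (f : 'cV[R]_(r + m) -> 'cV[R]_(r + m)) (h u : 'cV[R]_(r + m)) :
    'M[R]_(r + m) := \matrix_(i, j) ('D_h ('D_(delta_mx j 0) f) u) i 0.

Lemma Jac_Jf r m (f : 'cV[R]_(r + m) -> 'cV[R]_(r + m)) u : differentiable f u ->
  Jac f u = Jf f u.
Proof. by move=> df; apply/matrixP => i j; rewrite !mxE deriveE. Qed.

Lemma Jf_mul r m (f : 'cV[R]_(r + m) -> 'cV[R]_(r + m)) u h : differentiable f u ->
  Jf f u *m h = 'D_h f u.
Proof.
move=> df; rewrite derive_partials//; apply/matrixP => i j; rewrite ord1 summxE mxE.
by apply: eq_bigr => k _; rewrite !mxE mulrC.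
Qed.

Lemma is_derive_Jf r m (f : 'cV[R]_(r + m) -> 'cV[R]_(r + m)) (W : R -> 'cV[R]_(r + m)) (x : R) dW :
  is_derive x 1 W dW -> (forall v, differentiable ('D_v f) (W x)) ->
  is_derive x 1 (fun y => Jf f (W y)) (dJf f dW (W x)).
Proof.
move=> hW df; apply/is_derive_mxP => i j.
under eq_fun do rewrite mxE; rewrite mxE.
by have /is_derive_mxP := is_derive_comp_mx hW (df (delta_mx j 0)); exact.
Qed.

Lemma continuous_Jf r m (f : 'cV[R]_(r + m) -> 'cV[R]_(r + m)) u :
  (forall v, {for u, continuous ('D_v f)}) -> {for u, continuous (Jf f)}.
Proof.
move=> cf; apply/continuous_mxP => i j.
rewrite (_ : (fun y => _) = fun y => ('D_(delta_mx j 0) f y) i 0).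
  by have /continuous_mxP := cf (delta_mx j 0); exact.
by apply/funext => y; rewrite mxE.
Qed.

Lemma dJf_bounds r m (D : set 'cV[R]_(r + m)) (f : 'cV[R]_(r + m) -> 'cV[R]_(r + m)) u0 :
  open D -> D u0 -> Ck_on 2 D f ->
  exists2 K : R, 0 <= K & \forall u \near u0, `|Jf f u| <= K /\
    forall h : 'cV[R]_(r + m), `|dJf f h u| <= K * `|h|.
Proof.
move=> oD Du0 [df cf].
have /choice[K hK] : forall j, exists K : R, 0 <= K /\ \forall u \near u0,
    `|'D_(delta_mx j 0) f u| <= K /\
    forall h : 'cV[R]_(r + m), `|'D_h ('D_(delta_mx j 0) f) u| <= K * `|h|.
  by move=> j; have [K K0 hK] := C1_bounds oD Du0 (cf (delta_mx j 0)); exists K.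
have K0 j : 0 <= K j by have [] := hK j.
have leK j : K j <= \sum_k K k by exact: le_sum_term.
exists (\sum_k K k); first exact: sumr_ge0.
near=> u.
have hu : forall j, `|'D_(delta_mx j 0) f u| <= K j /\
    forall h : 'cV[R]_(r + m), `|'D_h ('D_(delta_mx j 0) f) u| <= K j * `|h|.
  by near: u; apply: filter_forall => j; have [] := hK j.
split=> [|h]; (apply: mx_norm_le => [|i j]; [by rewrite ?mulr_ge0// sumr_ge0|rewrite mxE]).
  by have [h1 _] := hu j; rewrite (le_trans (mx_entry_le _ _ _))// (le_trans h1).
have [_ h1] := hu j; rewrite (le_trans (mx_entry_le _ _ _))// (le_trans (h1 h))//.
by rewrite ler_wpM2r.
Unshelve. all: by end_near. Qed.

End near_constants.

(** * The structural assumptions supply the data of the energy estimate *)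

Section core.
Context {R : realType}.

Lemma symmetricmx_tr k (M : 'M[R]_k) : M \is symmetricmx -> M^T = M.
Proof.
move=> /is_hermitianmxP; rewrite expr0 scale1r => h; rewrite [RHS]h.
by apply/matrixP => i j; rewrite !mxE.
Qed.

Lemma block_diag_norm_le r m (M : 'M[R]_(r + m)) :
  `|block_mx (ulsubmx M) 0 0 (drsubmx M) : 'M[R]_(r + m)| <= `|M|.
Proof.
apply: mx_norm_le => // i j.
case: (split_ordP i) => k ->; case: (split_ordP j) => l ->.
- by rewrite block_mxEul !mxE mx_entry_le.
- by rewrite block_mxEur mxE normr0.
- by rewrite block_mxEdl mxE normr0.
- by rewrite block_mxEdr !mxE mx_entry_le.
Qed.

Lemma ulsubmx_block_mul r m (P : 'M[R]_r) (Q : 'M[R]_m) (M : 'M[R]_(r + m)) :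
  ulsubmx (block_mx P 0 0 Q *m M) = P *m ulsubmx M.
Proof. by rewrite -{1}(submxK M) mulmx_block block_mxKul mul0mx addr0. Qed.

Lemma ulsubmxB r m (M N : 'M[R]_(r + m)) : ulsubmx (M - N) = ulsubmx M - ulsubmx N.
Proof. by apply/matrixP => i j; rewrite !mxE. Qed.

Variables (r m : nat) (D : set 'cV[R]_(r + m)) (f0 f : 'cV[R]_(r + m) -> 'cV[R]_(r + m)).
Variables (B22 : 'cV[R]_(r + m) -> 'M[R]_m).
Hypothesis oD : open D.
Hypothesis sys : structural_assumptions D f0 f B22.

Lemma B22_dr u : B22 u = drsubmx (Bmx B22 u).
Proof. by rewrite /Bmx block_mxKdr. Qed.

(** The matrix, built column by column, of the lower block of [z |-> dB(u) z w]; it serves as the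
    coefficient [eE]. *)
Let Eop (u w : 'cV[R]_(r + m)) : 'M[R]_(m, r + m) :=
  \matrix_(i, j) (dsubmx ('D_(delta_mx j 0) (Bmx B22) u *m w)) i 0.

Let Eop_mul u w z : D u -> Eop u w *m z = dsubmx ('D_z (Bmx B22) u *m w).
Proof.
move=> Du; have dB : differentiable (Bmx B22) u by have [h _] := B_smooth sys 1; exact: h.
rewrite (derive_partials _ dB) mulmx_suml linear_sum /=; apply/matrixP => i j.
rewrite ord1 summxE mxE; apply: eq_bigr => k _.
by rewrite [Eop u w i k]mxE -scalemxAl linearZ /= [RHS]mxE mulrC.
Qed.

(** The coercivity constants are found at [U0] and halved to survive in a neighbourhood. Every
    derivative along [W] is linear in [dW], so a small [rho] puts them all below [eta]. [rho]
    precedes the profile and the spectral parameter in the quantifiers. *)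
Lemma core_rigidity (U0 : 'cV[R]_(r + m)) : D U0 -> exists2 rho : R, 0 < rho &
  (forall u, `|u - U0| <= rho -> D u) /\
  forall (W dW : R -> 'cV[R]_(r + m)),
  (forall x : R, 0 <= x <= 1 -> `|W x - U0| <= rho /\ `|dW x| <= rho) ->
  {within `[0, 1], continuous W} ->
  (forall x : R, 0 < x < 1 -> is_derive x 1 W (dW x)) ->
  forall (la lb : R) (X Y dX dY : R -> 'cV[R]_(r + m)) (GX GY dGX dGY : R -> 'cV[R]_m),
  0 <= la ->
  {within `[0, 1], continuous X} -> {within `[0, 1], continuous Y} ->
  {within `[0, 1], continuous GX} -> {within `[0, 1], continuous GY} ->
  (forall x : R, 0 < x < 1 -> [/\ is_derive x 1 X (dX x), is_derive x 1 GX (dGX x),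
     GX x = B22 (W x) *m dsubmx (dX x) + dsubmx ('D_(X x) (Bmx B22) (W x) *m dW x) &
     la *: (Jac f0 (W x) *m X x) - lb *: (Jac f0 (W x) *m Y x) +
       dJf f (dW x) (W x) *m X x + Jf f (W x) *m dX x = col_mx 0 (dGX x)]) ->
  (forall x : R, 0 < x < 1 -> [/\ is_derive x 1 Y (dY x), is_derive x 1 GY (dGY x),
     GY x = B22 (W x) *m dsubmx (dY x) + dsubmx ('D_(Y x) (Bmx B22) (W x) *m dW x) &
     la *: (Jac f0 (W x) *m Y x) + lb *: (Jac f0 (W x) *m X x) +
       dJf f (dW x) (W x) *m Y x + Jf f (W x) *m dY x = col_mx 0 (dGY x)]) ->
  X 0 = 0 -> Y 0 = 0 -> dsubmx (X 1) = 0 -> dsubmx (Y 1) = 0 ->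
  forall x : R, 0 <= x <= 1 -> X x = 0 /\ Y x = 0.
Proof.
move=> DU0; have [S1 [S2 [smS hS]]] := symmetrizable sys.
set S := fun u => block_mx (S1 u) 0 0 (S2 u) in smS hS.
have df u : D u -> differentiable f u by have [h _] := f_smooth sys 1; exact: h.
have ddf u v : D u -> differentiable ('D_v f) u.
  by have [_ h] := f_smooth sys 2; have [h' _] := h v; exact: h'.
have symS u : D u -> [/\ (S u *m Jac f0 u)^T = S u *m Jac f0 u,
    (S u *m Jf f u)^T = S u *m Jf f u &
    forall v, 0 <= bil (S u *m Jac f0 u) v v].
  move=> Du; have [s1 s2 s3 _] := hS u Du; rewrite -Jac_Jf; last exact: df.
  split; [exact: (symmetricmx_tr s1)|exact: (symmetricmx_tr s3)|move=> v].
  by have [->|vn0] := eqVneq v 0; [rewrite bil0l|exact/ltW/s2].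
(* The first block row of [A0] is that of the identity, so [S1] is the upper left block of [S A0],
   hence symmetric positive definite. Positivity of the speeds then makes [S1 A11] positive
   definite. *)
have [c1 c10 hc1] : exists2 c : R, 0 < c &
    forall v, c * `|v| ^+ 2 <= bil (ulsubmx (S U0 *m Jf f U0)) v v.
  apply: posdef_coercive; have [s1 s2 s3 _] := hS U0 DU0.
  have [t1 t2 t3] := symS U0 DU0.
  have ulA0 : ulsubmx (S U0 *m Jac f0 U0) = S1 U0.
    by rewrite ulsubmx_block_mul (A0_block sys DU0) block_mxKul mulmx1.
  rewrite ulsubmx_block_mul -Jac_Jf; last exact: df.
  apply: symmetrized_speeds_posdef.
  - by rewrite -ulA0 trmx_ulsub t1.
  - move=> v vn0; rewrite -ulA0 -/(bil _ v v).
    have : col_mx v 0 != 0 :> 'cV[R]_(r + m).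
      by apply: contraNneq vn0 => /(congr1 usubmx); rewrite col_mxKu linear0 => ->.
    move=> /s2; rewrite -/(bil _ (col_mx v 0) (col_mx v 0)) bil_block col_mxKu col_mxKd.
    by rewrite !bil0l !addr0 {2}/bil mulmx0 mxE addr0.
  - rewrite -(ulsubmx_block_mul (S1 U0) (S2 U0)) trmx_ulsub.
    by rewrite Jac_Jf ?t2//; exact: df.
  - exact: A11_speeds sys _ DU0.
have [c2 c20 hc2] : exists2 c : R, 0 < c &
    forall v, c * `|v| ^+ 2 <= bil (S2 U0 *m B22 U0) v v.
  apply: posdef_coercive => v vn0; have [_ _ _ s4] := hS U0 DU0.
  have := s4 v vn0; rewrite -!/(bil _ v v) bilDm.
  have -> : bil (S2 U0 *m B22 U0)^T v v = bil (S2 U0 *m B22 U0) v v.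
    by rewrite /bil -[in LHS](trmxK (_ *m v)) mxE !trmx_mul !trmxK mulmxA.
  lra.
have C1S : Ck_on 1 D S by exact: smS.
have C1B : Ck_on 1 D (Bmx B22) by exact: (B_smooth sys 1).
have [KS KS0 nS] := C1_bounds oD DU0 C1S.
have [KB KB0 nB] := C1_bounds oD DU0 C1B.
have [KA KA0 nA] := dJf_bounds oD DU0 (f_smooth sys 2).
have cS : {for U0, continuous S} by apply: differentiable_continuous; have [h _] := C1S; exact: h.
have cB : {for U0, continuous (Bmx B22)} by apply: differentiable_continuous; have [h _] := C1B; exact: h.
have cJ : {for U0, continuous (Jf f)}.
  by apply: continuous_Jf => v; apply: differentiable_continuous; exact: ddf.
have nc1 : \forall u \near U0, forall v,
    c1 / 2 * `|v| ^+ 2 <= bil (ulsubmx (S u *m Jf f u)) v v.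
  have /cvgrPdist_le := continuous_mulmx cS cJ.
  have e0 : 0 < c1 / 2 / ((r * r)%:R + 1) by rewrite !divr_gt0// ltr_wpDl.
  move=> /(_ _ e0); apply: filterS => u hu; apply: (coercive_near hc1).
  have := ulsubmx_norm_le (S u *m Jf f u - S U0 *m Jf f U0); rewrite ulsubmxB => hul.
  move: hu; rewrite distrC ler_pdivlMr ?ltr_wpDl// => hu.
  apply: le_trans hu; rewrite mulrC ler_pM// lerDl//.
have nc2 : \forall u \near U0, forall v, c2 / 2 * `|v| ^+ 2 <= bil (S2 u *m B22 u) v v.
  have cd (g : 'cV[R]_(r + m) -> 'M[R]_(r + m)) : {for U0, continuous g} ->
      {for U0, continuous (fun u => drsubmx (g u))}.
    move=> /continuous_mxP cg; apply/continuous_mxP => i j.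
    rewrite (_ : (fun y => _) = fun y => g y (rshift r i) (rshift r j)); first exact: cg.
    by apply/funext => y; rewrite !mxE.
  have /cvgrPdist_le := continuous_mulmx (cd _ cS) (cd _ cB).
  have e0 : 0 < c2 / 2 / ((m * m)%:R + 1) by rewrite !divr_gt0// ltr_wpDl.
  move=> /(_ _ e0); apply: filterS => u; rewrite /S !block_mxKdr => hu.
  apply: (coercive_near hc2).
  rewrite distrC; move: hu; rewrite ler_pdivlMr ?ltr_wpDl// => hu.
  by apply: le_trans hu; rewrite mulrC ler_pM// lerDl.
pose c := Num.min (c1 / 2) (c2 / 2).
have c0 : 0 < c by rewrite lt_min !divr_gt0.
pose K := KS + KB + KA; have K0 : 0 <= K by rewrite !addr_ge0.
have [eta eta0 ER] := energy_rigidity r m c0 K0.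
have : \forall u \near U0, [/\ D u, `|S u| <= KS /\ forall h : 'cV[R]_(r + m), `|'D_h S u| <= KS * `|h|,
   `|Bmx B22 u| <= KB /\ forall h : 'cV[R]_(r + m), `|'D_h (Bmx B22) u| <= KB * `|h|,
   `|Jf f u| <= KA /\ forall h : 'cV[R]_(r + m), `|dJf f h u| <= KA * `|h| &
   (forall v, c1 / 2 * `|v| ^+ 2 <= bil (ulsubmx (S u *m Jf f u)) v v) /\
   (forall v, c2 / 2 * `|v| ^+ 2 <= bil (S2 u *m B22 u) v v)].
  near=> u; split; [|near: u..|split; near: u] => //.
  by near: u; exact: open_nbhs_nbhs.
move=> /nbhs_closed_ball_le[rho1 rho10 hrho].
pose n : R := (r + m)%:R; have n0 : 0 <= n by [].
(* The factor [n + 1] serves two bounds at once: [K * rho] for derivatives of the coefficients, and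
   [n * (K * rho)] for [Eop], which contains a matrix product. *)
pose T := (n + 1) * (K + 1); have T0 : 0 < T by rewrite mulr_gt0// ltr_wpDl.
pose rho := Num.min rho1 (eta / T).
have rho_rho1 : rho <= rho1 by rewrite ge_min lexx.
have rhoT : T * rho <= eta by rewrite mulrC -ler_pdivlMr// ge_min lexx orbT.
have rho0 : 0 < rho by rewrite lt_min rho10 divr_gt0.
have nrho : 0 <= n * rho by rewrite mulr_ge0// ltW.
have Krho : 0 <= K * rho by rewrite mulr_ge0// ltW.
have nKrho : 0 <= n * (K * rho) by rewrite mulr_ge0.
have e1 : K * rho <= eta by move: rhoT; rewrite /T; move: rho0 => ?; lra.
have e2 : n * (K * rho) <= eta by move: rhoT; rewrite /T; move: rho0 => ?; lra.
have KSK : KS <= K by rewrite /K -addrA lerDl addr_ge0.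
have KBK : KB <= K by rewrite /K addrAC lerDr addr_ge0.
have KAK : KA <= K by rewrite /K lerDr addr_ge0.
exists rho => //; split.
  by move=> u hu; have [] := hrho u (le_trans hu rho_rho1).
move=> W dW hW cW dWd la lb X Y dX dY GX GY dGX dGY la0 cX cY cGX cGY hX hY X0 Y0 X1 Y1.
have WD (x : R) : 0 <= x <= 1 -> `|W x - U0| <= rho1.
  by move=> /hW[h _]; exact: le_trans rho_rho1.
have DW (x : R) : 0 <= x <= 1 -> D (W x) by move=> /WD/hrho[].
have oc (x : R) : 0 < x < 1 -> 0 <= x <= 1 by move=> /andP[? ?]; rewrite !ltW.
pose d (x : R) := EnergyData (Jf f (W x)) (Jac f0 (W x)) (S1 (W x)) (S2 (W x)) (B22 (W x))
   (Eop (W x) (dW x)) (dJf f (dW x) (W x)) (ulsubmx ('D_(dW x) S (W x)))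
   (drsubmx ('D_(dW x) S (W x))).
have wS : {within `[0, 1], continuous (fun x => S (W x))}.
  apply: within_comp cW _ => x; rewrite /= in_itv/= => x01.
  by apply: differentiable_continuous; have [h _] := C1S; exact/h/DW.
have dS (x : R) : 0 < x < 1 -> is_derive x 1 (fun y => S (W y)) ('D_(dW x) S (W x)).
  move=> x01; apply: is_derive_comp_mx; first exact: dWd.
  by have [h _] := C1S; exact/h/DW/oc.
have hyp : forall x : R, 0 <= x <= 1 -> energy_hyp c K eta (d x).
  move=> x x01; have [_ hdW] := hW x x01.
    have [Dx [S_K dS_K] [B_K dB_K] [A_K dA_K] [co1 co2]] := hrho _ (WD x x01).
    have [sy1 sy2 sy3] := symS _ Dx.
    have dSn : `|'D_(dW x) S (W x)| <= eta.
      by rewrite (le_trans (dS_K _))// (le_trans _ e1)// ler_pM.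
    have n1 : `|S2 (W x)| <= K.
    rewrite (_ : S2 (W x) = drsubmx (S (W x))); last by rewrite block_mxKdr.
    exact: le_trans (drsubmx_norm_le _) (le_trans S_K KSK).
  have n2 : `|B22 (W x)| <= K.
    by rewrite B22_dr; exact: le_trans (drsubmx_norm_le _) (le_trans B_K KBK).
  have n3 : `|Eop (W x) (dW x)| <= eta.
    apply: mx_norm_le => [|i j]; first exact: ltW.
    rewrite mxE; apply: le_trans (mx_entry_le _ _ _) _.
    apply: le_trans (dsubmx_norm_le _) _; apply: le_trans (mulmx_norm_le _ _) _.
    apply: le_trans e2; rewrite -mulrA; apply: ler_wpM2l => //; apply: ler_pM => //.
    apply: le_trans (dB_K _) _; apply: le_trans KBK; apply: ler_piMr => //.
    by apply: mx_norm_le => // a b; rewrite mxE; case: (_ && _); rewrite ?normr1 ?normr0.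
  have n4 : `|dJf f (dW x) (W x)| <= eta.
    by apply: le_trans (dA_K _) _; apply: le_trans e1; apply: ler_pM.
  split.
  - exact: le_trans A_K KAK.
  - exact: le_trans S_K KSK.
  - exact: n1.
  - exact: n2.
  - exact: n3.
  - exact: n4.
  - exact: le_trans (block_diag_norm_le _) dSn.
  - exact: le_trans (drsubmx_norm_le _) dSn.
  - exact: sy2.
  - exact: sy1.
  - exact: sy3.
  - by move=> v; apply: le_trans (co1 v); apply: ler_wpM2r; rewrite ?exprn_ge0// ge_min lexx.
  - by move=> v; apply: le_trans (co2 v); apply: ler_wpM2r; rewrite ?exprn_ge0// ge_min lexx orbT.
have dA : forall x : R, 0 < x < 1 -> is_derive x 1 (fun y => eA (d y)) (edA (d x)).
  move=> x x01 /=; apply: is_derive_Jf; first exact: dWd.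
  by move=> v; exact/ddf/DW/oc.
have dS1 : forall x : R, 0 < x < 1 -> is_derive x 1 (fun y => eS1 (d y)) (edS1 (d x)).
  move=> x x01 /=; have /is_derive_mxP h := dS x x01; apply/is_derive_mxP => i j.
  rewrite !mxE (_ : (fun y => _) = fun y => S (W y) (lshift m i) (lshift m j)); first exact: h.
  by apply/funext => y; rewrite block_mxEul.
have dS2 : forall x : R, 0 < x < 1 -> is_derive x 1 (fun y => eS2 (d y)) (edS2 (d x)).
  move=> x x01 /=; have /is_derive_mxP h := dS x x01; apply/is_derive_mxP => i j.
  rewrite !mxE (_ : (fun y => _) = fun y => S (W y) (rshift r i) (rshift r j)); first exact: h.
  by apply/funext => y; rewrite block_mxEdr.
have kA : {within `[0, 1], continuous (fun x => eA (d x))}.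
  apply: within_comp cW _ => x; rewrite /= in_itv/= => x01.
  by apply: continuous_Jf => v; apply: differentiable_continuous; exact/ddf/DW.
have kS1 : {within `[0, 1], continuous (fun x => eS1 (d x))}.
  apply/within_mxP => i j.
  rewrite (_ : (fun y => _) = fun y => S (W y) (lshift m i) (lshift m j)).
    by move/within_mxP : wS; exact.
  by apply/funext => y; rewrite block_mxEul.
have kS2 : {within `[0, 1], continuous (fun x => eS2 (d x))}.
  apply/within_mxP => i j.
  rewrite (_ : (fun y => _) = fun y => S (W y) (rshift r i) (rshift r j)).
    by move/within_mxP : wS; exact.
  by apply/funext => y; rewrite block_mxEdr.
have E := ER d hyp dA dS1 dS2 kA kS1 kS2 la lb X Y dX dY GX GY dGX dGY la0 cX cY cGX cGY.
apply: E X0 Y0 X1 Y1.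
- move=> x x01; have [h1 h2 h3 h4] := hX x x01; split; [exact: h1|exact: h2| |exact: h4].
  by rewrite h3 /eG /= Eop_mul//; exact/DW/oc.
- move=> x x01; have [h1 h2 h3 h4] := hY x x01; split; [exact: h1|exact: h2| |exact: h4].
  by rewrite h3 /eG /= Eop_mul//; exact/DW/oc.
Unshelve. all: by end_near. Qed.

End core.

(** * Spectral stability *)

Section complex_parts.
Context {R : realType}.

Lemma Re_add (a b : R[i]) : complex.Re (a + b) = complex.Re a + complex.Re b.
Proof. by case: a b => ? ? [? ?]. Qed.

Lemma Im_add (a b : R[i]) : complex.Im (a + b) = complex.Im a + complex.Im b.
Proof. by case: a b => ? ? [? ?]. Qed.

Lemma Re_sum (I : Type) (s : seq I) (P : pred I) (F : I -> R[i]) :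
  complex.Re (\sum_(i <- s | P i) F i) = \sum_(i <- s | P i) complex.Re (F i).
Proof. by apply: (big_morph _ Re_add). Qed.

Lemma Im_sum (I : Type) (s : seq I) (P : pred I) (F : I -> R[i]) :
  complex.Im (\sum_(i <- s | P i) F i) = \sum_(i <- s | P i) complex.Im (F i).
Proof. by apply: (big_morph _ Im_add). Qed.

Lemma Re_mul (a b : R[i]) :
  complex.Re (a * b) = complex.Re a * complex.Re b - complex.Im a * complex.Im b.
Proof. by case: a b => ? ? [? ?]. Qed.

Lemma Im_mul (a b : R[i]) :
  complex.Im (a * b) = complex.Re a * complex.Im b + complex.Im a * complex.Re b.
Proof. by case: a b => ? ? [? ?]. Qed.

Lemma mxRe_add p q (M N : 'M[R[i]]_(p, q)) : mxRe (M + N) = mxRe M + mxRe N.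
Proof. by apply/matrixP => i j; rewrite !mxE Re_add. Qed.

Lemma mxIm_add p q (M N : 'M[R[i]]_(p, q)) : mxIm (M + N) = mxIm M + mxIm N.
Proof. by apply/matrixP => i j; rewrite !mxE Im_add. Qed.

Lemma mxRe_scale p q (l : R[i]) (M : 'M[R[i]]_(p, q)) :
  mxRe (l *: M) = complex.Re l *: mxRe M - complex.Im l *: mxIm M.
Proof. by apply/matrixP => i j; rewrite !mxE Re_mul. Qed.

Lemma mxIm_scale p q (l : R[i]) (M : 'M[R[i]]_(p, q)) :
  mxIm (l *: M) = complex.Re l *: mxIm M + complex.Im l *: mxRe M.
Proof. by apply/matrixP => i j; rewrite !mxE Im_mul. Qed.

Lemma mxRe_mxC p q (M : 'M[R]_(p, q)) : mxRe (mxC M) = M.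
Proof. by apply/matrixP => i j; rewrite !mxE. Qed.

Lemma mxIm_mxC p q (M : 'M[R]_(p, q)) : mxIm (mxC M) = 0.
Proof. by apply/matrixP => i j; rewrite !mxE. Qed.

Lemma mxRe_mull p q s (M : 'M[R]_(p, q)) (V : 'M[R[i]]_(q, s)) :
  mxRe (mxC M *m V) = M *m mxRe V.
Proof.
apply/matrixP => i j; rewrite !mxE Re_sum; apply: eq_bigr => k _.
by rewrite Re_mul !mxE mul0r subr0.
Qed.

Lemma mxIm_mull p q s (M : 'M[R]_(p, q)) (V : 'M[R[i]]_(q, s)) :
  mxIm (mxC M *m V) = M *m mxIm V.
Proof.
apply/matrixP => i j; rewrite !mxE Im_sum; apply: eq_bigr => k _.
by rewrite Im_mul !mxE mul0r addr0.
Qed.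

Lemma mxRe_mulr p q s (V : 'M[R[i]]_(p, q)) (M : 'M[R]_(q, s)) :
  mxRe (V *m mxC M) = mxRe V *m M.
Proof.
apply/matrixP => i j; rewrite !mxE Re_sum; apply: eq_bigr => k _.
by rewrite Re_mul !mxE mulr0 subr0.
Qed.

Lemma mxIm_mulr p q s (V : 'M[R[i]]_(p, q)) (M : 'M[R]_(q, s)) :
  mxIm (V *m mxC M) = mxIm V *m M.
Proof.
apply/matrixP => i j; rewrite !mxE Im_sum; apply: eq_bigr => k _.
by rewrite Im_mul !mxE mulr0 add0r.
Qed.

Lemma mxReIm_eq0 p q (V : 'M[R[i]]_(p, q)) : mxRe V = 0 -> mxIm V = 0 -> V = 0.
Proof.
move=> /matrixP hr /matrixP hi; apply/matrixP => i j.
by have := hr i j; have := hi i j; rewrite !mxE; case: (V i j) => a b /= -> ->.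
Qed.

Lemma mxRe_derive01C k (V : R -> 'cV[R[i]]_k) x :
  mxRe (derive01C V x) = derive01 (fun y => mxRe (V y)) x.
Proof.
apply/matrixP => i j; rewrite /derive01C mxRe_add mxRe_scale !mxRe_mxC mxIm_mxC !mxE.
by rewrite mul0r mulr0 subr0 addr0.
Qed.

Lemma mxIm_derive01C k (V : R -> 'cV[R[i]]_k) x :
  mxIm (derive01C V x) = derive01 (fun y => mxIm (V y)) x.
Proof.
apply/matrixP => i j; rewrite /derive01C mxIm_add mxIm_scale !mxRe_mxC !mxIm_mxC !mxE.
by rewrite mulr0 !add0r mul1r.
Qed.

Lemma mxRe_eigen k (la : R[i]) (A : 'M[R]_k) (V : 'cV[R[i]]_k) (F : R -> 'cV[R[i]]_k) x :
  mxRe (la *: (mxC A *m V) + derive01C F x) =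
  complex.Re la *: (A *m mxRe V) - complex.Im la *: (A *m mxIm V) +
  derive01 (fun y => mxRe (F y)) x.
Proof. by rewrite mxRe_add mxRe_scale mxRe_mull mxIm_mull mxRe_derive01C. Qed.

Lemma mxIm_eigen k (la : R[i]) (A : 'M[R]_k) (V : 'cV[R[i]]_k) (F : R -> 'cV[R[i]]_k) x :
  mxIm (la *: (mxC A *m V) + derive01C F x) =
  complex.Re la *: (A *m mxIm V) + complex.Im la *: (A *m mxRe V) +
  derive01 (fun y => mxIm (F y)) x.
Proof. by rewrite mxIm_add mxIm_scale mxRe_mull mxIm_mull mxIm_derive01C. Qed.

Lemma mxRe_dBC r m (B22 : 'cV[R]_(r + m) -> 'M[R]_m) u (V : 'cV[R[i]]_(r + m)) :
  mxRe (dBC B22 u V) = \sum_j mxRe V j 0 *: 'd (Bmx B22) u (delta_mx j 0).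
Proof.
apply/matrixP => i j; rewrite mxE !summxE Re_sum; apply: eq_bigr => k _.
by rewrite [X in complex.Re X]mxE Re_mul [RHS]mxE !mxE /= mulr0 subr0.
Qed.

Lemma mxIm_dBC r m (B22 : 'cV[R]_(r + m) -> 'M[R]_m) u (V : 'cV[R[i]]_(r + m)) :
  mxIm (dBC B22 u V) = \sum_j mxIm V j 0 *: 'd (Bmx B22) u (delta_mx j 0).
Proof.
apply/matrixP => i j; rewrite mxE !summxE Im_sum; apply: eq_bigr => k _.
by rewrite [X in complex.Im X]mxE Im_mul [RHS]mxE !mxE /= mulr0 add0r.
Qed.

End complex_parts.

(** * The eigenvalue problem as a real system for two vector functions *)

Section spectral.
Context {R : realType}.

Lemma within_ext (W : normedModType R) (g h : R -> W) :
  (forall x : R, 0 <= x <= 1 -> g x = h x) ->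
  {within `[0, 1], continuous g} -> {within `[0, 1], continuous h}.
Proof.
move=> gh /within_continuousP cg; apply/within_continuousP => x x01 e e0.
have [d d0 hd] := cg x x01 e e0; exists d => // y y01 yx.
have /andP[x0 y0] : (0 <= x <= 1) && (0 <= y <= 1) by move: x01 y01; rewrite /= !in_itv/= => -> ->.
by rewrite -(gh y y0) -(gh x x0); exact: hd.
Qed.

Lemma C1_01_is_derive (W : normedModType R) (g : R -> W) (x : R) : C1_01 g -> 0 < x < 1 ->
  is_derive x 1 g (derive01 g x).
Proof.
move=> [dg _] x01; apply: (is_derive01_derive x01); apply: derivable01P.
by apply/dg/I01P; case/andP: x01 => *; rewrite !ltW.
Qed.

Variables (r m : nat) (D : set 'cV[R]_(r + m)) (f0 f : 'cV[R]_(r + m) -> 'cV[R]_(r + m)).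
Variables (B22 : 'cV[R]_(r + m) -> 'M[R]_m).
Hypothesis oD : open D.
Hypothesis sys : structural_assumptions D f0 f B22.

Lemma usubmx_Bmx_mul u (w : 'cV[R]_(r + m)) : usubmx (Bmx B22 u *m w) = 0.
Proof. by rewrite -[w]vsubmxK mul_block_col col_mxKu !mul0mx addr0. Qed.

Lemma dsubmx_Bmx_mul u (w : 'cV[R]_(r + m)) : dsubmx (Bmx B22 u *m w) = B22 u *m dsubmx w.
Proof. by rewrite -[w in LHS]vsubmxK mul_block_col col_mxKd mul0mx add0r. Qed.

Lemma usubmx_derive_Bmx u v (w : 'cV[R]_(r + m)) : D u ->
  usubmx ('D_v (Bmx B22) u *m w) = 0.
Proof.
move=> Du; have dB : differentiable (Bmx B22) u by have [h _] := B_smooth sys 1; exact: h.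
apply/matrixP => i j; rewrite !mxE big1// => k _.
rewrite derive_mx; last exact: diff_derivable.
rewrite mxE (_ : (fun y => _) = cst 0) ?derive_cst ?mul0r//.
apply/funext => y; rewrite /Bmx; case: (split_ordP k) => l ->.
  by rewrite block_mxEul mxE.
by rewrite block_mxEur mxE.
Qed.

(** The flux of [eigenproblem] has real coefficients, so its real and imaginary parts are this
    expression at the real and imaginary parts of the eigenfunction. *)
Let realflux (W X : R -> 'cV[R]_(r + m)) (x : R) : 'cV[R]_(r + m) :=
  Bmx B22 (W x) *m derive01 X x +
  (\sum_j X x j 0 *: 'd (Bmx B22) (W x) (delta_mx j 0)) *m derive01 W x.

Let realfluxE (W X : R -> 'cV[R]_(r + m)) (x : R) : D (W x) -> realflux W X x =
  Bmx B22 (W x) *m derive01 X x + 'D_(X x) (Bmx B22) (W x) *m derive01 W x.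
Proof.
move=> Dx; have dB : differentiable (Bmx B22) (W x) by have [h _] := B_smooth sys 1; exact: h.
by rewrite (derive_partials _ dB); under [in RHS]eq_bigr do rewrite deriveE//.
Qed.

Let realflux_cont (W X : R -> 'cV[R]_(r + m)) :
  (forall x : R, 0 <= x <= 1 -> D (W x)) -> C1_01 W -> C1_01 X ->
  {within `[0, 1], continuous (fun x => dsubmx (realflux W X x))}.
Proof.
move=> DW cW cX; apply: within_dsubmx.
have [dB cdB] := B_smooth sys 1.
have wW := C1_01_within cW; have wX := C1_01_within cX.
apply: within_add; apply: within_mulmx.
- by apply: within_comp wW _ => x; rewrite /= in_itv/= => x01; apply/differentiable_continuous/dB/DW.
- by case: cX.
- have h j : {within `[0, 1], continuous (fun x => 'd (Bmx B22) (W x) (delta_mx j 0))}.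
    have hD : {within `[0, 1], continuous (fun x => 'D_(delta_mx j 0) (Bmx B22) (W x))}.
      apply: (within_comp (g := 'D_(delta_mx j 0) (Bmx B22)) wW) => x; rewrite /= in_itv/= => x01.
      exact: (cdB (delta_mx j 0) _ (DW x x01)).
    have EqD (x : R) : 0 <= x <= 1 ->
        'd (Bmx B22) (W x) (delta_mx j 0) = 'D_(delta_mx j 0) (Bmx B22) (W x).
      by move=> x01; rewrite [RHS]deriveE//; exact/dB/DW.
    exact: (within_ext (fun x x01 => esym (EqD x x01)) hD).
  apply/within_mxP => a b.
  rewrite (_ : (fun y => _) = fun y => (\row_j ('d (Bmx B22) (W y) (delta_mx j 0)) a b *m X y) 0 0).
    have : {within `[0, 1], continuous (fun y => \row_j ('d (Bmx B22) (W y) (delta_mx j 0)) a b *m X y)}.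
      apply: within_mulmx => //; apply/within_mxP => i j.
      rewrite (_ : (fun y => _) = fun y => ('d (Bmx B22) (W y) (delta_mx j 0)) a b).
        by have /within_mxP := h j; exact.
      by apply/funext => y; rewrite mxE.
    by move/within_mxP; exact.
  by apply/funext => y; rewrite summxE mxE; apply: eq_bigr => k _; rewrite !mxE mulrC.
- by case: cW.
Qed.

(** [N] is the spectral term. Expanding [(A X)'] by the product rule puts the equation into the form
    expected by [core_rigidity]. *)
Lemma real_eigen_system (W X : R -> 'cV[R]_(r + m)) (x : R) (N : 'cV[R]_(r + m)) :
  (forall x : R, 0 <= x <= 1 -> D (W x)) -> C1_01 W -> C1_01 X -> 0 < x < 1 ->
  derivable01 (realflux W X) x ->
  N + derive01 (fun y => Jac f (W y) *m X y) x = derive01 (realflux W X) x ->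
  [/\ is_derive x 1 X (derive01 X x),
      is_derive x 1 (fun y => dsubmx (realflux W X y)) (dsubmx (derive01 (realflux W X) x)),
      dsubmx (realflux W X x) = B22 (W x) *m dsubmx (derive01 X x) +
        dsubmx ('D_(X x) (Bmx B22) (W x) *m derive01 W x) &
      N + dJf f (derive01 W x) (W x) *m X x + Jf f (W x) *m derive01 X x =
        col_mx 0 (dsubmx (derive01 (realflux W X) x))].
Proof.
move=> DW cW cX x01 dF E.
have x01' : 0 <= x <= 1 by case/andP: x01 => *; rewrite !ltW.
have dX : is_derive x 1 X (derive01 X x).
  exact: C1_01_is_derive.
have dW : is_derive x 1 W (derive01 W x).
  exact: C1_01_is_derive.
have [dF2 dF1] := is_derive01_sub_mx (derivable01P dF).
(* The first block row of [B] is zero along the profile, as is that of its derivative, so the flux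
   has no [I] component to differentiate. *)
have u0 : usubmx (derive01 (realflux W X) x) = 0.
  have h0 : is_derive01 (fun y => usubmx (realflux W X y)) x 0.
    apply: (@is_derive01_ext _ _ (cst 0)) => //.
      move=> y y01; rewrite realfluxE ?linearD; last exact: DW.
      by rewrite /= usubmx_Bmx_mul usubmx_derive_Bmx ?addr0//; exact: DW.
    by apply: is_derive_derive01; exact: is_derive_cst.
  have [_ <-] := is_derive01_unique x01' dF1.
  by have [_ <-] := is_derive01_unique x01' h0.
split.
- exact: dX.
- exact: is_derive01_derive.
- by rewrite realfluxE ?linearD /= ?dsubmx_Bmx_mul//; exact: DW.
- rewrite -[X in col_mx X _]u0 vsubmxK -E -addrA; congr (_ + _).
  have df u : D u -> differentiable f u by have [h _] := f_smooth sys 1; exact: h.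
  have ddf u v : D u -> differentiable ('D_v f) u.
    by have [_ h] := f_smooth sys 2; have [h' _] := h v; exact: h'.
  have hA : is_derive x 1 (fun y => Jf f (W y) *m X y)
      (dJf f (derive01 W x) (W x) *m X x + Jf f (W x) *m derive01 X x).
    by apply: is_derive_mulmx dX; apply: is_derive_Jf => // v; exact/ddf/DW.
  have hA' := is_derive_derive01 hA.
  have hA2 : is_derive01 (fun y => Jac f (W y) *m X y) x
      (dJf f (derive01 W x) (W x) *m X x + Jf f (W x) *m derive01 X x).
    by apply: is_derive01_ext hA' => // y y01; rewrite Jac_Jf//; exact/df/DW.
  by have [_ <-] := is_derive01_unique x01' hA2.
Qed.

(** One radius serves every [lambda] in the closed right half-plane, since [core_rigidity] fixes it
    before the spectral parameter. *)
Lemma spectral_near U0 : D U0 -> exists2 rho : R, 0 < rho &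
  forall W : R -> 'cV[R]_(r + m), C1_01 W ->
  (forall x : R, 0 <= x <= 1 -> `|W x - U0| <= rho /\ `|derive01 W x| <= rho) ->
  spectrally_stable f0 f B22 W.
Proof.
move=> /(core_rigidity oD sys)[rho rho0 [Drho core]]; exists rho => // W cW hW.
have DW (x : R) : 0 <= x <= 1 -> D (W x) by move=> /hW[h _]; exact: Drho.
move=> la la0 V [[cX cY] hV V0 V1] x /I01P x01.
set X := fun y => mxRe (V y) in cX; set Y := fun y => mxIm (V y) in cY.
have hx (y : R) : 0 < y < 1 -> [/\ derivable01 (realflux W X) y, derivable01 (realflux W Y) y,
    complex.Re la *: (Jac f0 (W y) *m X y) - complex.Im la *: (Jac f0 (W y) *m Y y)
      + derive01 (fun y => Jac f (W y) *m X y) y = derive01 (realflux W X) y &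
    complex.Re la *: (Jac f0 (W y) *m Y y) + complex.Im la *: (Jac f0 (W y) *m X y)
      + derive01 (fun y => Jac f (W y) *m Y y) y = derive01 (realflux W Y) y].
  move=> y01; have [[]] := hV y y01.
  set F := (fun x => _ + _) => dR dI /[dup] /(congr1 (@mxRe R _ _)) eR /(congr1 (@mxIm R _ _)) eI.
  have FR : (fun y => mxRe (F y)) = realflux W X.
    apply/funext => z; rewrite /F /realflux mxRe_add mxRe_mull mxRe_derive01C mxRe_mulr.
    by rewrite mxRe_dBC.
  have FI : (fun y => mxIm (F y)) = realflux W Y.
    apply/funext => z; rewrite /F /realflux mxIm_add mxIm_mull mxIm_derive01C mxIm_mulr.
    by rewrite mxIm_dBC.
  rewrite FR in dR; rewrite FI in dI.
  move: eR; rewrite mxRe_eigen mxRe_derive01C FR => eR.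
  move: eI; rewrite mxIm_eigen mxIm_derive01C FI => eI.
  have FR' : (fun y => mxRe (mxC (Jac f (W y)) *m V y)) = fun y => Jac f (W y) *m X y.
    by apply/funext => z; rewrite mxRe_mull.
  have FI' : (fun y => mxIm (mxC (Jac f (W y)) *m V y)) = fun y => Jac f (W y) *m Y y.
    by apply/funext => z; rewrite mxIm_mull.
  by rewrite FR' in eR; rewrite FI' in eI; split; [exact: dR|exact: dI|exact: eR|exact: eI].
have X0 : X 0 = 0 by rewrite /X V0; apply/matrixP => i j; rewrite !mxE.
have Y0 : Y 0 = 0 by rewrite /Y V0; apply/matrixP => i j; rewrite !mxE.
have X1 : dsubmx (X 1) = 0.
  by rewrite /X /mxRe -map_dsubmx V1; apply/matrixP => i j; rewrite !mxE.
have Y1 : dsubmx (Y 1) = 0.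
  by rewrite /Y /mxIm -map_dsubmx V1; apply/matrixP => i j; rewrite !mxE.
have dW (y : R) : 0 < y < 1 -> is_derive y 1 W (derive01 W y).
  exact: C1_01_is_derive.
have [] := core W (derive01 W) hW (C1_01_within cW) dW (complex.Re la) (complex.Im la) X Y
  (derive01 X) (derive01 Y) (fun y => dsubmx (realflux W X y)) (fun y => dsubmx (realflux W Y y))
  (fun y => dsubmx (derive01 (realflux W X) y)) (fun y => dsubmx (derive01 (realflux W Y) y))
  la0 (C1_01_within cX) (C1_01_within cY) (realflux_cont DW cW cX) (realflux_cont DW cW cY)
  _ _ X0 Y0 X1 Y1 x x01.
- move=> y y01; have [dR dI eR eI] := hx y y01.
  exact: (real_eigen_system DW cW cX y01 dR eR).
- move=> y y01; have [dR dI eR eI] := hx y y01.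
  exact: (real_eigen_system DW cW cY y01 dI eI).
- exact: mxReIm_eq0.
Qed.

End spectral.

(** * The profile equations *)

Section profile_field.
Context {R : realType}.

Lemma unitmx_of_ker n (A : 'M[R]_n) : (forall v : 'cV[R]_n, A *m v = 0 -> v = 0) -> A \in unitmx.
Proof.
move=> h; rewrite -unitmx_tr -row_free_unit; apply: inj_row_free => v hv.
by apply: trmx_inj; rewrite trmx0; apply: h; rewrite -[A]trmxK -trmx_mul hv trmx0.
Qed.

Variables (r m : nat) (D : set 'cV[R]_(r + m)) (f0 f : 'cV[R]_(r + m) -> 'cV[R]_(r + m)).
Variables (B22 : 'cV[R]_(r + m) -> 'M[R]_m).
Hypothesis oD : open D.
Hypothesis sys : structural_assumptions D f0 f B22.

Lemma A11_unit u : D u -> ulsubmx (Jf f u) \in unitmx.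
Proof.
move=> Du; have df : differentiable f u by have [h _] := f_smooth sys 1; exact: h.
rewrite -(map_unitmx (real_complex R)) -row_free_unit -kermx_eq0; apply/negPn/negP => k0.
have := A11_speeds sys Du (z := 0); rewrite (Jac_Jf df) /eigenvalue /eigenspace.
by rewrite raddf0 subr0 => /(_ k0)[_]; rewrite ltxx.
Qed.

(** On a kernel vector of [B22] the positive definite form of [S22 B22] plus its transpose would
    vanish. *)
Lemma B22_unit u : D u -> B22 u \in unitmx.
Proof.
move=> Du; have [S1 [S2 [_ hS]]] := symmetrizable sys; have [_ _ _ h] := hS u Du.
apply: unitmx_of_ker => v hv; apply/eqP; apply: contraT => /h.
rewrite mulmxDr mulmxDl mxE trmx_mul -!mulmxA hv (mulmxA v^T (B22 u)^T) -trmx_mul hv trmx0.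
by rewrite mul0mx !mulmx0 !mxE addr0 ltxx.
Qed.

Variable U0 : 'cV[R]_(r + m).
Hypothesis DU0 : D U0.

(* The profile equations in explicit form [W' = profile_dir W *m profile_src W C]: the rows of
   [profile_dir] solve [A11 W_I' + A12 W_II' = 0]. *)
Definition profile_dir (u : 'cV[R]_(r + m)) : 'M[R]_(r + m, m) :=
  col_mx (- (invmx (ulsubmx (Jf f u)) *m ursubmx (Jf f u))) 1%:M *m invmx (B22 u).

Definition profile_src (u : 'cV[R]_(r + m)) (c : 'cV[R]_m) : 'cV[R]_m :=
  dsubmx (f u) - dsubmx (f U0) + B22 U0 *m c.

(* The parameter [C] is carried along as a constant component of the state. *)
Definition profile_field (y : 'cV[R]_(r + m + m)) : 'cV[R]_(r + m + m) :=
  col_mx (profile_dir (usubmx y) *m profile_src (usubmx y) (dsubmx y)) 0.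

Lemma profile_dirP u (s : 'cV[R]_m) : D u ->
  B22 u *m dsubmx (profile_dir u *m s) = s /\
  usubmx (Jf f u *m (profile_dir u *m s)) = 0.
Proof.
move=> Du; rewrite /profile_dir -mulmxA; set t := invmx (B22 u) *m s.
rewrite mul_col_mx mul1mx col_mxKd mulNmx; split; first by rewrite /t mulKVmx// B22_unit.
rewrite -[X in usubmx (X *m _)]submxK mul_block_col col_mxKu mulmxN -!mulmxA mulKVmx ?A11_unit//.
by rewrite addNr.
Qed.

Lemma profile_dir_unique u (w : 'cV[R]_(r + m)) : D u -> usubmx (Jf f u *m w) = 0 ->
  w = profile_dir u *m (B22 u *m dsubmx w).
Proof.
move=> Du; rewrite /profile_dir -mulmxA mulKmx ?B22_unit// mul_col_mx mul1mx mulNmx.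
rewrite -[X in usubmx (X *m _)]submxK -[w in X in X -> _]vsubmxK mul_block_col col_mxKu => h.
rewrite -[LHS]vsubmxK; congr col_mx; rewrite -[LHS](mulKmx (A11_unit Du)).
by rewrite -mulmxA -mulmxN; congr (_ *m _); apply/eqP; rewrite -addr_eq0 h.
Qed.

Let y0 : 'cV[R]_(r + m + m) := col_mx U0 0.

Lemma profile_field0 : profile_field y0 = 0.
Proof.
by rewrite /profile_field /y0 col_mxKu col_mxKd /profile_src subrr mulmx0 addr0 mulmx0 col_mx0.
Qed.

Lemma is_c11_profile_dir i j : is_c11 U0 (fun u => profile_dir u i j).
Proof.
have [rho rho0 Drho] : exists2 rho : R, 0 < rho & forall u, `|u - U0| <= rho -> D u.
  by have /nbhs_closed_ball_le[rho rho0 h] : nbhs U0 D by [exact: open_nbhs_nbhs]; exists rho.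
have JfE k l : is_c11 U0 (fun u => Jf f u k l).
  (* Three derivatives of [f]: one for the Jacobian, two more for its entries to have Lipschitz
     gradients. *)
  have [_ Hf] := f_smooth sys 3.
  have := c11_of_C2 k 0 oD DU0 (Hf (delta_mx l 0)).
  move=> [rho1 [K1 [r1 k1 H]]]; eexists; exists rho1, K1; split=> // a b ha hb.
  by have := H a b ha hb; rewrite !(mxE _ _ k l); exact.
have JulE k l : is_c11 U0 (fun u => ulsubmx (Jf f u) k l).
  by rewrite (_ : (fun _ => _) = fun u => Jf f u (lshift m k) (lshift m l))//;
    apply/funext => u; rewrite 2!mxE.
have JurE k l : is_c11 U0 (fun u => ursubmx (Jf f u) k l).
  by rewrite (_ : (fun _ => _) = fun u => Jf f u (lshift m k) (rshift r l))//;
    apply/funext => u; rewrite 2!mxE.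
have BE k l : is_c11 U0 (fun u => B22 u k l).
  have hB := c11_of_C2 (rshift r k) (rshift r l) oD DU0 (B_smooth sys 2).
  eexists; move: hB; rewrite (_ : (fun u => Bmx B22 u _ _) = fun u => B22 u k l); first exact.
  by apply/funext => u; rewrite /Bmx block_mxEdr.
have iA := is_c11_invmx rho0 (fun u hu => A11_unit (Drho u hu)) JulE.
have iB := is_c11_invmx rho0 (fun u hu => B22_unit (Drho u hu)) BE.
apply: is_c11_mulmx => // k l; case: (split_ordP k) => k' ->.
  rewrite (_ : (fun _ => _) = fun u => -1 * (invmx (ulsubmx (Jf f u)) *m ursubmx (Jf f u)) k' l).
    by apply: is_c11_mul; [exact: is_c11_cst|exact: is_c11_mulmx].
  by apply/funext => u; rewrite col_mxEu mxE mulN1r.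
rewrite (_ : (fun _ => _) = fun=> (1%:M : 'M[R]_m) k' l); first exact: is_c11_cst.
by apply/funext => u; rewrite col_mxEd.
Qed.

Let dsrc (j : 'I_m) (y : 'cV[R]_(r + m + m)) : 'rV[R]_(r + m + m) :=
  row_mx (\row_k ('D_(delta_mx k 0) f (usubmx y)) (rshift r j) 0) (row j (B22 U0)).

Lemma c11_profile_src j : c11 y0 (fun y => profile_src (usubmx y) (dsubmx y) j 0) (dsrc j).
Proof.
have h1 : c11 y0 (fun y => f (usubmx y) (rshift r j) 0)
    (fun y => row_mx (\row_k ('D_(delta_mx k 0) f (usubmx y)) (rshift r j) 0) 0).
  exact: (c11_usubmx 0 (c11_of_C2 (rshift r j) 0 oD DU0 (f_smooth sys 2))).
have h2 := c11_add h1 (c11_cst y0 (- dsubmx (f U0) j 0)).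
have h3 : c11 y0 (fun y => \sum_k B22 U0 j k * y (rshift (r + m) k) 0) _ :=
  c11_sum _ _ (fun k => c11_mul (c11_cst y0 (B22 U0 j k)) (c11_coord y0 (rshift (r + m) k))).
have := c11_add h2 h3; congr (c11 _ _ _); apply/funext => y.
  rewrite /profile_src !mxE; congr (_ + _); apply: eq_bigr => k _; by rewrite !mxE.
rewrite addr0 /dsrc; apply/rowP => k; rewrite mxE summxE.
case: (split_ordP k) => l ->; rewrite ?row_mxEl ?row_mxEr.
  rewrite big1 ?addr0// => i _; rewrite !mxE eqxx/= eq_lrshift.
  by rewrite !mulr0 addr0.
rewrite mxE add0r (bigD1 l)//= big1 ?addr0.
  by rewrite !mxE !eqxx !mulr1 mulr0 addr0.
move=> i il; rewrite !mxE eqxx/= (inj_eq (@rshift_inj _ _)) eq_sym (negbTE il).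
by rewrite !mulr0 addr0.
Qed.

(** At the equilibrium the source vanishes, so the derivative of [profile_dir] drops out of [DH y0].
    The explicit form of [DH y0] lets the linearised flow be recognised as the linearised steady
    problem. *)
Lemma profile_field_c11 : exists (rho K : R) (DH : 'cV[R]_(r + m + m) -> 'M[R]_(r + m + m)),
  [/\ 0 < rho, 0 <= K,
    forall a, `|a - y0| <= rho -> D (usubmx a) /\ `|DH a| <= K,
    forall a b, `|a - y0| <= rho -> `|b - y0| <= rho ->
      [/\ `|DH a - DH b| <= K * `|a - b|,
         `|profile_field a - profile_field b - DH b *m (a - b)| <= K * `|a - b| ^+ 2 &
         `|profile_field a - profile_field b| <= K * `|a - b|] &
    DH y0 = col_mx (profile_dir U0 *m row_mx (dsubmx (Jf f U0)) (B22 U0)) 0].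
Proof.
have [rho1 rho10 Drho1] : exists2 rho : R, 0 < rho & forall u, `|u - U0| <= rho -> D u.
  by have /nbhs_closed_ball_le[rho rho0 h] : nbhs U0 D by [exact: open_nbhs_nbhs]; exists rho.
have /choice[dN hN] : forall ij : 'I_(r + m) * 'I_m, exists dN, c11 y0
    (fun y => profile_dir (usubmx y) ij.1 ij.2) dN.
  move=> [i j]; have [Dh hDh] := is_c11_profile_dir i j.
  by eexists; exact: (c11_usubmx 0 hDh).
(* Product rule in the rows of the state; zero rows for the parameter, which does not evolve. *)
pose DE (i : 'I_(r + m + m)) (y : 'cV[R]_(r + m + m)) : 'rV[R]_(r + m + m) := match fintype.split i with
  | inl k => \sum_j (profile_dir (usubmx y) k j *: dsrc j y +
       profile_src (usubmx y) (dsubmx y) j 0 *: dN (k, j) y)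
  | inr _ => 0 end.
have hE i : c11 y0 (fun y => profile_field y i 0) (DE i).
  rewrite /DE; case: (split_ordP i) => k ->.
    have := c11_sum (index_enum 'I_m) xpredT (fun j => c11_mul (hN (k, j)) (c11_profile_src j)).
    congr (c11 _ _ _); apply/funext => y.
    by rewrite /profile_field col_mxEu mxE.
  rewrite (_ : (fun _ => _) = fun=> 0); first exact: c11_cst.
  by apply/funext => y; rewrite /profile_field col_mxEd mxE.
have [rho2 [K [rho20 K0 H]]] := c11_family hE.
pose rho := Num.min rho1 rho2; pose q : R := (r + m + m)%:R.
have q0 : 0 <= q by [].
have rho0 : 0 < rho by rewrite lt_min rho10.
have ar2 (a : 'cV[R]_(r + m + m)) : `|a - y0| <= rho -> `|a - y0| <= rho2.
  by move=> h; rewrite (le_trans h)// ge_min lexx orbT.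
pose L := q * K + 2 * rho2 * K.
have L0 : 0 <= L by rewrite addr_ge0// !mulr_ge0// ltW.
exists rho, (K + L), (fun y => \matrix_(i, k) DE i y 0 k).
have KL : K <= K + L by rewrite lerDl.
have LK : L <= K + L by rewrite lerDr.
split.
- exact: rho0.
- exact: addr_ge0.
- move=> a ha; split.
    apply: Drho1; rewrite -[U0](col_mxKu U0 (0 : 'cV[R]_m)) -linearB.
    by rewrite (le_trans (usubmx_norm_le _))// (le_trans ha)// ge_min lexx.
  apply: mx_norm_le => [|i j]; first exact: addr_ge0.
  rewrite mxE; have [_ h _ _] := H i a a (ar2 _ ha) (ar2 _ ha).
  by rewrite (le_trans (mx_entry_le _ _ _))// (le_trans h).
- move=> a b ha hb; have nab := normr_ge0 (a - b); split.
  + apply: mx_norm_le => [|i j]; first by rewrite mulr_ge0// addr_ge0.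
    rewrite !mxE; have [_ _ h _] := H i a b (ar2 _ ha) (ar2 _ hb).
    have := mx_entry_le (DE i a - DE i b) 0 j; rewrite !mxE => /le_trans; apply.
    by rewrite (le_trans h)// ler_wpM2r.
  + apply: mx_norm_le => [|i j]; first by rewrite mulr_ge0 ?exprn_ge0// addr_ge0.
    have [_ _ _ h] := H i a b (ar2 _ ha) (ar2 _ hb); rewrite ord1.
    rewrite (_ : (_ - _ : 'cV[R]_(r + m + m)) i 0 = profile_field a i 0 - profile_field b i 0
        - (DE i b *m (a - b)) 0 0).
      by rewrite (le_trans h)// ler_wpM2r ?exprn_ge0.
    move: (profile_field a) (profile_field b) => pa pb; rewrite !mxE; congr (_ - _).
    by apply: eq_bigr => k _; rewrite !mxE.
  + apply: mx_norm_le => [|i j]; first by rewrite mulr_ge0// addr_ge0.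
    rewrite ord1 mxE [X in _ + X]mxE.
    have := c11_on_lip (ltW rho20) K0 (H i) (ar2 _ ha) (ar2 _ hb); move/le_trans; apply.
    by rewrite ler_wpM2r.
- apply/matrixP => i k; rewrite mxE /DE; case: (split_ordP i) => l ->.
    rewrite col_mxEu summxE [RHS]mxE; apply: eq_bigr => j _.
    have -> : profile_src (usubmx y0) (dsubmx y0) = 0.
      by rewrite /profile_src /y0 col_mxKu col_mxKd subrr mulmx0 addr0.
    rewrite [X in X *: dN _ _]mxE scale0r addr0 mxE /y0 col_mxKu; congr (_ * _).
    rewrite /dsrc; case: (split_ordP k) => k' ->; rewrite ?row_mxEl ?row_mxEr mxE//.
    by rewrite col_mxKu !mxE.
  by rewrite col_mxEd !mxE.
Qed.

End profile_field.

(** * Steady problem, profile equations and explicit equation: the equivalences *)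

Section profile_equations.
Context {R : realType}.

Lemma is_derive_col_mx p q n (P : R -> 'M[R]_(p, n)) dP (Q : R -> 'M[R]_(q, n)) dQ (x : R) :
  is_derive x 1 P dP -> is_derive x 1 Q dQ ->
  is_derive x 1 (fun y => col_mx (P y) (Q y)) (col_mx dP dQ).
Proof.
move=> /is_derive_mxP hP /is_derive_mxP hQ; apply/is_derive_mxP => i j.
case: (split_ordP i) => k ->.
  by under eq_fun do rewrite col_mxEu; rewrite col_mxEu; exact: hP.
by under eq_fun do rewrite col_mxEd; rewrite col_mxEd; exact: hQ.
Qed.

Lemma is_derive_usubmx r m q (W : R -> 'M[R]_(r + m, q)) dW (x : R) :
  is_derive x 1 W dW -> is_derive x 1 (fun y => usubmx (W y)) (usubmx dW).
Proof.
move=> /is_derive_mxP h; apply/is_derive_mxP => i j.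
by under eq_fun do rewrite mxE; rewrite mxE; exact: h.
Qed.

Lemma within_usubmx r m q (A : set R) (W : R -> 'M[R]_(r + m, q)) :
  {within A, continuous W} -> {within A, continuous (fun y => usubmx (W y))}.
Proof.
move=> /within_mxP h; apply/within_mxP => i j.
rewrite (_ : (fun y => _) = fun y => W y (lshift m i) j)//.
by apply/funext => y; rewrite mxE.
Qed.

Lemma within_col_mx p q n (A : set R) (P : R -> 'M[R]_(p, n)) (Q : R -> 'M[R]_(q, n)) :
  {within A, continuous P} -> {within A, continuous Q} ->
  {within A, continuous (fun y => col_mx (P y) (Q y))}.
Proof.
move=> /within_mxP cP /within_mxP cQ; apply/within_mxP => i j.
case: (split_ordP i) => k ->.
- by rewrite (_ : (fun y => _) = fun y => P y k j)//; apply/funext => y; rewrite col_mxEu.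
- by rewrite (_ : (fun y => _) = fun y => Q y k j)//; apply/funext => y; rewrite col_mxEd.
Qed.

Lemma derive_continuous_within (p q : nat) (W dW : R -> 'M[R]_(p, q)) :
  (forall x : R, 0 <= x <= 1 -> is_derive x 1 W (dW x)) -> {within `[0, 1], continuous W}.
Proof.
by move=> h; apply: (is_derive_within (dW := dW)) => x; rewrite /= in_itv/=; exact: h.
Qed.

Variables (r m : nat) (D : set 'cV[R]_(r + m)) (f0 f : 'cV[R]_(r + m) -> 'cV[R]_(r + m)).
Variables (B22 : 'cV[R]_(r + m) -> 'M[R]_m).
Hypothesis oD : open D.
Hypothesis sys : structural_assumptions D f0 f B22.
Variable U0 : 'cV[R]_(r + m).
Hypothesis DU0 : D U0.

Let df u : D u -> differentiable f u.
Proof. by have [h _] := f_smooth sys 1; exact: h. Qed.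

Lemma is_derive_flux_comp (W : R -> 'cV[R]_(r + m)) dW (x : R) : D (W x) ->
  is_derive x 1 W dW -> is_derive x 1 (fun y => f (W y)) (Jf f (W x) *m dW).
Proof. by move=> Dx hW; rewrite Jf_mul; [exact: is_derive_comp_mx (df Dx)|exact: df]. Qed.

(** Differentiating the constraint [f_I (W) = f_I (U0)] supplies the missing equation for [W_I'], so
    that [W'] is determined by [profile_dir_unique]. *)
Lemma profile_ode_field C (W : R -> 'cV[R]_(r + m)) : profile_ode D f B22 U0 C W ->
  {within `[0, 1], continuous (fun x => col_mx (W x) C)} /\
  forall x : R, 0 < x < 1 -> is_derive x 1 (fun x => col_mx (W x) C)
    (profile_field f B22 U0 (col_mx (W x) C)).
Proof.
move=> [DW cW W0 E]; split.
  by apply: within_col_mx; [exact: C1_01_within|exact: within_cst].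
move=> x x01; have x01' : 0 <= x <= 1 by case/andP: x01 => *; rewrite !ltW.
have Ix : I01 x by exact/I01P.
have hW := C1_01_is_derive cW x01.
apply: is_derive_eq (is_derive_col_mx hW (is_derive_cst C x 1)) _.
rewrite /profile_field col_mxKu col_mxKd; congr col_mx.
have [E1 _] := E x Ix.
rewrite [LHS](profile_dir_unique sys (DW x Ix)).
  rewrite /profile_src -E1; congr (_ *m (_ *m _)).
  have [d2 _] := is_derive01_sub_mx (derivable01P (cW.1 x Ix)).
  by have [_ ->] := is_derive01_unique x01' d2.
have h1 := is_derive_usubmx (is_derive_flux_comp (DW x Ix) hW).
have h2 : is_derive01 (fun y => usubmx (f (W y))) x 0.
  apply: (@is_derive01_ext _ _ (cst (usubmx (f U0)))) => //.
    by move=> y /I01P/E[].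
  by apply: is_derive_derive01; exact: is_derive_cst.
have [_ <-] := is_derive01_unique x01' (is_derive_derive01 h1).
by have [_ <-] := is_derive01_unique x01' h2.
Qed.

(** Conversely, the explicit field is tangent to the level sets of [f_I], so the constraint
    propagates from 0, and the parameter component stays equal to [C]. *)
Lemma profile_field_ode C (V : R -> 'cV[R]_(r + m + m)) : V 0 = col_mx U0 C ->
  (forall x : R, 0 <= x <= 1 -> D (usubmx (V x)) /\
     is_derive x 1 V (profile_field f B22 U0 (V x))) ->
  {within `[0, 1], continuous (fun x => profile_field f B22 U0 (V x))} ->
  profile_ode D f B22 U0 C (fun x => usubmx (V x)) /\
  forall x : R, 0 <= x <= 1 ->
    derive01 (fun x => usubmx (V x)) x = usubmx (profile_field f B22 U0 (V x)).
Proof.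
move=> V0 hV cF.
have cV : {within `[0, 1], continuous V}.
  by apply: derive_continuous_within => x x01; have [_ h] := hV x x01; exact: h.
have oc (x : R) : 0 < x < 1 -> 0 <= x <= 1 by move=> /andP[? ?]; rewrite !ltW.
have zero_in : 0 <= (0 : R) <= 1 by rewrite lexx ler01.
set W := fun x => usubmx (V x).
have dW (x : R) : 0 <= x <= 1 ->
    is_derive x 1 W (profile_dir f B22 (W x) *m profile_src f B22 U0 (W x) (dsubmx (V x))).
  move=> x01; have [_ h] := hV x x01.
  by have := is_derive_usubmx h; rewrite /profile_field col_mxKu.
have V2 (x : R) : 0 <= x <= 1 -> dsubmx (V x) = C.
  move=> x01; have hd (z : R) : 0 < z < 1 -> is_derive z 1 (fun x => dsubmx (V x)) 0.
    move=> z01; have [_ h] := hV z (oc z z01).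
    by have := is_derive_dsubmx h; rewrite /profile_field col_mxKd.
  by have -> := is_derive_const (within_dsubmx cV) hd x01; rewrite V0 col_mxKd.
have DWx (x : R) : 0 <= x <= 1 -> derivable01 W x /\ derive01 W x =
    profile_dir f B22 (W x) *m profile_src f B22 U0 (W x) C.
  move=> x01; have := dW x x01; rewrite V2// => h.
  exact: is_derive01_unique x01 (is_derive_derive01 h).
have DWf (x : R) : 0 <= x <= 1 -> derive01 W x = usubmx (profile_field f B22 U0 (V x)).
  by move=> x01; have [_ ->] := DWx x x01; rewrite /profile_field col_mxKu V2.
split; last exact: DWf.
split.
- by move=> x /I01P x01; have [] := hV x x01.
- split; first by move=> x /I01P x01; have [] := DWx x x01.
  by apply: within_ext (within_usubmx cF) => x x01; rewrite DWf.
- by rewrite /W V0 col_mxKu.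
- move=> x /I01P x01; have [Dx _] := hV x x01.
  have [hd eD] := DWx x x01.
  split.
    have [d2 _] := is_derive01_sub_mx (derivable01P hd).
    have [_ ->] := is_derive01_unique x01 d2.
    by rewrite eD; have [-> _] := profile_dirP sys (profile_src f B22 U0 (W x) C) Dx.
  have -> : usubmx (f U0) = usubmx (f (W 0)) by rewrite /W V0 col_mxKu.
  apply: (@is_derive_const _ _ _ (fun x => usubmx (f (W x)))) => //.
    apply: within_usubmx; apply: (within_comp (g := f) (within_usubmx cV)) => z.
    rewrite /= in_itv/= => z01; apply: differentiable_continuous.
    by apply: df; have [] := hV z z01.
  move=> z z01; have [Dz _] := hV z (oc z z01).
  have h := is_derive_usubmx (is_derive_flux_comp Dz (dW z (oc z z01))).
  have [_ e0] := profile_dirP sys (profile_src f B22 U0 (W z) (dsubmx (V z))) Dz.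
  exact: is_derive_eq h e0.
Qed.

(** One integration: [f (W)] minus the flux is constant. Evaluating it at 0, where the flux is
    [B22 U0] times the slope, identifies the parameter. *)
Lemma steady_profile U1II (W : R -> 'cV[R]_(r + m)) : steady_solution D f B22 U0 U1II W ->
  profile_ode D f B22 U0 (derive01 (fun x => dsubmx (W x)) 0) W.
Proof.
move=> [DW cW E W0 W1].
have cWw := C1_01_within cW.
have oc (x : R) : 0 < x < 1 -> 0 <= x <= 1 by move=> /andP[? ?]; rewrite !ltW.
have dWd (x : R) : 0 <= x <= 1 -> derive01 (fun y => dsubmx (W y)) x = dsubmx (derive01 W x).
  move=> x01; have [d2 _] := is_derive01_sub_mx (derivable01P (cW.1 x ((I01P x).2 x01))).
  by have [_ ->] := is_derive01_unique x01 d2.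
set flux := fun x => Bmx B22 (W x) *m derive01 W x in E.
have cflux : {within `[0, 1], continuous flux}.
  apply: within_mulmx; last by case: cW.
  apply: (within_comp (g := Bmx B22) cWw) => x; rewrite /= in_itv/= => /I01P Ix.
  by apply: differentiable_continuous; have [h _] := B_smooth sys 1; exact/h/DW.
have cst01 (x : R) : 0 <= x <= 1 -> f (W x) - flux x = f (W 0) - flux 0.
  apply: (@is_derive_const _ _ _ (fun x => f (W x) - flux x)).
    apply: within_sub cflux; apply: (within_comp (g := f) cWw) => z.
    by rewrite /= in_itv/= => /I01P Iz; apply: differentiable_continuous; exact/df/DW.
  move=> z z01; have [dfl e] := E z z01.
  have h1 := is_derive_flux_comp (DW z ((I01P z).2 (oc z z01))) (C1_01_is_derive cW z01).
  have h2 := is_derive01_derive z01 (derivable01P dfl).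
  apply: is_derive_eq (is_derive_sub h1 h2) _.
  rewrite -e; have [_ ->] := is_derive01_unique (oc z z01) (is_derive_derive01 h1).
  by rewrite subrr.
have zero_in : 0 <= (0 : R) <= 1 by rewrite lexx ler01.
split=> // x /I01P x01.
have /eqP := cst01 x x01; rewrite subr_eq => /eqP ->; rewrite W0 dWd// (dWd 0)//.
have eu (a b c : 'cV[R]_(r + m)) : usubmx (a - b + c) = usubmx a - usubmx b + usubmx c.
  by apply/matrixP => i j; rewrite !mxE.
have ed (a b c : 'cV[R]_(r + m)) : dsubmx (a - b + c) = dsubmx a - dsubmx b + dsubmx c.
  by apply/matrixP => i j; rewrite !mxE.
have fu y : usubmx (flux y) = 0 := usubmx_Bmx_mul _ _ _.
have fd y : dsubmx (flux y) = B22 (W y) *m dsubmx (derive01 W y) := dsubmx_Bmx_mul _ _ _.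
rewrite eu ed !fu !fd W0 subr0 addr0; split; last by [].
move: (B22 (W x) *m _) (B22 U0 *m _) (dsubmx (f U0)) => P Q S.
by apply/matrixP => i j; rewrite !mxE; ring.
Qed.

(** Along a profile the flux equals [f (W)] up to a constant, so it inherits differentiability from
    [W]. *)
Lemma profile_steady C U1II (W : R -> 'cV[R]_(r + m)) : profile_ode D f B22 U0 C W ->
  dsubmx (W 1) = U1II -> steady_solution D f B22 U0 U1II W.
Proof.
move=> [DW cW W0 E] W1; split=> // x x01.
have x01' : 0 <= x <= 1 by case/andP: x01 => *; rewrite !ltW.
have dWd (y : R) : 0 <= y <= 1 -> derive01 (fun y => dsubmx (W y)) y = dsubmx (derive01 W y).
  move=> y01; have [d2 _] := is_derive01_sub_mx (derivable01P (cW.1 y ((I01P y).2 y01))).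
  by have [_ ->] := is_derive01_unique y01 d2.
have h1 := is_derive_flux_comp (DW x ((I01P x).2 x01')) (C1_01_is_derive cW x01).
set c := f U0 - col_mx 0 (B22 U0 *m C).
have h2 : is_derive01 (fun y => Bmx B22 (W y) *m derive01 W y) x
    (Jf f (W x) *m derive01 W x).
  apply: (@is_derive01_ext _ _ (fun y => f (W y) - c)) => //.
    move=> y y01; have [E1 E2] := E y ((I01P y).2 y01).
    rewrite -[RHS]vsubmxK usubmx_Bmx_mul dsubmx_Bmx_mul -dWd// E1 -[LHS]vsubmxK /c.
    have eu (a b d : 'cV[R]_(r + m)) : usubmx (a - (b - d)) = usubmx a - usubmx b + usubmx d.
      by apply/matrixP => i j; rewrite !mxE opprB addrA addrAC.
    have ed (a b d : 'cV[R]_(r + m)) : dsubmx (a - (b - d)) = dsubmx a - dsubmx b + dsubmx d.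
      by apply/matrixP => i j; rewrite !mxE opprB addrA addrAC.
    by rewrite eu ed col_mxKu col_mxKd E2 addr0 subrr.
  apply: is_derive_derive01; apply: is_derive_eq (is_derive_sub h1 (is_derive_cst c x 1)) _.
  by rewrite subr0.
have [d2 e2] := is_derive01_unique x01' h2; split; first exact: d2.
rewrite e2.
by have [_ ->] := is_derive01_unique x01' (is_derive_derive01 h1).
Qed.

End profile_equations.

(** * A quantitative inverse function theorem *)

Section local_inverse.
Context {R : realType}.

Lemma quadratic_differentiable p q (P : 'cV[R]_p -> 'cV[R]_q) (c : 'cV[R]_p) (Q : 'M[R]_(q, p))
    (rad M : R) : 0 < rad -> 0 <= M ->
  (forall h : 'cV[R]_p, `|h| <= rad -> `|P (c + h) - P c - Q *m h| <= M * `|h| ^+ 2) ->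
  differentiable P c /\ forall h, 'd P c h = Q *m h.
Proof.
move=> rad0 M0 H.
have cQ : continuous (mulmx Q : 'cV[R]_p -> 'cV[R]_q).
  move=> x; apply: continuous_mulmx; first exact: cst_continuous.
  exact: cvg_id.
have E : P \o shift c = cst (P c) + (mulmx Q : 'cV[R]_p -> 'cV[R]_q) +o_ 0 id.
  apply/eqaddoP => e e0.
  suff : \forall h \near (0 : 'cV[R]_p), `|P (h + c) - (P c + Q *m h)| <= e * `|h| by exact.
  apply/nbhs_norm0P; exists (Num.min rad (e / (M + 1))).
    by rewrite /= lt_min rad0 divr_gt0// ltr_wpDl.
  move=> h; rewrite /= lt_min => /andP[hr he].
  rewrite opprD addrA (addrC h) (le_trans (H h (ltW hr)))// expr2 mulrA ler_wpM2r//.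
  move: he; rewrite ltr_pdivlMr ?ltr_wpDl// => he; have := normr_ge0 h; nra.
have D := diff_unique cQ E.
split; last by move=> h; rewrite D.
by apply/diff_locallyP; rewrite D.
Qed.

Variables (m : nat) (P : 'cV[R]_m -> 'cV[R]_m) (Q : 'cV[R]_m -> 'M[R]_m) (rad M : R).
Hypotheses (rad0 : 0 < rad) (M0 : 0 <= M).
(** The linearisation point [cs] is free: [cs = 0] gives the contraction, [cs = c'] the derivative
    at [c'], and comparing the two carries invertibility from [Q 0] to nearby points. *)
Hypothesis P_est : forall c c' cs : 'cV[R]_m, `|c| <= rad -> `|c'| <= rad -> `|cs| <= rad ->
  `|P c - P c' - Q cs *m (c - c')| <= M * (`|c - c'| * (`|c - c'| + `|c' - cs|)).
Hypothesis Q0 : Q 0 \in unitmx.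

(* One Newton step from the linearisation at [0] is a contraction near [0]. *)
Lemma local_inverse (e0 : R) : 0 < e0 -> exists2 e : R, 0 < e <= e0 &
  [/\ e < rad, forall c c' : 'cV[R]_m, `|c| <= e -> `|c'| <= e -> P c = P c' -> c = c',
      forall c : 'cV[R]_m, `|c| <= e -> Q c \in unitmx &
      forall e' : R, 0 < e' <= e -> exists2 d : R, 0 < d & forall t : 'cV[R]_m,
        `|t - P 0| <= d -> exists2 c : 'cV[R]_m, `|c| <= e' & P c = t].
Proof.
move=> e00; set N := invmx (Q 0).
pose k : R := m%:R * `|N|; have k0 : 0 <= k by rewrite mulr_ge0.
have Nle (h : 'cV[R]_m) : `|N *m h| <= k * `|h| by exact: mulmx_norm_le.
(* The bound [rad / 2] keeps [c + d] with [|c|, |d| <= e] in the domain of the estimate; the last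
   one makes [k * (M * (4 * e)) <= 1 / 2], the contraction factor of the Newton map. *)
pose e := Num.min e0 (Num.min (rad / 2) (8 * (k * M + 1))^-1).
have kM0 : 0 <= k * M by rewrite mulr_ge0.
have e_gt0 : 0 < e by rewrite !lt_min e00 divr_gt0// invr_gt0 mulr_gt0// ltr_wpDl.
have e1 : e <= e0 by rewrite ge_min lexx.
have e2 : e <= rad / 2 by rewrite !ge_min lexx !orbT.
have e3 : k * (M * (4 * e)) <= 1 / 2.
  have : e <= (8 * (k * M + 1))^-1 by rewrite !ge_min lexx !orbT.
  rewrite -[X in _ <= X]mul1r ler_pdivlMr ?mulr_gt0 ?ltr_wpDl// => h.
  have := mulr_ge0 (ltW e_gt0) kM0; lra.
have er : e < rad by rewrite (le_lt_trans e2)//; lra.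
have ler (c : 'cV[R]_m) : `|c| <= e -> `|c| <= rad by move=> h; rewrite (le_trans h) ?ltW.
have n0 : `|0 : 'cV[R]_m| <= rad by rewrite normr0 ltW.
have half (x : R) : 0 <= x -> x <= 1 / 2 * x -> x = 0.
  by move=> x0 x1; apply/eqP; rewrite eq_le x0 andbT; lra.
have dist (c c' : 'cV[R]_m) : `|c| <= e -> `|c'| <= e ->
    `|N *m (P c - P c') - (c - c')| <= 1 / 2 * `|c - c'|.
  move=> hc hc'; have := P_est (ler _ hc) (ler _ hc') n0; rewrite subr0 => h.
  rewrite -[X in _ - X](mulKmx Q0) -mulmxBr (le_trans (Nle _))//.
  have d2 : `|c - c'| <= e + e by rewrite (le_trans (ler_normB _ _))// lerD.
  have nd := normr_ge0 (c - c').
  have h2 : M * (`|c - c'| * (`|c - c'| + `|c'|)) <= M * (4 * e) * `|c - c'|.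
    by rewrite -mulrA ler_wpM2l// mulrC ler_wpM2r//; lra.
  by rewrite (le_trans (ler_wpM2l k0 (le_trans h h2)))// mulrA ler_wpM2r.
exists e; first by rewrite e_gt0.
split=> //.
- move=> c c' hc hc' E; have := dist c c' hc hc'; rewrite E subrr mulmx0 sub0r normrN.
  by move=> /(half _ (normr_ge0 _))/normr0_eq0/subr0_eq.
(* A kernel vector is scaled to [d] of norm [e]. Linearising [P (c + d) - P c] at [c] and at 0
   bounds [Q 0 *m d] by [3 * M * e ^+ 2]; inverting [Q 0] gives [|d| <= e / 2], a contradiction. *)
- move=> c hc; apply: unitmx_of_ker => h Qh; apply/eqP; apply: contraT => hn0.
  have nh : 0 < `|h| by rewrite normr_gt0.
  pose d := (e / `|h|) *: h.
  have nd : `|d| = e by rewrite normrZ ger0_norm ?divfK ?gt_eqF// divr_ge0// ltW.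
  have Qd : Q c *m d = 0 by rewrite -scalemxAr Qh scaler0.
  have cd : `|c + d| <= rad by rewrite (le_trans (ler_normD _ _))// nd; lra.
  have cdc : c + d - c = d by rewrite addrAC subrr add0r.
  have := P_est cd (ler _ hc) (ler _ hc); rewrite cdc Qd subr0 subrr normr0 addr0.
  have := P_est cd (ler _ hc) n0; rewrite cdc subr0 nd => h1 h2.
  have h3 : `|Q 0 *m d| <= M * (4 * e) * e.
    rewrite -[Q 0 *m d](subrK (P (c + d) - P c)) (le_trans (ler_normD _ _))// distrC.
    have : M * (e * (e + `|c|)) <= M * (e * (e + e)) by apply: (ler_wpM2l M0); apply: (ler_wpM2l (ltW e_gt0)); rewrite lerD2l.
    by have := mulr_ge0 M0 (mulr_ge0 (ltW e_gt0) (ltW e_gt0)); lra.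
  have : `|d| <= 1 / 2 * e.
    rewrite -(mulKmx Q0 d) (le_trans (Nle _))// (le_trans (ler_wpM2l k0 h3))// mulrA.
    by rewrite ler_wpM2r// ltW.
  by rewrite nd => /(half _ (ltW e_gt0)) e00'; rewrite e00' ltxx in e_gt0.
move=> e' /andP[e'0 e'e].
(* With this radius [T] moves 0 by at most [e' / 2]; the contraction factor [1 / 2] contributes the
   other half, so [T] maps the ball of radius [e'] into itself. *)
exists (e' / 2 / (k + 1)) => [|t ht]; first by rewrite !divr_gt0// ltr_wpDl.
pose T (c : 'cV[R]_m) := c - N *m (P c - t).
pose U : set 'cV[R]_m := [set c | `|c| <= e'].
have TB (c c' : 'cV[R]_m) : U c -> U c' -> `|T c - T c'| <= 1 / 2 * `|c - c'|.
  move=> hc hc'; have := dist c c' (le_trans hc e'e) (le_trans hc' e'e).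
  have -> : N *m (P c - P c') = N *m (P c - t) - N *m (P c' - t).
    by rewrite -mulmxBr opprB addrA subrK.
  rewrite /T -normrN; move: (N *m (P c - t)) (N *m (P c' - t)) => x y.
  have -> : c - x - (c' - y) = - (x - y - (c - c')).
    by apply/matrixP => i j; rewrite !mxE; ring.
  exact.
have T0 : `|T 0| <= e' / 2.
  rewrite /T sub0r normrN (le_trans (Nle _))// distrC (le_trans (ler_wpM2l k0 ht))//.
  rewrite mulrA ler_pdivrMr ?ltr_wpDl// mulrDr mulr1 mulrC lerDl.
  by rewrite divr_ge0// ltW.
have TU : set_fun U U T.
  move=> c hc; have U0 : U 0 by rewrite /U/= normr0 ltW.
  have := TB c 0 hc U0; rewrite subr0 => h; rewrite /U/=.
  rewrite -[T c](subrK (T 0)) (le_trans (ler_normD _ _))//.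
  by have : 1 / 2 * `|c| <= 1 / 2 * e' by [rewrite ler_wpM2l|]; lra.
have ctr : is_contraction (mkfun TU).
  have h2 : (0 : R) <= 1 / 2 by [].
  exists (NngNum h2); split; first by rewrite /=; lra.
  by move=> [c c'] [/= hc hc']; exact: TB.
have clU : closed U.
  rewrite (_ : U = closed_ball (0 : 'cV[R]_m) e'); first exact: closed_ball_closed.
  by rewrite closed_ballE//; apply/seteqP; split=> c; rewrite /U /closed_ball_/= sub0r normrN.
have neU : U !=set0 by exists 0; rewrite /U/= normr0 ltW.
have [c Uc /esym cT] := banach_fixed_point ctr clU neU.
exists c => //; move: cT; rewrite /= /T => /eqP; rewrite subr_eq addrC -subr_eq subrr eq_sym.
move=> /eqP/(congr1 (mulmx (Q 0))); rewrite mulKVmx// mulmx0 => /eqP.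
by rewrite subr_eq0 => /eqP.
Qed.

End local_inverse.

(** * Nondegeneracy and the local solution theory *)

Section shooting.
Context {R : realType}.

Lemma enorm_ge (k : nat) (v : 'cV[R]_k) : `|v| <= enorm v.
Proof.
apply: mx_norm_le => [|i j]; first exact: sqrtr_ge0.
rewrite ord1 -sqrtr_sqr ler_wsqrtr//.
by apply: (le_sum_term (F := fun i => v i 0 ^+ 2)) => l; exact: sqr_ge0.
Qed.

(** The factor [k.+1] is not sharp, but it is positive in dimension zero as well, so it can be
    divided by. *)
Lemma enorm_le (k : nat) (v : 'cV[R]_k) : enorm v <= k.+1%:R * `|v|.
Proof.
rewrite -[leRHS]ger0_norm ?mulr_ge0// -sqrtr_sqr ler_wsqrtr//.
apply: (@le_trans _ _ (\sum_(i < k) `|v| ^+ 2)).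
  apply: ler_sum => i _; rewrite -[v i 0 ^+ 2]real_normK ?num_real//.
  by rewrite lerXn2r ?nnegrE// mx_entry_le.
rewrite sumr_const card_ord -[leLHS]mulr_natl exprMn ler_wpM2r ?sqr_ge0//.
by rewrite -natrX ler_nat (leq_trans (leqnSn k))// leq_pmulr.
Qed.

Variables (r m : nat) (D : set 'cV[R]_(r + m)) (f0 f : 'cV[R]_(r + m) -> 'cV[R]_(r + m)).
Variables (B22 : 'cV[R]_(r + m) -> 'M[R]_m).
Hypothesis oD : open D.
Hypothesis sys : structural_assumptions D f0 f B22.
Variable U0 : 'cV[R]_(r + m).
Hypothesis DU0 : D U0.

Lemma dJf0 u : D u -> dJf f 0 u = 0.
Proof.
move=> Du; apply/matrixP => i j; rewrite !mxE.
have dd : differentiable ('D_(delta_mx j 0) f) u.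
  by have [_ h] := f_smooth sys 2; have [h' _] := h (delta_mx j 0); exact: h'.
rewrite (derive_partials 0 dd) big1 ?mxE// => k _.
by rewrite mxE scale0r.
Qed.

Lemma profile_ode_slope C (W : R -> 'cV[R]_(r + m)) : profile_ode D f B22 U0 C W ->
  derive01 (fun x => dsubmx (W x)) 0 = C.
Proof.
move=> [_ _ W0 E]; have I0 : I01 (0 : R) by apply/I01P; rewrite lexx ler01.
have [] := E 0 I0; rewrite W0 subrr add0r => h _.
by rewrite -[LHS](mulKmx (B22_unit sys DU0)) h mulKmx// (B22_unit sys DU0).
Qed.

(* A vector in the kernel would produce a nontrivial solution of the linearised steady problem
   at the constant state [U0]. *)
Lemma constant_state_nondegenerate (Z : R -> 'M[R]_(r + m + m)) : Z 0 = 1%:M ->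
  (forall x : R, 0 <= x <= 1 -> is_derive x 1 Z
    (col_mx (profile_dir f B22 U0 *m row_mx (dsubmx (Jf f U0)) (B22 U0)) 0 *m Z x)) ->
  dsubmx (ursubmx (Z 1)) \in unitmx.
Proof.
move=> Z0 dZ; apply: unitmx_of_ker => h Qh.
have oc (x : R) : 0 < x < 1 -> 0 <= x <= 1 by move=> /andP[? ?]; rewrite !ltW.
have zero_in : 0 <= (0 : R) <= 1 by rewrite lexx ler01.
have one_in : 0 <= (1 : R) <= 1 by rewrite lexx ler01.
pose z x := Z x *m col_mx 0 h.
have dz (x : R) : 0 <= x <= 1 -> is_derive x 1 z
    (col_mx (profile_dir f B22 U0 *m row_mx (dsubmx (Jf f U0)) (B22 U0)) 0 *m z x).
  move=> x01; apply: is_derive_eq (is_derive_mulmx (dZ x x01) (is_derive_cst (col_mx 0 h) x 1)) _.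
  by rewrite mulmx0 addr0 /z mulmxA.
have cz := derive_continuous_within dz.
have z0 : z 0 = col_mx 0 h by rewrite /z Z0 mul1mx.
have z2 (x : R) : 0 <= x <= 1 -> dsubmx (z x) = h.
  move=> x01; have hd (y : R) : 0 < y < 1 -> is_derive y 1 (fun x => dsubmx (z x)) 0.
    by move=> y01; have := is_derive_dsubmx (dz y (oc y y01)); rewrite mul_col_mx col_mxKd mul0mx.
  by have -> := is_derive_const (within_dsubmx cz) hd x01; rewrite z0 col_mxKd.
pose X x := usubmx (z x); pose s x := dsubmx (Jf f U0) *m X x + B22 U0 *m h.
pose dX x := profile_dir f B22 U0 *m s x.
have hX (x : R) : 0 <= x <= 1 -> is_derive x 1 X (dX x).
  move=> x01; apply: is_derive_eq (is_derive_usubmx (dz x x01)) _.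
  rewrite mul_col_mx col_mxKu -mulmxA /dX; congr (_ *m _).
  by rewrite -{1}[z x]vsubmxK mul_row_col z2.
have ds (x : R) : 0 <= x <= 1 -> is_derive x 1 s (dsubmx (Jf f U0) *m dX x).
  move=> x01; have := is_derive_mulmx (is_derive_cst (dsubmx (Jf f U0)) x 1) (hX x x01).
  move=> /is_derive_add/(_ (is_derive_cst (B22 U0 *m h) x 1)) hs.
  by apply: is_derive_eq hs _; rewrite mul0mx add0r addr0.
(* Used at the constant profile with spectral parameter 0 and vanishing imaginary part: [X] is the
   variation of the state and [s] its flux. *)
have [rho rho0 [_ core]] := core_rigidity oD sys DU0.
have X0 : X 0 = 0 by rewrite /X z0 col_mxKu.
have X1 : dsubmx (X 1) = 0.
  rewrite /X /z -[Z 1]submxK mul_block_col mulmx0 add0r col_mxKu.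
  by rewrite -{1}[ursubmx _]vsubmxK mul_col_mx col_mxKd.
have Wsmall (x : R) : 0 <= x <= 1 -> `|U0 - U0| <= rho /\ `|0 : 'cV[R]_(r + m)| <= rho.
  by move=> _; rewrite subrr !normr0; split; exact: ltW.
have Xzero (x : R) : 0 <= x <= 1 -> X x = 0.
  move=> x01.
  have wU : {within `[0, 1], continuous (fun _ : R => U0)} by exact: within_cst.
  have wn : {within `[0, 1], continuous (fun _ : R => 0 : 'cV[R]_(r + m))} by exact: within_cst.
  have wm : {within `[0, 1], continuous (fun _ : R => 0 : 'cV[R]_m)} by exact: within_cst.
  have [] := core (fun=> U0) (fun=> 0) Wsmall wU (fun x _ => is_derive_cst U0 x 1) 0 0
    X (fun=> 0) dX (fun=> 0) s (fun=> 0) (fun x => dsubmx (Jf f U0) *m dX x) (fun=> 0) (lexx 0)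
    (derive_continuous_within hX) wn (derive_continuous_within ds) wm _ _ X0 (erefl _) X1 _ x x01.
  - move=> y /oc y01; split; [exact: hX|exact: ds| |].
      have [h1 _] := profile_dirP sys (s y) DU0.
      by rewrite mulmx0 linear0 addr0 h1.
    have [_ h2] := profile_dirP sys (s y) DU0.
    rewrite !scale0r subrr add0r dJf0// mul0mx add0r -[LHS]vsubmxK h2.
    by rewrite -[Jf f U0 in LHS]vsubmxK mul_col_mx col_mxKd.
  - move=> y _; split; [exact: is_derive_cst|exact: is_derive_cst| |].
      by rewrite mulmx0 linear0 mulmx0 addr0.
    by rewrite !scale0r !mulmx0 !addr0 col_mx0.
  - exact: linear0.
  - by [].
(* [X] vanishes identically, so its derivative vanishes at any interior point; there the equation
   reduces to [B22 U0 *m h = 0]. *)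
have half_in : 0 <= (1 / 2 : R) <= 1 by apply/andP; split; lra.
have dX0 : dX (1 / 2) = 0.
  have [_ <-] := is_derive01_unique half_in (is_derive_derive01 (hX _ half_in)).
  have h0 : is_derive01 X (1 / 2) 0.
    apply: (@is_derive01_ext _ _ (cst 0)) half_in _ _ => [y y01|]; first by rewrite Xzero.
    by apply: is_derive_derive01; exact: is_derive_cst.
  by have [_ ->] := is_derive01_unique half_in h0.
have [h1 _] := profile_dirP sys (s (1 / 2)) DU0.
move: h1; rewrite -/(dX (1 / 2)) dX0 linear0 mulmx0 /s Xzero// mulmx0 add0r => /esym Bh.
by rewrite -[h](mulKmx (B22_unit sys DU0)) Bh mulmx0.
Qed.

End shooting.

(** * The shooting map and its linearisation *)

Section profile_flow_section.
Context {R : realType}.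
Variables (r m : nat) (D : set 'cV[R]_(r + m)) (f0 f : 'cV[R]_(r + m) -> 'cV[R]_(r + m)).
Variables (B22 : 'cV[R]_(r + m) -> 'M[R]_m).
Hypothesis oD : open D.
Hypothesis sys : structural_assumptions D f0 f B22.
Variable U0 : 'cV[R]_(r + m).
Hypothesis DU0 : D U0.

(** The flow is restricted to initial states [(U0, C)], which differ only in the parameter. [Q C] is
    therefore the block of the linearised flow that maps a variation of the parameter to the [II]
    component at 1. *)
Lemma profile_flow : exists (rad M : R) (Wf : 'cV[R]_m -> R -> 'cV[R]_(r + m))
    (Q : 'cV[R]_m -> 'M[R]_m), [/\ 0 < rad /\ 0 <= M,
  forall C : 'cV[R]_m, `|C| <= rad -> profile_ode D f B22 U0 C (Wf C) /\
    forall x : R, 0 <= x <= 1 -> `|Wf C x - U0| <= M * `|C| /\ `|derive01 (Wf C) x| <= M * `|C|,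
  forall (C : 'cV[R]_m) W, `|C| <= rad -> profile_ode D f B22 U0 C W ->
    forall x : R, 0 <= x <= 1 -> W x = Wf C x,
  forall C C' Cs : 'cV[R]_m, `|C| <= rad -> `|C'| <= rad -> `|Cs| <= rad ->
    `|dsubmx (Wf C 1) - dsubmx (Wf C' 1) - Q Cs *m (C - C')| <=
      M * (`|C - C'| * (`|C - C'| + `|C' - Cs|)) &
  Q 0 \in unitmx].
Proof.
have [rho [K [DH [rho0 K0 hD hL DH0]]]] := profile_field_c11 oD sys DU0.
set y0 : 'cV[R]_(r + m + m) := col_mx U0 0 in hD hL DH0.
pose H := profile_field f B22 U0.
have DH_le (a : 'cV[R]_(r + m + m)) : `|a - y0| <= rho -> `|DH a| <= K by move=> /hD[].
have DH_lip (a b : 'cV[R]_(r + m + m)) : `|a - y0| <= rho -> `|b - y0| <= rho ->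
  `|DH a - DH b| <= K * `|a - b| by move=> ha /(hL _ _ ha)[].
have H_taylor (a b : 'cV[R]_(r + m + m)) : `|a - y0| <= rho -> `|b - y0| <= rho ->
  `|H a - H b - DH b *m (a - b)| <= K * `|a - b| ^+ 2 by move=> ha /(hL _ _ ha)[].
have H0 : H y0 = 0 by exact: profile_field0.
have [rad [M [Y [rad0 M0 hY hU hZ]]]] :=
  flow_near_equilibrium rho0 K0 H0 DH_le DH_lip H_taylor.
have dC (C C' : 'cV[R]_m) : col_mx U0 C - col_mx U0 C' = col_mx 0 (C - C').
  by rewrite opp_col_mx add_col_mx subrr.
have nC (C : 'cV[R]_m) : `|col_mx 0 C : 'cV[R]_(r + m + m)| <= `|C|.
  apply: mx_norm_le => // i j; case: (split_ordP i) => k ->.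
    by rewrite col_mxEu mxE normr0.
  by rewrite col_mxEd mx_entry_le.
have yC (C : 'cV[R]_m) : `|col_mx U0 C - y0| <= `|C| by rewrite dC subr0.
have one_in : 0 <= (1 : R) <= 1 by rewrite lexx ler01.
have zero_in : 0 <= (0 : R) <= 1 by rewrite lexx ler01.
have rad_in (C : 'cV[R]_m) : `|C| <= rad -> `|col_mx U0 C - y0| <= rad by exact: le_trans (yC C).
have /choice[Z hZf] : forall C : 'cV[R]_m, exists Z : R -> 'M[R]_(r + m + m), `|C| <= rad ->
    [/\ Z 0 = 1%:M, forall x : R, 0 <= x <= 1 -> is_derive x 1 Z (DH (Y (col_mx U0 C) x) *m Z x) &
      forall y y' : 'cV[R]_(r + m + m), `|y - y0| <= rad -> `|y' - y0| <= rad ->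
        `|Y y 1 - Y y' 1 - Z 1 *m (y - y')| <=
          M * (`|y - y'| * (`|y - y'| + `|y' - col_mx U0 C|))].
  move=> C; have [hC|hC] := boolP (`|C| <= rad); last by exists (fun=> 0).
  by have [Z h] := hZ _ (rad_in C hC); exists Z.
have KM0 : 0 <= K * M by rewrite mulr_ge0.
(* [M] bounds the distance to [U0]; [K * M] bounds the slope, because the field vanishes at the
   equilibrium and is [K]-Lipschitz. *)
exists rad, (M + K * M), (fun C x => usubmx (Y (col_mx U0 C) x)),
  (fun C => dsubmx (ursubmx (Z C 1))); split.
- by split; rewrite ?addr_ge0.
- move=> C hC; have [Y0 hYx] := hY _ (rad_in C hC).
  have cY : {within `[0, 1], continuous (Y (col_mx U0 C))}.
    by apply: derive_continuous_within => x x01; have [h _ _] := hYx x x01; exact: h.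
  have inB (x : R) : 0 <= x <= 1 -> `|Y (col_mx U0 C) x - y0| <= rho by move=> /hYx[].
  have cF : {within `[0, 1], continuous (fun x => H (Y (col_mx U0 C) x))}.
    apply/within_continuousP => x x01 e e0.
    have Kp : 0 < K + 1 by rewrite ltr_wpDl.
    have e1 : 0 < e / (K + 1) by rewrite divr_gt0.
    have [d d0 hd] := (within_continuousP _ _).1 cY x x01 _ e1; exists d => // y y01 yx.
    have x01' : 0 <= x <= 1 by move: x01; rewrite /= in_itv.
    have y01' : 0 <= y <= 1 by move: y01; rewrite /= in_itv.
    have [_ _ h] := hL _ _ (inB y y01') (inB x x01'); apply: le_lt_trans h _.
    have := hd y y01 yx; rewrite ltr_pdivlMr//; apply: le_lt_trans.
    by rewrite mulrC ler_wpM2l// lerDl.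
  have hV (x : R) : 0 <= x <= 1 -> D (usubmx (Y (col_mx U0 C) x)) /\
      is_derive x 1 (Y (col_mx U0 C)) (profile_field f B22 U0 (Y (col_mx U0 C) x)).
    by move=> x01; have [h1 _ h3] := hYx x x01; split; [have [] := hD _ h3|exact: h1].
  have [ode dW] := profile_field_ode sys Y0 hV cF; split; first exact: ode.
  move=> x x01; have [_ h2 h3] := hYx x x01.
  have h4 : `|Y (col_mx U0 C) x - y0| <= M * `|C|.
    by apply: le_trans h2 _; apply: ler_wpM2l.
  split.
    have <- : usubmx (Y (col_mx U0 C) x - y0) = usubmx (Y (col_mx U0 C) x) - U0.
      by rewrite linearB /= col_mxKu.
    apply: le_trans (usubmx_norm_le _) _; apply: le_trans h4 _.
    by apply: ler_wpM2r => //; rewrite lerDl.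
  rewrite dW//; apply: le_trans (usubmx_norm_le _) _.
  have y00 : `|y0 - y0| <= rho by rewrite subrr normr0 ltW.
  have [_ _] := hL _ _ h3 y00; rewrite -/(H y0) H0 subr0 => h5; apply: le_trans h5 _.
  apply: (@le_trans _ _ (K * (M * `|C|))); first exact: ler_wpM2l.
  by rewrite mulrA; apply: ler_wpM2r => //; rewrite lerDr.
- move=> C W hC ode x x01; have [cV dV] := profile_ode_field sys ode.
  have V0 : col_mx (W 0) C = col_mx U0 C by have [_ _ ->] := ode.
  by rewrite -(hU _ _ (rad_in C hC) cV V0 dV x x01) col_mxKu.
- move=> C C' Cs hC hC' hCs; have [_ _ est] := hZf Cs hCs.
  have h := est _ _ (rad_in C hC) (rad_in C' hC'); rewrite !dC in h.
  have E : dsubmx (usubmx (Y (col_mx U0 C) 1 - Y (col_mx U0 C') 1 - Z Cs 1 *m col_mx 0 (C - C'))) =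
      dsubmx (usubmx (Y (col_mx U0 C) 1)) - dsubmx (usubmx (Y (col_mx U0 C') 1)) -
      dsubmx (ursubmx (Z Cs 1)) *m (C - C').
    have -> : Z Cs 1 *m col_mx 0 (C - C') = col_mx (ursubmx (Z Cs 1) *m (C - C'))
        (drsubmx (Z Cs 1) *m (C - C')).
      by rewrite -{1}[Z Cs 1]submxK mul_block_col !mulmx0 !add0r.
    have eu (a b d : 'cV[R]_(r + m + m)) : usubmx (a - b - d) = usubmx a - usubmx b - usubmx d.
      by apply/matrixP => i j; rewrite !mxE.
    have ed (a b d : 'cV[R]_(r + m)) : dsubmx (a - b - d) = dsubmx a - dsubmx b - dsubmx d.
      by apply/matrixP => i j; rewrite !mxE.
    rewrite eu ed col_mxKu; congr (_ - _).
    by rewrite -{1}[ursubmx _]vsubmxK mul_col_mx col_mxKd.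
  rewrite -E; apply: le_trans (dsubmx_norm_le _) _; apply: le_trans (usubmx_norm_le _) _.
  apply: le_trans h _; apply: ler_pM; [exact: M0|by rewrite mulr_ge0// addr_ge0|by rewrite lerDl|].
  by apply: ler_pM => //; exact: lerD.
(* For [C = 0] the flow rests at the equilibrium, so the linearised equation has the constant
   coefficient [DH y0]. *)
- have n0 : `|0 : 'cV[R]_m| <= rad by rewrite normr0 ltW.
  have [Z0 dZ _] := hZf 0 n0; apply: (constant_state_nondegenerate oD sys DU0 Z0) => x x01.
  have [_ hYx] := hY _ (rad_in 0 n0); have [_ h _] := hYx x x01.
  rewrite -DH0; have -> : y0 = Y (col_mx U0 0) x; last exact: dZ.
  by move: h; rewrite subrr normr0 mulr0 normr_le0 subr_eq0 => /eqP.
Qed.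

End profile_flow_section.

Theorem theorem2p7 (R : realType) (r m : nat) (D : set 'cV[R]_(r + m))
    (f0 f : 'cV[R]_(r + m) -> 'cV[R]_(r + m))
    (B22 : 'cV[R]_(r + m) -> 'M[R]_m)
    (Dopen : open D)
    (Hsys : structural_assumptions D f0 f B22)
    (U0 : 'cV[R]_(r + m)) (DU0 : D U0) :
  exists delta eps : R, 0 < delta /\ 0 < eps /\
    forall U1II : 'cV[R]_m, enorm (dsubmx U0 - U1II) <= delta ->
    exists Uh : R -> 'cV[R]_(r + m),
      [/\ steady_solution D f B22 U0 U1II Uh,
          enorm (derive01 (fun x => dsubmx (Uh x)) 0) <= eps,
          (forall W : R -> 'cV[R]_(r + m),
             steady_solution D f B22 U0 U1II W ->
             enorm (derive01 (fun x => dsubmx (W x)) 0) <= eps ->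
             forall x, I01 x -> W x = Uh x),
          steady_nondegenerate D f B22 U0 U1II Uh &
          spectrally_stable f0 f B22 Uh].
Proof.
have [rho rho0 spec] := spectral_near Dopen Hsys DU0.
have [rad [M [Wf [Q [[rad0 M0] hW hU est Q0]]]]] := profile_flow Dopen Hsys DU0.
have M1 : 0 < M + 1 by rewrite ltr_wpDl.
(* For [|C| <= rho / (M + 1)] the profile and its slope stay within [rho], the size required by
   [spectral_near]. *)
have e00 : 0 < rho / (M + 1) by rewrite divr_gt0.
have [e /andP[e0 ee0] [erad inj unitQ surj]] :=
  local_inverse (P := fun C => dsubmx (Wf C 1)) rad0 M0 est Q0 e00.
have ler C : `|C : 'cV[R]_m| <= e -> `|C| <= rad by move=> h; exact: le_trans h (ltW erad).
have Me (C : 'cV[R]_m) : `|C| <= e -> M * `|C| <= rho.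
  move=> hC; apply: (@le_trans _ _ ((M + 1) * e)); first by rewrite ler_pM// lerDl.
  by rewrite mulrC -ler_pdivlMr.
(* Uniqueness holds in the sup-norm ball of radius [e], which contains the Euclidean one. The
   solution must itself satisfy the Euclidean bound, so it is sought in a smaller sup-norm ball. *)
have e'0 : 0 < e / m.+1%:R by rewrite divr_gt0.
have e'e : e / m.+1%:R <= e by rewrite ler_pdivrMr//; apply: ler_peMr; [exact: ltW|rewrite ler1n].
have [d d0 hd] := surj (e / m.+1%:R) (introT andP (conj e'0 e'e)).
have one_in : 0 <= (1 : R) <= 1 by rewrite lexx ler01.
have P0 : dsubmx (Wf 0 1) = dsubmx U0.
  have n0 : `|0 : 'cV[R]_m| <= rad by rewrite normr0 ltW.
  have [_ /(_ 1 one_in)[h _]] := hW 0 n0; congr dsubmx.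
  by move: h; rewrite normr0 mulr0 normr_le0 subr_eq0 => /eqP.
exists d, e; split=> //; split=> // U1II hU1.
have [c ce Pc] : exists2 c : 'cV[R]_m, `|c| <= e / m.+1%:R & dsubmx (Wf c 1) = U1II.
  by apply: hd; rewrite P0 distrC; exact: le_trans (enorm_ge _) hU1.
have ce1 : `|c| <= e := le_trans ce e'e.
have [ode bnd] := hW c (ler c ce1).
have slope := profile_ode_slope Hsys DU0 ode.
(* Whatever solution [Psi] selects, uniqueness identifies it with the flow [Wf C]. *)
have PsiE (C : 'cV[R]_m) : `|C| <= rad -> Psi D f B22 U0 U1II C = dsubmx (Wf C 1) - U1II.
  move=> hC; rewrite /Psi; congr (dsubmx _ - _).
  apply: (hU C _ hC) => //; apply: (@xgetPex _ _ [set W | profile_ode D f B22 U0 C W]).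
  by exists (Wf C); have [] := hW C hC.
have loc (h : 'cV[R]_m) : `|h| <= rad - e -> `|c + h| <= rad.
  by move=> hh; apply: le_trans (ler_normD _ _) _; lra.
exists (Wf c); split.
- exact: (profile_steady Hsys ode).
- by rewrite slope; apply: le_trans (enorm_le _) _; rewrite mulrC -ler_pdivlMr.
(* A competitor is the profile whose parameter is its slope at 0, so equal end values give equal
   parameters by injectivity of the shooting map. *)
- move=> W sW We x /I01P x01; have odeW := steady_profile Hsys sW.
  set C := derive01 _ 0 in We odeW; have Ce : `|C| <= e := le_trans (enorm_ge _) We.
  have WE := hU C W (ler C Ce) odeW; rewrite WE//.
  have -> // : C = c; apply: inj => //; rewrite Pc -WE//.
  by case: sW.
(* [Psi] is known explicitly only for parameters of norm at most [rad], and the ball of radius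
   [rad - e] about [c] fits inside. The estimate with both base points at [c] is then a Taylor
   expansion with derivative [Q c]. *)
- have [dP JP] : differentiable (Psi D f B22 U0 U1II) c /\
      forall h, 'd (Psi D f B22 U0 U1II) c h = Q c *m h.
    apply: (@quadratic_differentiable _ _ _ _ _ _ (rad - e) M) => //; first by rewrite subr_gt0.
    move=> h hh; rewrite !PsiE ?loc ?ler// opprB addrA subrK.
    have := est (c + h) c c (loc h hh) (ler c ce1) (ler c ce1).
    by rewrite [c + h - c]addrAC subrr add0r normr0 addr0 -expr2.
  rewrite /steady_nondegenerate slope; split=> //.
  + suff : \forall C \near c, Psi_dom D f B22 U0 C by exact.
    apply/nbhs_normP; exists (rad - e); first by rewrite /= subr_gt0.
    move=> C /=; rewrite distrC => hC; exists (Wf C).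
    have hCr : `|C| <= rad by rewrite -[C](subrK c) addrC; apply: loc; exact: ltW.
    by have [] := hW C hCr.
  + by rewrite PsiE ?ler// Pc subrr.
  + rewrite (_ : Jac _ _ = Q c); first exact: unitQ.
    apply/matrixP => i j; rewrite mxE JP mxE (bigD1 j)//= big1 => [|k kj].
      by rewrite mxE !eqxx mulr1 addr0.
    by rewrite mxE (negbTE kj) mulr0.
- apply: spec; first by case: ode.
  by move=> x /bnd[h1 h2]; split; [exact: le_trans h1 (Me c ce1)|exact: le_trans h2 (Me c ce1)].
Qed.
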